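(* Let $r\in\mathbb{N}=\{1,2,\dots\}$ and let $g=(g_{ij}(x))$ be a symmetric bilinear form (possibly degenerate, of any signature) of class $C^r$ and of constant rank on a domain $U\subset\mathbb{R}^n$. Assume that at every $x\in U$ $$\sum_s\Gamma_{ij,s}v^s=0\quad\text{for all } i,j\text{ and every } v\in\mathcal{R}_g(x).$$ Then one can find functions $\Gamma^i_{jk}$ of class $C^{r-1}$ such that $\Gamma^i_{jk}=\Gamma^i_{kj}$ and $$\sum_s\left(\Gamma^s_{jk}g_{is}+\Gamma^s_{ik}g_{js}\right)=\frac{\partial g_{ij}}{\partial x^k}\quad\text{for all } i,j,k.$$ Moreover, there exist (local) flat coordinates for $g$ of class $C^{r+1}$ if and only if $R_{ijk\ell}=0$ for all $i,j,k,\ell$, where $$R_{ijk\ell}:=\sum_s g_{is}\left(\frac{\partial \Gamma^s_{j\ell}}{\partial x^k}-\frac{\partial\Gamma^s_{jk}}{\partial x^\ell}+\sum_a\left(\Gamma^s_{ka}\Gamma^a_{\ell j}-\Gamma^s_{\ell a}\Gamma^a_{jk}\right)\right),$$ and where for $r=1$ the condition $R_{ijk\ell}=0$ is understood in the weak sense (see context).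
   Context: All indices run from $1$ to $n$. Notation: $\Gamma_{ij,s}:=\tfrac12\left(\frac{\partial g_{js}}{\partial x^i}+\frac{\partial g_{is}}{\partial x^j}-\frac{\partial g_{ij}}{\partial x^s}\right)$ and $\mathcal{R}_g(x):=\{v\in T_xU\mid g(v,\cdot)=0\}$. The form $g$ is a covariant tensor field; a local coordinate system is flat for $g$ if the components of $g$ in it are constant; existence of flat coordinates is meant locally, in a neighbourhood of every point of $U$. The condition $R_{ijk\ell}=0$ does not depend on the choice of the symmetric functions $\Gamma^i_{jk}$ satisfying the displayed linear system. Weak sense for $r=1$ (when $\Gamma^i_{jk}$ is only continuous): the condition $R_{ijk\ell}=0$ means that for all $j,k,\ell\in\{1,\dots,n\}$ and every smooth one-form $u=\sum_i u_i\,dx^i$ with compact support such that $\mathcal{R}_g\subseteq\operatorname{Kernel}(u)$, $$\int\sum_s\left(-\Gamma^s_{j\ell}\frac{\partial u_s}{\partial x^k}+\Gamma^s_{jk}\frac{\partial u_s}{\partial x^\ell}+u_s\sum_a\left(\Gamma^s_{ka}\Gamma^a_{\ell j}-\Gamma^s_{\ell a}\Gamma^a_{jk}\right)\right)dx=0.$$ This condition too is independent of the choice of $\Gamma^i_{jk}$.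
   Formalization: For r=1 the compactly supported one-forms u in the weak condition are taken of class C^1 instead of smooth: for degenerate g of class C^1 there may be no nonzero C^∞ form vanishing on R_g, and the equivalence with C^∞ forms then fails. *)

(* Defs.v *)
From HB Require Import structures.
From mathcomp Require Import all_boot all_order all_algebra.
From mathcomp Require Import all_classical all_reals all_analysis.
Set Implicit Arguments.
Unset Strict Implicit.
Unset Printing Implicit Defensive.
Import Order.TTheory GRing.Theory Num.Theory.
Import numFieldNormedType.Exports.
Local Open Scope classical_set_scope.
Local Open Scope ring_scope.

Definition partial (R : realType) (n : nat) (k : 'I_n) (f : 'rV[R]_n -> R)
    (x : 'rV[R]_n) : R :=
  'D_(delta_mx 0 k : 'rV[R]_n) f x.

(* Meant for open U: continuity and derivability are those of the total
   function f at the points of U, which then depend only on f on U. *)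
Fixpoint Ck (R : realType) (n : nat) (U : set 'rV[R]_n) (k : nat)
    (f : 'rV[R]_n -> R) : Prop :=
  (forall x, U x -> {for x, continuous f}) /\
  match k with
  | 0 => True
  | k'.+1 => forall i : 'I_n,
      (forall x, U x -> derivable f x (delta_mx 0 i : 'rV[R]_n)) /\
      Ck U k' (partial i f)
  end.

(* Iterated Lebesgue integral over R^n. It is only used for continuous
   compactly supported integrands, where it is the Lebesgue integral by
   Fubini's theorem. *)
Fixpoint rVintegral (R : realType) (n : nat) : ('rV[R]_n -> R) -> R :=
  match n with
  | 0 => fun f => f 0
  | m.+1 => fun f =>
      \int[@lebesgue_measure R]_t
        rVintegral (fun y : 'rV[R]_m => f (row_mx (t%:M : 'rV[R]_1) y))
  end.

Definition domain_set (R : realType) (n : nat) (U : set 'rV[R]_n) : Prop :=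
  [/\ open U, connected U & U !=set0].

Section BilinearForm.
Variables (R : realType) (n : nat).
Variables (U : set 'rV[R]_n) (g : 'rV[R]_n -> 'M[R]_n).

Definition symmetric_on : Prop := forall x, U x -> (g x)^T = g x.

Definition form_Ck (r : nat) : Prop :=
  forall i j : 'I_n, Ck U r (fun x => g x i j).

Definition constant_rank : Prop :=
  forall x y, U x -> U y -> \rank (g x) = \rank (g y).

Definition radical (x : 'rV[R]_n) : set 'rV[R]_n :=
  [set v | forall w : 'rV[R]_n, v *m g x *m w^T = 0].

Definition christoffel1 (i j s : 'I_n) (x : 'rV[R]_n) : R :=
  2^-1 * (partial i (fun y => g y j s) x + partial j (fun y => g y i s) x
          - partial s (fun y => g y i j) x).

(* [Gam s j k] stands for the function with upper index s and lower indices
   j, k. *)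
Definition adapted_symbols (r : nat)
    (Gam : 'I_n -> 'I_n -> 'I_n -> 'rV[R]_n -> R) : Prop :=
  [/\ forall s j k, Ck U r.-1 (Gam s j k),
      forall s j k x, U x -> Gam s j k x = Gam s k j x
    & forall i j k x, U x ->
        \sum_s (Gam s j k x * g x i s + Gam s i k x * g x j s)
        = partial k (fun y => g y i j) x].

Definition curvature (Gam : 'I_n -> 'I_n -> 'I_n -> 'rV[R]_n -> R)
    (i j k l : 'I_n) (x : 'rV[R]_n) : R :=
  \sum_s g x i s *
    (partial k (Gam s j l) x - partial l (Gam s j k) x
     + \sum_a (Gam s k a x * Gam a l j x - Gam s l a x * Gam a j k x)).

(* One-forms with compact support in U annihilating the radical of g.
   They are required to be C^1, not C^infinity: for g of class C^1 the radical
   is only a C^1 distribution, and it can happen that 0 is the only C^infinity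
   one-form vanishing on it. *)
Definition test_form (u : 'I_n -> 'rV[R]_n -> R) : Prop :=
  let supp := closure [set x | exists s, u s x != 0] in
  [/\ forall s, Ck U 1 (u s), compact supp, supp `<=` U
    & forall x v, U x -> radical x v -> \sum_s u s x * v 0 s = 0].

Definition weak_curvature_zero
    (Gam : 'I_n -> 'I_n -> 'I_n -> 'rV[R]_n -> R) : Prop :=
  forall (j k l : 'I_n) (u : 'I_n -> 'rV[R]_n -> R), test_form u ->
    rVintegral (fun x => \sum_s
      (- Gam s j l x * partial k (u s) x + Gam s j k x * partial l (u s) x
       + u s x * \sum_a (Gam s k a x * Gam a l j x - Gam s l a x * Gam a j k x)))
    = 0.

Definition curvature_zero (r : nat)
    (Gam : 'I_n -> 'I_n -> 'I_n -> 'rV[R]_n -> R) : Prop :=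
  if r == 1%N then weak_curvature_zero Gam
  else forall i j k l x, U x -> curvature Gam i j k l x = 0.

(* Around every p in U there is a C^m diffeomorphism phi : V -> W between open
   sets, with inverse psi, such that the components of g in the coordinates
   y = phi x are constant. *)
Definition has_flat_coordinates (m : nat) : Prop :=
  forall p, U p ->
  exists (V W : set 'rV[R]_n) (phi psi : 'rV[R]_n -> 'rV[R]_n) (c : 'M[R]_n),
    [/\ [/\ open V, V p, V `<=` U & open W],
        (forall x, V x -> W (phi x) /\ psi (phi x) = x),
        (forall y, W y -> V (psi y) /\ phi (psi y) = y),
        (forall i : 'I_n, Ck V m (fun x => phi x 0 i) /\
                          Ck W m (fun y => psi y 0 i))
      & forall (y : 'rV[R]_n) (a b : 'I_n), W y ->
          \sum_i \sum_j g (psi y) i j * partial a (fun z => psi z 0 i) y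
                                      * partial b (fun z => psi z 0 j) y
          = c a b].

End BilinearForm.

(* Main.v *)
(* Near a point p choose indices f such that the principal minor G = g_ff of size
   m = rank g is invertible, and let L = g_{.f} G^-1, so that g = L G L^T. The
   columns of L span the annihilator of the radical, and with (Gamma_k)_{as} =
   Gamma^a_{ks} one has d_k L = Gamma_k^T L - L N_k, where N_k = (Gamma_k^T L)_f
   is only of class C^(r-1). Tested on chi L, the weak curvature condition says
   that the connection d - N is flat in the sense of distributions. Solving
   d Z = N Z along the rays issued from p then gives a parallel frame Z; the
   columns of L Z are closed one-forms with primitives of class C^(r+1), and
   G - Z G(p) Z^T satisfies a homogeneous linear equation, hence vanishes. So
   g = (L Z) G(p) (L Z)^T, and the primitives, completed by some of the x^i, are
   flat coordinates.

   Conversely, let J be the Jacobian matrix of a flat chart, g = J^T c J. Koszul's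
   argument gives c J Gamma_k = c d_k J, and a test form supported in the chart
   is u = y c J; the integrand of the weak condition becomes
   sum c_ab (d_l y_a d_k J_bj - d_k y_a d_l J_bj), which integrates to zero even
   if J is only C^1. A partition of unity concludes. For r > 1 the weak and
   the strong conditions are equivalent by integration by parts. *)
Require Import Defs.
From HB Require Import structures.
From mathcomp Require Import all_boot all_order all_algebra.
From mathcomp Require Import all_classical all_reals all_analysis.
From mathcomp Require Import ring lra.
Import Order.TTheory GRing.Theory Num.Theory.
Import numFieldNormedType.Exports.
Set Implicit Arguments.
Unset Strict Implicit.
Unset Printing Implicit Defensive.
Local Open Scope classical_set_scope.
Local Open Scope ring_scope.

(** * Derivatives and continuity in R^n *)

Notation bas k := (delta_mx 0 k : 'rV__).

Section EpsDelta.
Variable R : realType.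

(** The case r = 1 dictates the form of the argument. There N_k is only continuous, so flatness
    cannot be stated by derivatives, and regularizing the connection would not help: curvature is
    quadratic, so a mollified flat connection need not be flat. Flatness is therefore read as a
    linear relation d N = C in which the bracket C is a given continuous two-form. This relation
    survives mollifying N and C separately, and in the limit Poincare's homotopy formula yields a
    differentiable B with d_k B = N_k - Q_k, where Q comes from C. When Z is compared on two
    neighbouring rays, the increment of B, corrected by Q, replaces the term h N_k, which cannot be
    differentiated along a ray. Test forms are only C^1, so cutoffs need not be smoother, and all
    bumps are built from max(t, 0)^2. One construction serves every r, since the strong condition
    enters only through the weak one. In the other direction c may be degenerate, so the identities
    for J are kept multiplied by c. *)

Lemma nbhs_epsP (V : normedModType R) (x : V) (P : set V) :
  nbhs x P <-> exists2 r : R, 0 < r & forall y, `|y - x| < r -> P y.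
Proof.
split.
  move/nbhs_normP => [r /= r0 H]; exists r => // y yx; apply: H.
  by rewrite /ball_/= distrC.
move=> [r r0 H]; apply/nbhs_normP; exists r => //= y /=; rewrite distrC; exact: H.
Qed.

Lemma continuous_epsP (V W : normedModType R) (f : V -> W) (x : V) :
  {for x, continuous f} <->
  forall e : R, 0 < e -> exists2 r : R, 0 < r &
    forall y, `|y - x| < r -> `|f y - f x| <= e.
Proof.
split.
  move=> /cvgrPdist_le H e e0; have /nbhs_epsP [r r0 Hr] := H _ e0.
  by exists r => // y /Hr; rewrite distrC.
move=> H; apply/cvgrPdist_le => e e0; have [r r0 Hr] := H _ e0.
by apply/nbhs_epsP; exists r => // y /Hr; rewrite distrC.
Qed.

(** Multiplying out the difference quotient admits [h = 0] and turns later proofs of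
    differentiability into plain estimates. *)
Lemma is_derive_epsP (V : normedModType R) (f : V -> R) (x v : V) (d : R) :
  is_derive x v f d <->
  forall e, 0 < e -> exists2 r, 0 < r &
    forall h : R, `|h| < r -> `|f (x + h *: v) - f x - h * d| <= e * `|h|.
Proof.
split.
  move=> [dv <-] e e0.
  move: dv => /cvgrPdist_le /(_ e e0).
  rewrite near_withinE => /nbhs_epsP[r r0 Hr]; exists r => // h hr.
  have [->|h0] := eqVneq h 0; first by rewrite scale0r addr0 mul0r subr0 subrr normr0 mulr0.
  have := Hr h; rewrite subr0 => /(_ hr h0) /=.
  rewrite [h *: v + x]addrC => H.
  have -> : f (x + h *: v) - f x - h * 'D_v f x =
     - h * ('D_v f x - h^-1 *: (f (x + h *: v) - f x)).
    by rewrite /GRing.scale/=; field.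
  by rewrite normrM normrN mulrC ler_wpM2r.
move=> H.
have cv : (fun h => h^-1 *: ((f \o shift x) (h *: v) - f x)) @ 0^' --> d.
  apply/cvgrPdist_le => e e0; have [r r0 Hr] := H _ e0.
  rewrite near_withinE; apply/nbhs_epsP; exists r => // h; rewrite subr0 => /Hr {}Hr h0 /=.
  rewrite [h *: v + x]addrC.
  have -> : d - h^-1 *: (f (x + h *: v) - f x) =
     - h^-1 * (f (x + h *: v) - f x - h * d).
    by rewrite /GRing.scale/=; field.
  rewrite normrM normrN normfV mulrC ler_pdivrMr ?normr_gt0//.
by split; [apply/cvg_ex; exists d|apply: cvg_lim].
Qed.

Lemma is_derive_line (V : normedModType R) (f : V -> R) (x v : V) (t d : R) :
  is_derive (x + t *: v) v f d -> is_derive (t:R) (1:R) (fun t => f (x + t *: v)) d.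
Proof.
move=> /is_derive_epsP H; apply/is_derive_epsP => e /H[r r0 Hr]; exists r => // h hr.
by rewrite scalerDl addrA scaler1; exact: Hr.
Qed.

(** The derivative is assumed on the symmetric interval of radius [|h|], which spares callers a case
    distinction on the sign of [h]. *)
Lemma MVT_line (V : normedModType R) (f : V -> R) (x v : V) (D : V -> R) (h : R) :
  (forall t : R, `|t| <= `|h| -> is_derive (x + t *: v) v f (D (x + t *: v))) ->
  exists2 s, `|s| <= `|h| & f (x + h *: v) - f x = h * D (x + s *: v).
Proof.
move=> H.
have d (t : R) : `|t| <= `|h| -> is_derive (t:R) (1:R) (fun t => f (x + t *: v)) (D (x + t *: v)).
  by move=> /H; exact: is_derive_line.
have c (t : R) : `|t| <= `|h| -> {for t, continuous (fun t : R => f (x + t *: v))}.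
  move=> /d [dt _]; apply: differentiable_continuous; exact/derivable1_diffP.
have [h0|h0] := leP 0 h.
  have [||s] := @MVT_segment R (fun t : R => f (x + t *: v)) (fun t : R => D (x + t *: v)) 0 h h0.
  - move=> t; rewrite in_itv/= => /andP[t0 th]; apply: d.
    by rewrite !ger0_norm// ltW.
  - apply: continuous_in_subspaceT => t; rewrite inE/= in_itv/= => /andP[t0 th].
    by apply: c; rewrite !ger0_norm.
  - rewrite in_itv/= => /andP[t0 th]; rewrite scale0r addr0 subr0 => ->.
    by exists s; [rewrite !ger0_norm|rewrite mulrC].
have [||s] := @MVT_segment R (fun t : R => f (x + t *: v)) (fun t : R => D (x + t *: v)) h 0 (ltW h0).
- move=> t; rewrite in_itv/= => /andP[t0 th]; apply: d.
  by rewrite !ltr0_norm// lerN2 ltW.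
- apply: continuous_in_subspaceT => t; rewrite inE/= in_itv/= => /andP[t0 th].
  by apply: c; rewrite (ltr0_norm h0) ler0_norm// lerN2.
- rewrite in_itv/= => /andP[t0 th]; rewrite scale0r addr0 sub0r => Hs.
  exists s; first by rewrite (ltr0_norm h0) ler0_norm// lerN2.
  by rewrite -opprB Hs; ring.
Qed.

Lemma norm_mxE m n (A : 'M[R]_(m, n)) :
  `|A| = \big[Num.max/0]_ij `|A ij.1 ij.2|.
Proof. by rewrite [LHS]/Num.norm/= mx_normrE. Qed.

Lemma norm_mx_leP m n (A : 'M[R]_(m, n)) (M : R) : 0 <= M ->
  (`|A| <= M <-> forall i j, `|A i j| <= M).
Proof.
move=> M0; rewrite norm_mxE; split.
  by move=> /bigmax_leP[_ H] i j; exact: (H (i, j)).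
by move=> H; apply/bigmax_leP; split => // -[i j] _; exact: H.
Qed.

Lemma norm_mx_coord m n (A : 'M[R]_(m, n)) i j : `|A i j| <= `|A|.
Proof. by move: i j; apply/norm_mx_leP. Qed.

Lemma norm_mx_ltP m n (A : 'M[R]_(m, n)) (M : R) : 0 < M ->
  (`|A| < M <-> forall i j, `|A i j| < M).
Proof.
move=> M0; split.
  by move=> H i j; apply: le_lt_trans (norm_mx_coord _ _ _) H.
by move=> H; rewrite norm_mxE; apply/bigmax_ltP; split => // -[i j] _; exact: H.
Qed.

Lemma norm_bas n (k : 'I_n) : `|bas k : 'rV[R]_n| = 1.
Proof.
apply/eqP; rewrite eq_le; apply/andP; split.
  apply/norm_mx_leP => // i j; rewrite mxE; case: (_ && _); rewrite ?normr1 ?normr0//.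
by have := norm_mx_coord (bas k : 'rV[R]_n) 0 k; rewrite mxE !eqxx normr1.
Qed.

Lemma norm_bas_scale n (k : 'I_n) h : `|h *: (bas k : 'rV[R]_n)| = `|h|.
Proof. by rewrite normrZ norm_bas mulr1. Qed.

(** The norm is the maximum of the entries, which is not submultiplicative; hence the dimension
    factors in all later constants. *)
Lemma norm_mulmx m n p (A : 'M[R]_(m, n)) (B : 'M[R]_(n, p)) :
  `|A *m B| <= n%:R * (`|A| * `|B|).
Proof.
apply/norm_mx_leP => [|i j]; first by rewrite !mulr_ge0.
rewrite mxE (le_trans (ler_norm_sum _ _ _))//.
rewrite (@le_trans _ _ (\sum_(k < n) `|A| * `|B|))//.
  by apply: ler_sum => k _; rewrite normrM ler_pM// norm_mx_coord.
by rewrite sumr_const card_ord mulr_natl.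
Qed.

End EpsDelta.

Section Calculus.
Variable R : realType.

(** [N] is abstract because there are two uses: as the distance to a point, and as the identity on
    radii when [P i d] itself quantifies over all pairs of points at distance at most [d]. *)
Lemma common_radius (I : finType) (T : Type) (N : T -> R) (P : I -> T -> Prop) :
  (forall i, exists2 r : R, 0 < r & forall y, N y < r -> P i y) ->
  exists2 r : R, 0 < r & forall y, N y < r -> forall i, P i y.
Proof.
move=> H.
have /choice[r Hr] : forall i, exists r : R, 0 < r /\ forall y, N y < r -> P i y.
  by move=> i; have [r r0 Hr] := H i; exists r.
exists (\big[Num.min/1]_i r i).
  by apply: lt_bigmin => // i _; have [] := Hr i.
move=> y Ny i; have [_] := Hr i; apply; apply: lt_le_trans Ny _.
exact: bigmin_le_cond.
Qed.

Lemma is_derive_near (V : normedModType R) (f g : V -> R) (x v : V) (d : R) :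
  (\forall y \near x, f y = g y) -> is_derive x v f d -> is_derive x v g d.
Proof.
move=> /nbhs_epsP[r r0 fg] /is_derive_epsP H; apply/is_derive_epsP => e e0.
have [s s0 Hs] := H _ e0.
have n0 : 0 < `|v| + 1 by rewrite ltr_wpDl.
exists (Num.min s (r / (`|v| + 1))); first by rewrite lt_min s0 divr_gt0.
move=> h; rewrite lt_min => /andP[hs]; rewrite ltr_pdivlMr// => hr.
rewrite -!fg ?subrr ?normr0//; first exact: Hs.
rewrite addrAC subrr add0r normrZ (le_lt_trans _ hr)// ler_wpM2l//.
by rewrite lerDl.
Qed.

Lemma continuous_near (V : normedModType R) (f g : V -> R) (x : V) : (\forall y \near x, f y = g y) ->
  {for x, continuous f} -> {for x, continuous g}.
Proof.
move=> /nbhs_epsP[s s0 Hs] /continuous_epsP H; apply/continuous_epsP => e /H[r r0 Hr].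
exists (Num.min r s); first by rewrite lt_min r0.
move=> y; rewrite lt_min => /andP[/Hr yr /Hs ys].
by rewrite -ys -Hs// subrr normr0.
Qed.

Lemma is_derive_ext (V : normedModType R) (f g : V -> R) (x v : V) (d : R) :
  f =1 g -> is_derive x v f d -> is_derive x v g d.
Proof. by move=> /funext ->. Qed.

Lemma continuous_ext (V : normedModType R) (f g : V -> R) (x : V) :
  f =1 g -> {for x, continuous f} -> {for x, continuous g}.
Proof. by move=> /funext ->. Qed.

Section Rules.
Variables (V : normedModType R) (x v : V).
Implicit Types (f g : V -> R).

Lemma is_derive_add f g a b : is_derive x v f a -> is_derive x v g b ->
  is_derive x v (fun y => f y + g y) (a + b).
Proof. by move=> ? ?; exact: is_deriveD. Qed.

Lemma is_derive_sub f g a b : is_derive x v f a -> is_derive x v g b ->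
  is_derive x v (fun y => f y - g y) (a - b).
Proof. by move=> ? ?; exact: is_deriveB. Qed.

Lemma is_derive_mul f g a b : is_derive x v f a -> is_derive x v g b ->
  is_derive x v (fun y => f y * g y) (a * g x + f x * b).
Proof.
move=> ? ?; have := @is_deriveM _ _ _ _ _ _ _ _ _.
move=> /(_ _ _ f g x v a b); rewrite addrC [_ *: a]mulrC; exact.
Qed.

Lemma is_derive_const c : is_derive x v (fun=> c : R) 0.
Proof. exact: is_derive_cst. Qed.

Lemma is_derive_bigsum (I : Type) (s : seq I) (P : pred I) (f : I -> V -> R) (d : I -> R) :
  (forall i, P i -> is_derive x v (f i) (d i)) ->
  is_derive x v (fun y => \sum_(i <- s | P i) f i y) (\sum_(i <- s | P i) d i).
Proof.
move=> H; elim: s => [|i s IH].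
  under eq_fun do rewrite big_nil; rewrite big_nil; exact: is_derive_const.
under eq_fun do rewrite big_cons; rewrite big_cons; case: ifP => // /H ?.
exact: is_derive_add.
Qed.

Lemma is_derive_inv f a : f x != 0 -> is_derive x v f a ->
  is_derive x v (fun y => (f y)^-1) (- (f x) ^- 2 * a).
Proof.
move=> fx0 [df <-]; split; first exact: derivableV.
exact: deriveV.
Qed.

End Rules.

Lemma is_derive_unique (V : normedModType R) (f : V -> R) (x v : V) a b :
  is_derive x v f a -> is_derive x v f b -> a = b.
Proof. by move=> [_ <-] [_ <-]. Qed.

Lemma is_derive_partial n (f : 'rV[R]_n -> R) x k d :
  is_derive x (bas k) f d -> partial k f x = d.
Proof. by move=> [_ <-]. Qed.

Lemma is_derive_coord n (x v : 'rV[R]_n) i :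
  is_derive x v (fun y : 'rV[R]_n => y 0 i) (v 0 i).
Proof.
apply/is_derive_epsP => e e0; exists 1 => // h _.
rewrite !mxE (_ : _ - _ - _ = 0); last by ring.
by rewrite normr0 mulr_ge0// ltW.
Qed.

Section StrictDifferentiability.
Variables (n : nat) (U : set 'rV[R]_n) (f : 'rV[R]_n -> R).
Variable D : 'I_n -> 'rV[R]_n -> R.
Hypothesis Uo : open U.
Hypothesis fD : forall y i, U y -> is_derive y (bas i) f (D i y).

(** Walk from [y] to [z] changing one coordinate at a time and apply the mean value theorem on each
    edge. That both endpoints may vary is what the inverse function theorem and the symmetry of
    second derivatives need. *)
Lemma strict_diff x : U x -> (forall i, {for x, continuous (D i)}) ->
  forall e, 0 < e -> exists2 r, 0 < r & forall y z,
   `|y - x| < r -> `|z - x| < r ->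
   `|f z - f y - \sum_i (z - y) 0 i * D i x| <= e * `|z - y|.
Proof.
move=> Ux Dc e e0.
have n0 : 0 < (n%:R + 1 : R) by rewrite ltr_wpDl.
have [r1 r10 Hr1] : exists2 r : R, 0 < r & forall y, `|y - x| < r -> U y.
  by apply/nbhs_epsP; exact: open_nbhs_nbhs.
have [r2 r20 Hr2] : exists2 r : R, 0 < r & forall y, `|y - x| < r ->
    forall i, `|D i y - D i x| <= e / (n%:R + 1).
  apply: (common_radius (N := fun y => `|y - x|)) => i.
  by move: (Dc i) => /continuous_epsP/(_ (e / (n%:R + 1))); apply; rewrite divr_gt0.
(* The corners [w j] stay within [r] of [x] and an edge is shorter than [2 * r], so the whole path
   stays within [3 * r]. *)
set r := Num.min r1 r2 / 3.
have rr1 : 3 * r <= r1 by rewrite /r mulrC divfK// ge_min lexx.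
have rr2 : 3 * r <= r2 by rewrite /r mulrC divfK// ge_min lexx orbT.
have r0 : 0 < r by rewrite divr_gt0// lt_min r10.
exists r => // y z yx zx.
pose w (j : nat) : 'rV[R]_n := \row_i (if (i < j)%N then z 0 i else y 0 i).
have w0 : w 0%N = y by apply/rowP => i; rewrite mxE.
have wn : w n = z by apply/rowP => i; rewrite mxE ltn_ord.
have wS (j : 'I_n) : w j.+1 = w j + (z - y) 0 j *: bas j.
  apply/rowP => i; rewrite !mxE eqxx/= ltnS.
  have [->|ij] := eqVneq i j; first by rewrite leqnn ltnn mulr1 addrC subrK.
  have ij' : (i == j :> nat) = false by exact/negbTE.
  by rewrite leq_eqVlt ij' mulr0 addr0.
have wb j (i : 'I_n) : `|(w j - x) 0 i| < r.
  rewrite !mxE; case: ifP => _.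
    by have := zx; move=> /(norm_mx_ltP _ r0)/(_ 0 i); rewrite !mxE.
  by have := yx; move=> /(norm_mx_ltP _ r0)/(_ 0 i); rewrite !mxE.
have zyb i : `|(z - y) 0 i| < 2 * r.
  have -> : (z - y) 0 i = (z - x) 0 i - (y - x) 0 i by rewrite !mxE; ring.
  rewrite (le_lt_trans (ler_normB _ _))//.
  move: yx zx => /(norm_mx_ltP _ r0)/(_ 0 i) a /(norm_mx_ltP _ r0)/(_ 0 i) b.
  lra.
have Hb (j : 'I_n) s : `|s| <= `|(z - y) 0 j| -> `|w j + s *: bas j - x| < 3 * r.
  move=> sj; rewrite addrAC.
  have : `|w j - x| < r by apply/norm_mx_ltP => // a b; rewrite ord1.
  have := norm_bas_scale j s; have := zyb j => a b c.
  apply: le_lt_trans (ler_normD _ _) _; lra.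
rewrite -{1}wn -{1}w0 -(telescope_sumr (fun j => f (w j)))// big_mkord.
rewrite -sumrB (le_trans (ler_norm_sum _ _ _))//.
have -> : e * `|z - y| = \sum_(i < n) (e / n%:R * `|z - y|).
  rewrite sumr_const card_ord -[RHS]mulr_natr.
  (* In dimension 0 the division by [n] is by zero, but then [z = y] and both sides vanish. *)
  case: (n) z y {w w0 wn wS wb zyb Hb yx zx}  => [|m] z y.
    by rewrite mulr0 (_ : z - y = 0) ?normr0 ?mulr0//; apply/rowP => -[].
  by rewrite mulrAC divfK// pnatr_eq0.
apply: ler_sum => j _; rewrite wS.
have [|s sj ->] := @MVT_line R _ f (w j) (bas j) (D j) ((z - y) 0 j).
  by move=> t /Hb tb; apply: fD; apply: Hr1; apply: lt_le_trans tb rr1.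
rewrite -mulrBr normrM mulrC.
apply: (@le_trans _ _ (e / (n%:R + 1) * `|z - y|)).
  apply: ler_pM => //; last exact: norm_mx_coord.
  by apply: Hr2; apply: lt_le_trans (Hb _ _ sj) rr2.
have n1 : 0 < n%:R :> R by rewrite ltr0n (leq_ltn_trans _ (ltn_ord j)).
by rewrite ler_wpM2r// ler_pM2l// lef_pV2 ?posrE// lerDl.
Qed.

Lemma diff_at x : U x -> (forall i, {for x, continuous (D i)}) ->
  forall e, 0 < e -> exists2 r, 0 < r & forall z, `|z - x| < r ->
   `|f z - f x - \sum_i (z - x) 0 i * D i x| <= e * `|z - x|.
Proof.
move=> Ux Dc e e0; have [r r0 Hr] := strict_diff Ux Dc e0.
by exists r => // z zx; apply: Hr => //; rewrite subrr normr0.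
Qed.

Lemma diff_continuous x : U x -> (forall i, {for x, continuous (D i)}) ->
  {for x, continuous f}.
Proof.
move=> Ux Dc; apply/continuous_epsP => e e0.
have [r r0 Hr] := diff_at Ux Dc ltr01.
pose M := 1 + \sum_i `|D i x|.
have M0 : 0 < M by rewrite ltr_pwDl// sumr_ge0.
exists (Num.min r (e / M)); first by rewrite lt_min r0 divr_gt0.
move=> z; rewrite lt_min => /andP[zr]; rewrite ltr_pdivlMr// => ze.
rewrite -(subrK (\sum_i (z - x) 0 i * D i x) (f z - f x)).
apply: le_trans (ler_normD _ _) _; apply: le_trans (ltW ze).
rewrite mulrDr mulr1; apply: lerD; first by have := Hr _ zr; rewrite mul1r.
rewrite mulr_sumr (le_trans (ler_norm_sum _ _ _))//; apply: ler_sum => i _.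
by rewrite normrM ler_wpM2r// norm_mx_coord.
Qed.

End StrictDifferentiability.

Lemma chain_rule n (f : 'rV[R]_n -> R) (c : 'I_n -> R) (V : normedModType R)
   (p : V -> 'rV[R]_n) (y v : V) (c' : 'I_n -> R) :
  (forall e, 0 < e -> exists2 r, 0 < r & forall z, `|z - p y| < r ->
   `|f z - f (p y) - \sum_i (z - p y) 0 i * c i| <= e * `|z - p y|) ->
  (forall i, is_derive y v (fun t => p t 0 i) (c' i)) ->
  is_derive y v (fun t => f (p t)) (\sum_i c' i * c i).
Proof.
move=> fd pd; apply/is_derive_epsP => e e0.
pose M := 1 + \sum_i `|c' i|.
have M0 : 0 < M by rewrite ltr_pwDl// sumr_ge0.
pose N := 1 + \sum_i `|c i|.
have N0 : 0 < N by rewrite ltr_pwDl// sumr_ge0.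
have eM : 0 < e / 2 / M by rewrite !divr_gt0.
have eN : 0 < e / 2 / N by rewrite !divr_gt0.
have [r1 r10 Hr1] := fd _ eM.
(* The bound 1 in the minimum gives [p] the Lipschitz constant [M]; the other bound controls the
   linear part of [f]. *)
have [r2 r20 Hr2] : exists2 r : R, 0 < r & forall h, `|h| < r ->
    forall i, `|p (y + h *: v) 0 i - p y 0 i - h * c' i| <= Num.min 1 (e / 2 / N) * `|h|.
  apply: (common_radius (N := fun h : R => `|h|)) => i.
  by move: (pd i) => /is_derive_epsP/(_ (Num.min 1 (e / 2 / N))); apply; rewrite lt_min ltr01.
exists (Num.min r2 (r1 / M)); first by rewrite lt_min r20 divr_gt0.
move=> h; rewrite lt_min => /andP[hr2]; rewrite ltr_pdivlMr// => hr1.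
have Hc := Hr2 _ hr2.
have pM : `|p (y + h *: v) - p y| <= M * `|h|.
  apply/norm_mx_leP => [|i j]; first by rewrite mulr_ge0// ltW.
  rewrite ord1 !mxE -(subrK (h * c' j) (p _ 0 j - _)).
  apply: le_trans (ler_normD _ _) _; rewrite mulrDl; apply: lerD.
    by apply: le_trans (Hc j) _; rewrite ler_wpM2r// ge_min lexx.
  rewrite normrM mulrC ler_wpM2r// (bigD1 j)//= lerDl sumr_ge0//.
have /Hr1 {}Hr1 : `|p (y + h *: v) - p y| < r1.
  by apply: le_lt_trans pM _; rewrite mulrC.
rewrite -(subrK (\sum_i (p (y + h *: v) - p y) 0 i * c i) (f (p (y + h *: v)) - f (p y))).
rewrite -addrA; apply: le_trans (ler_normD _ _) _.
have -> : e * `|h| = e / 2 / M * (M * `|h|) + e / 2 / N * `|h| * N.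
  by field; rewrite !gt_eqF.
apply: lerD; first by apply: le_trans Hr1 _; rewrite ler_wpM2l// ltW.
rewrite mulr_sumr -sumrB (le_trans (ler_norm_sum _ _ _))//.
rewrite mulrDr mulr1 mulr_sumr ler_wpDl//; first by rewrite mulr_ge0// ltW.
apply: ler_sum => i _; rewrite mulrA -mulrBl normrM ler_wpM2r// !mxE.
by apply: le_trans (Hc i) _; rewrite ler_wpM2r// ge_min lexx orbT.
Qed.

End Calculus.

(** * Functions of class C^k *)

Section CkTheory.
Variables (R : realType) (n : nat).
Implicit Types (U V : set 'rV[R]_n) (f g : 'rV[R]_n -> R) (k : nat).

Lemma open_near U x : open U -> U x -> \forall y \near x, U y.
Proof. by move=> Uo Ux; exact: open_nbhs_nbhs. Qed.

Lemma Ck_cont U k f : Ck U k f -> forall x, U x -> {for x, continuous f}.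
Proof. by case: k => [|k] []. Qed.

Lemma Ck_deriv U k f : Ck U k.+1 f -> forall i x, U x ->
  is_derive x (bas i) f (partial i f x).
Proof. by case=> _ H i x Ux; have [/(_ _ Ux)] := H i; split. Qed.

Lemma Ck_partial U k f i : Ck U k.+1 f -> Ck U k (partial i f).
Proof. by case=> _ H; have [] := H i. Qed.

Lemma Ck_subset U V k f : V `<=` U -> Ck U k f -> Ck V k f.
Proof.
move=> VU; elim: k f => [|k IH] f [c H]; split; try by move=> x /VU /c.
  by [].
move=> i; have [d Hd] := H i; split; first by move=> x /VU /d.
exact: IH.
Qed.

Lemma Ck_ext U k f g : open U -> (forall x, U x -> f x = g x) -> Ck U k f -> Ck U k g.
Proof.
move=> Uo; elim: k f g => [|k IH] f g fg Hf.
  split => // x Ux; apply: continuous_near (Ck_cont Hf Ux).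
  by apply: filterS (open_near Uo Ux) => y /fg.
have near x : U x -> \forall y \near x, f y = g y.
  by move=> Ux; apply: filterS (open_near Uo Ux) => y /fg.
have gd i x : U x -> is_derive x (bas i) g (partial i f x).
  by move=> Ux; apply: is_derive_near (near _ Ux) _; exact: Ck_deriv Hf _ _ Ux.
split=> [x Ux|i]; first exact: continuous_near (near _ Ux) (Ck_cont Hf Ux).
split; first by move=> x /(gd i)[].
apply: IH (Ck_partial i Hf) => x Ux; apply/esym.
exact: is_derive_partial (gd _ _ Ux).
Qed.

(** The continuity of [f] demanded by [Ck] is not assumed: continuous partial derivatives imply
    it. *)
Lemma Ck_build U k f (D : 'I_n -> 'rV[R]_n -> R) : open U ->
  (forall x i, U x -> is_derive x (bas i) f (D i x)) ->
  (forall i, Ck U k (D i)) -> Ck U k.+1 f.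
Proof.
move=> Uo fD HD; split.
  move=> x Ux; apply: (diff_continuous Uo fD) => // i.
  exact: Ck_cont (HD i) _ Ux.
move=> i; split; first by move=> x /(fD _ i)[].
by apply: Ck_ext (HD i) => // x /(fD _ i)/is_derive_partial.
Qed.

Lemma Ck0 U f : (forall x, U x -> {for x, continuous f}) -> Ck U 0 f.
Proof. by split. Qed.

(** Being of class C^k is local; this is how functions are extended by zero off a compact set. *)
Lemma Ck_union U V k f : Ck U k f -> Ck V k f -> Ck (U `|` V) k f.
Proof.
elim: k f => [|k IH] f [c1 H1] [c2 H2]; split.
- by move=> x [/c1|/c2].
- by [].
- by move=> x [/c1|/c2].
- move=> i; have [d1 h1] := H1 i; have [d2 h2] := H2 i; split; last exact: IH.
  by move=> x [/d1|/d2].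
Qed.

Lemma CkS U k f : Ck U k.+1 f -> Ck U k f.
Proof.
elim: k f => [|k IH] f [c H]; split => // i.
by have [d /IH] := H i.
Qed.

Lemma Ck_le U j k f : (j <= k)%N -> Ck U k f -> Ck U j f.
Proof.
by move=> /subnK <-; elim: (k - j)%N => // l IH; rewrite addSn => /CkS.
Qed.

Lemma Ck_cst U k c : open U -> Ck U k (fun=> c).
Proof.
move=> Uo; elim: k c => [|k IH] c; first by split => // x _; exact: cst_continuous.
by apply: (@Ck_build _ _ _ (fun _ _ => 0)) => // x i _; exact: is_derive_const.
Qed.

Lemma Ck_coord U k i : open U -> Ck U k (fun x => x 0 i).
Proof.
move=> Uo; case: k => [|k].
  split => // x _; apply/continuous_epsP => e e0; exists e => // y /ltW.
  by apply: le_trans; have := norm_mx_coord (y - x) 0 i; rewrite !mxE.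
apply: (@Ck_build _ _ _ (fun j _ => (bas j : 'rV[R]_n) 0 i)) => //.
  by move=> x j _; exact: is_derive_coord.
by move=> j; exact: Ck_cst.
Qed.

Lemma Ck_add U k f g : open U -> Ck U k f -> Ck U k g -> Ck U k (fun x => f x + g x).
Proof.
move=> Uo; elim: k f g => [|k IH] f g Hf Hg.
  by split => // x Ux; apply: continuousD; [exact: Ck_cont Hf _ Ux|exact: Ck_cont Hg _ Ux].
apply: (@Ck_build _ _ _ (fun i x => partial i f x + partial i g x)) => //.
  by move=> x i Ux; apply: is_derive_add; [exact: Ck_deriv Hf _ _ Ux|exact: Ck_deriv Hg _ _ Ux].
by move=> i; apply: IH; exact: Ck_partial.
Qed.

Lemma Ck_mul U k f g : open U -> Ck U k f -> Ck U k g -> Ck U k (fun x => f x * g x).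
Proof.
move=> Uo; elim: k f g => [|k IH] f g Hf Hg.
  by split => // x Ux; apply: continuousM; [exact: Ck_cont Hf _ Ux|exact: Ck_cont Hg _ Ux].
apply: (@Ck_build _ _ _ (fun i x => partial i f x * g x + f x * partial i g x)) => //.
  by move=> x i Ux; apply: is_derive_mul; [exact: Ck_deriv Hf _ _ Ux|exact: Ck_deriv Hg _ _ Ux].
by move=> i; apply: Ck_add => //; apply: IH; try exact: Ck_partial; exact: CkS.
Qed.

Lemma Ck_scale U k c f : open U -> Ck U k f -> Ck U k (fun x => c * f x).
Proof. by move=> Uo; apply: Ck_mul => //; exact: Ck_cst. Qed.

Lemma Ck_opp U k f : open U -> Ck U k f -> Ck U k (fun x => - f x).
Proof.
move=> Uo Hf; apply: Ck_ext (Ck_scale (-1) Uo Hf) => // x _; exact: mulN1r.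
Qed.

Lemma Ck_sub U k f g : open U -> Ck U k f -> Ck U k g -> Ck U k (fun x => f x - g x).
Proof. by move=> Uo Hf Hg; apply: Ck_add => //; exact: Ck_opp. Qed.

Lemma Ck_sum U k (I : Type) (s : seq I) (P : pred I) (F : I -> 'rV[R]_n -> R) : open U ->
  (forall i, P i -> Ck U k (F i)) -> Ck U k (fun x => \sum_(i <- s | P i) F i x).
Proof.
move=> Uo H; elim: s => [|i s IH].
  by under eq_fun do rewrite big_nil; exact: Ck_cst.
under eq_fun do rewrite big_cons.
case Pi: (P i) => //; apply: Ck_add => //; exact: H.
Qed.

Lemma Ck_prod U k (I : Type) (s : seq I) (P : pred I) (F : I -> 'rV[R]_n -> R) : open U ->
  (forall i, P i -> Ck U k (F i)) -> Ck U k (fun x => \prod_(i <- s | P i) F i x).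
Proof.
move=> Uo H; elim: s => [|i s IH].
  by under eq_fun do rewrite big_nil; exact: Ck_cst.
under eq_fun do rewrite big_cons.
case Pi: (P i) => //; apply: Ck_mul => //; exact: H.
Qed.

(** The derivative is a polynomial in the inverse itself and the partials of [f], so the induction
    hypothesis applies to it. *)
Lemma Ck_inv U k f : open U -> (forall x, U x -> f x != 0) -> Ck U k f ->
  Ck U k (fun x => (f x)^-1).
Proof.
move=> Uo f0; elim: k => [|k IH] Hf.
  by split => // x Ux; apply: continuousV; [exact: f0|exact: Ck_cont Hf _ Ux].
apply: (@Ck_build _ _ _ (fun i x => - ((f x)^-1 * (f x)^-1) * partial i f x)) => //.
  move=> x i Ux; have := is_derive_inv (f0 _ Ux) (Ck_deriv Hf i Ux).
  by rewrite expr2 invfM.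
move=> i; apply: Ck_mul => //; last exact: Ck_partial.
by apply: Ck_opp => //; apply: Ck_mul => //; apply: IH; exact: CkS.
Qed.

Definition Ckmx U k p q (A : 'rV[R]_n -> 'M[R]_(p, q)) :=
  forall i j, Ck U k (fun x => A x i j).

Lemma Ckmx_mul U k p q r (A : 'rV[R]_n -> 'M[R]_(p, q)) (B : 'rV[R]_n -> 'M[R]_(q, r)) :
  open U -> Ckmx U k A -> Ckmx U k B -> Ckmx U k (fun x => A x *m B x).
Proof.
move=> Uo HA HB i j; under eq_fun do rewrite mxE.
by apply: Ck_sum => // l _; exact: Ck_mul.
Qed.

Lemma Ckmx_tr U k p q (A : 'rV[R]_n -> 'M[R]_(p, q)) :
  Ckmx U k A -> Ckmx U k (fun x => (A x)^T).
Proof. by move=> HA i j; under eq_fun do rewrite mxE. Qed.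

Lemma Ckmx_cst U k p q (A : 'M[R]_(p, q)) : open U -> Ckmx U k (fun=> A).
Proof. by move=> Uo i j; exact: Ck_cst. Qed.

Lemma Ckmx_sub U k p q p' q' (f : 'I_p' -> 'I_p) (h : 'I_q' -> 'I_q) (A : 'rV[R]_n -> 'M[R]_(p, q)) :
  Ckmx U k A -> Ckmx U k (fun x => mxsub f h (A x)).
Proof. by move=> HA i j; under eq_fun do rewrite mxE. Qed.

Lemma Ck_det U k p (A : 'rV[R]_n -> 'M[R]_p) : open U -> Ckmx U k A ->
  Ck U k (fun x => \det (A x)).
Proof.
move=> Uo HA; rewrite /determinant; apply: Ck_sum => // s _.
by apply: Ck_scale => //; apply: Ck_prod => // i _; exact: HA.
Qed.

Lemma Ckmx_adj U k p (A : 'rV[R]_n -> 'M[R]_p) : open U -> Ckmx U k A ->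
  Ckmx U k (fun x => \adj (A x)).
Proof.
move=> Uo HA i j; under eq_fun do rewrite mxE /cofactor.
apply: Ck_scale => //; apply: Ck_det => // a b.
by under eq_fun do rewrite !mxE; exact: HA.
Qed.

Lemma Ckmx_inv U k p (A : 'rV[R]_n -> 'M[R]_p) : open U ->
  (forall x, U x -> A x \in unitmx) -> Ckmx U k A -> Ckmx U k (fun x => invmx (A x)).
Proof.
move=> Uo AU HA i j.
apply: (@Ck_ext _ _ (fun x => (\det (A x))^-1 * \adj (A x) i j)) => //.
  by move=> x /AU Ax; rewrite /invmx Ax !mxE.
apply: Ck_mul => //; last exact: Ckmx_adj.
apply: Ck_inv => //; last exact: Ck_det.
by move=> x /AU; rewrite unitmxE unitfE.
Qed.

End CkTheory.

(* Keeps [split] and [//] from unfolding [Ck U k.+1]. *)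
#[global] Opaque Ck.

Section CkComposition.
Variables (R : realType) (n m : nat).

Lemma Ck_diff (U : set 'rV[R]_n) k (f : 'rV[R]_n -> R) x : open U -> Ck U k.+1 f -> U x ->
  forall e, 0 < e -> exists2 r, 0 < r & forall z, `|z - x| < r ->
   `|f z - f x - \sum_i (z - x) 0 i * partial i f x| <= e * `|z - x|.
Proof.
move=> Uo Hf Ux; apply: (@diff_at _ _ _ f (fun i => partial i f) Uo) => //.
  by move=> y i Uy; exact: Ck_deriv Hf _ _ Uy.
by move=> i; exact: Ck_cont (Ck_partial i Hf) _ Ux.
Qed.

Lemma Ck_chain (U : set 'rV[R]_n) k (f : 'rV[R]_n -> R) (V : normedModType R)
    (p : V -> 'rV[R]_n) (y v : V) c : open U -> Ck U k.+1 f -> U (p y) ->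
  (forall i, is_derive y v (fun t => p t 0 i) (c i)) ->
  is_derive y v (fun t => f (p t)) (\sum_i c i * partial i f (p y)).
Proof. by move=> Uo Hf Up; apply: chain_rule; exact: Ck_diff Hf Up. Qed.

Lemma Ck_line (U : set 'rV[R]_n) k (f : 'rV[R]_n -> R) (x v : 'rV[R]_n) (t : R) :
  open U -> Ck U k.+1 f -> U (x + t *: v) ->
  is_derive t 1 (fun t : R => f (x + t *: v)) (\sum_i v 0 i * partial i f (x + t *: v)).
Proof.
move=> Uo Hf Ux.
have := @Ck_chain U k f _ (fun t : R => x + t *: v) t 1 (fun i => v 0 i) Uo Hf Ux.
apply => i.
exact: (is_derive_line (f := fun y : 'rV[R]_n => y 0 i) (is_derive_coord _ _ _)).
Qed.

Lemma continuous_row (V : normedModType R) (p : V -> 'rV[R]_n) (y : V) :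
  (forall i, {for y, continuous (fun t => p t 0 i)}) -> {for y, continuous p}.
Proof.
move=> H; apply/continuous_epsP => e e0.
have [r r0 Hr] : exists2 r : R, 0 < r & forall z, `|z - y| < r ->
    forall i, `|p z 0 i - p y 0 i| <= e.
  apply: (common_radius (N := fun z => `|z - y|)) => i.
  by have /continuous_epsP/(_ _ e0) := H i.
exists r => // z /Hr {}Hr; apply/norm_mx_leP; first exact: ltW.
by move=> i j; rewrite ord1 !mxE.
Qed.

Lemma Ck_comp (U : set 'rV[R]_n) (V : set 'rV[R]_m) k (f : 'rV[R]_n -> R)
    (p : 'rV[R]_m -> 'rV[R]_n) : open U -> open V -> (forall y, V y -> U (p y)) ->
  (forall i, Ck V k (fun y => p y 0 i)) -> Ck U k f -> Ck V k (fun y => f (p y)).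
Proof.
move=> Uo Vo VU; elim: k f => [|k IH] f Hp Hf.
  apply: Ck0 => y Vy; apply: (@continuous_comp _ _ _ p f).
    by apply: continuous_row => i; exact: Ck_cont (Hp i) _ Vy.
  exact: Ck_cont Hf _ (VU _ Vy).
apply: (@Ck_build _ _ _ _ _
   (fun j y => \sum_i partial j (fun y => p y 0 i) y * partial i f (p y))) => //.
  move=> y j Vy; apply: Ck_chain Uo Hf (VU _ Vy) _ => i.
  exact: Ck_deriv (Hp i) _ _ Vy.
move=> j; apply: Ck_sum => // i _; apply: Ck_mul => //.
  exact: Ck_partial.
by apply: IH => [l|]; [exact: CkS|exact: Ck_partial].
Qed.

End CkComposition.

(** * Integrals of continuous functions *)

Section OneDim.
Variable R : realType.
Local Notation mu := (@lebesgue_measure R).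
Implicit Types (f g F : R -> R) (a b c h t u x y K M N : R).

(** Two-sided continuity, at the endpoints too: stronger than continuity on the segment, but all
    integrands here are total functions that have it. *)
Definition cont_on (a b : R) (f : R -> R) :=
  forall t, a <= t <= b -> {for t, continuous f}.

Lemma cont_on_within a b f : cont_on a b f -> {within `[a, b], continuous f}.
Proof.
move=> cf; apply: continuous_in_subspaceT => t; rewrite inE/= in_itv/=; exact: cf.
Qed.

Lemma cont_on_integrable a b f : cont_on a b f -> mu.-integrable `[a, b] (EFin \o f).
Proof.
move=> /cont_on_within cf; apply: continuous_compact_integrable => //.
exact: segment_compact.
Qed.

Lemma int_add a b f g : cont_on a b f -> cont_on a b g ->
  \int[mu]_(t in `[a, b]) (f t + g t) =
  \int[mu]_(t in `[a, b]) f t + \int[mu]_(t in `[a, b]) g t.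
Proof. by move=> cf cg; rewrite RintegralD//; exact: cont_on_integrable. Qed.

Lemma int_scale a b c f : cont_on a b f ->
  \int[mu]_(t in `[a, b]) (c * f t) = c * \int[mu]_(t in `[a, b]) f t.
Proof. by move=> cf; rewrite RintegralZl//; exact: cont_on_integrable. Qed.

Lemma int_cst a b c : a <= b -> \int[mu]_(t in `[a, b]) c = c * (b - a).
Proof.
move=> ab; rewrite Rintegral_cst//=.
by rewrite lebesgue_measure_itv/= lte_fin; case: ltgtP ab => //= -> _; rewrite subrr.
Qed.

Lemma cont_cst a b c : cont_on a b (fun=> c).
Proof. by move=> t _; exact: cst_continuous. Qed.

Lemma int_le a b f g : cont_on a b f -> cont_on a b g ->
  (forall t, a <= t <= b -> f t <= g t) ->
  \int[mu]_(t in `[a, b]) f t <= \int[mu]_(t in `[a, b]) g t.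
Proof.
by move=> cf cg fg; apply: le_Rintegral => //; exact: cont_on_integrable.
Qed.

Lemma int_bound a b f K : a <= b -> cont_on a b f ->
  (forall t, a <= t <= b -> `|f t| <= K) ->
  `|\int[mu]_(t in `[a, b]) f t| <= K * (b - a).
Proof.
move=> ab cf fK; rewrite -int_cst// ler_norml; apply/andP; split.
  rewrite -mulN1r -int_scale; last exact: cont_cst.
  apply: int_le => //; first exact: cont_cst.
  by move=> t /fK; rewrite mulN1r ler_norml => /andP[].
by apply: int_le => //; [exact: cont_cst|move=> t /fK; rewrite ler_norml => /andP[]].
Qed.

Lemma int_FTC2 a b F f : a <= b -> cont_on a b f ->
  (forall t, a < t < b -> is_derive t 1 F (f t)) -> cont_on a b F ->
  \int[mu]_(t in `[a, b]) f t = F b - F a.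
Proof.
move=> ab cf dF cF; case: ltgtP ab => // [ab _|<- _]; last first.
  by rewrite subrr set_itv1 Rintegral_set1.
rewrite /Rintegral (@continuous_FTC2 _ _ F)//.
- exact: cont_on_within.
- split.
  + by move=> t; rewrite in_itv/= => /dF[].
  + by apply: cvg_at_right_filter; apply: cF; rewrite lexx ltW.
  + by apply: cvg_at_left_filter; apply: cF; rewrite lexx ltW.
- by move=> t; rewrite in_itv/= => /dF H; rewrite derive1E; case: H.
Qed.

Lemma int_FTC1 a u f x : cont_on a u f -> a < x < u ->
  is_derive x 1 (fun y : R => \int[mu]_(t in `[a, y]) f t) (f x).
Proof.
move=> cf /andP[ax xu].
have [|||] := @continuous_FTC1_closed R f a x u xu.
- exact: cont_on_integrable.
- exact: ax.
- by apply: cf; rewrite !ltW.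
- by move=> d; rewrite derive1E; exact: DeriveDef.
Qed.

Lemma int_support M M' f : 0 <= M -> M <= M' -> (forall t, f t = 0 \/ `|t| <= M) ->
  \int[mu]_t f t = \int[mu]_(t in `[- M', M']) f t.
Proof.
move=> M0 MM f0; rewrite [RHS]Rintegral_mkcond; apply: eq_Rintegral => t _.
rewrite patchE; case: ifPn => // /negP; have [->//|tM tn] := f0 t.
exfalso; apply: tn; rewrite inE/= in_itv/= -ler_norml; exact: le_trans tM MM.
Qed.

(** Both integrals are increments of one primitive [F], taken between points beyond the support on
    either side; there [F] is constant, so the shift by [h] is invisible. *)
Lemma int_translation M f h : 0 <= M -> (forall t, {for t, continuous f}) ->
  (forall t, M <= `|t| -> f t = 0) ->
  \int[mu]_t f (t + h) = \int[mu]_t f t.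
Proof.
move=> M0 cf f0.
have f0' t : f t = 0 \/ `|t| <= M.
  by have [|/ltW/f0] := leP `|t| M; [right|left].
pose N := M + `|h|.
have N0 : 0 <= N by rewrite addr_ge0.
have hb : - `|h| <= h <= `|h| by rewrite -ler_norml.
rewrite (@int_support N N) //; last first.
  move=> t; have [->|tM] := f0' (t + h); [by left|right].
  rewrite (_ : t = (t + h) - h); last by rewrite addrK.
  by apply: le_trans (ler_normB _ _) _; rewrite lerD2r.
rewrite (@int_support M N f) //; last by rewrite lerDl.
(* One unit of margin: [int_FTC1] differentiates [F] only at interior points. *)
pose a := - N - `|h| - 1; pose b := N + `|h| + 1.
pose F (y : R) : R := \int[mu]_(t in `[a, y]) f t.
have cfo x y : cont_on x y f by move=> t _; exact: cf.
have dF x : a < x < b -> is_derive x 1 F (f x).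
  by move=> axb; exact: (int_FTC1 (cfo a b)).
have cF x : a < x < b -> {for x, continuous F}.
  move=> /dF [d _]; apply: differentiable_continuous; exact/derivable1_diffP.
have h0 : 0 <= `|h| by [].
have -> : \int[mu]_(t in `[- N, N]) f (t + h) = F (N + h) - F (- N + h).
  apply: (@int_FTC2 _ _ (fun t => F (t + h)) (fun t => f (t + h))); first by lra.
  - move=> t _; apply: (@continuous_comp _ _ _ (fun t => t + h) f); last exact: cf.
    by apply: continuousD => //; exact: cst_continuous.
  - move=> t tb; have := @is_derive_line R _ F h 1 t (f (t + h)).
    rewrite scaler1 [h + t]addrC => H.
    have -> : (fun t : R => F (t + h)) = (fun t : R => F (h + t *: 1)).
      by apply/funext => s; rewrite scaler1 addrC.
    by apply: H; apply: dF; rewrite /a /b; move: tb hb; lra.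
  - move=> t tb; apply: (@continuous_comp _ _ _ (fun t => t + h) F).
      by apply: continuousD => //; exact: cst_continuous.
    by apply: cF; rewrite /a /b; move: tb hb; lra.
have -> : \int[mu]_(t in `[- N, N]) f t = F N - F (- N).
  apply: (@int_FTC2 _ _ F f); [lra|exact: cfo| |].
  - by move=> t tb; apply: dF; rewrite /a /b; move: tb hb; lra.
  - by move=> t tb; apply: cF; rewrite /a /b; move: tb hb; lra.
have const x y : a < x -> x <= y -> y < b -> (forall t, x <= t <= y -> f t = 0) -> F y = F x.
  move=> ax xy yb fz.
  have := @int_FTC2 x y F f xy (cfo x y).
  rewrite (_ : Rintegral _ _ _ = 0); last first.
    rewrite (@eq_Rintegral _ _ _ _ _ (fun=> 0)) ?int_cst// ?mul0r//.
    by move=> t; rewrite inE/= in_itv/=; exact: fz.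
  move=> H; apply/eqP; rewrite -subr_eq0; apply/eqP; symmetry; apply: H.
    by move=> t tb; apply: dF; lra.
  by move=> t tb; apply: cF; lra.
have constM x y : a < x -> x <= y -> y < b -> M <= x -> F y = F x.
  move=> ax xy yb Mx; apply: const => // t tb; apply: f0; rewrite ger0_norm; lra.
have constm x y : a < x -> x <= y -> y < b -> y <= - M -> F y = F x.
  move=> ax xy yb Mx; apply: const => // t tb; apply: f0; rewrite ler0_norm; lra.
have e1 : F (N + h) = F N.
  have [h1|h1] := leP 0 h.
    by apply: constM; rewrite /a /b /N; lra.
  by apply/esym; apply: constM; rewrite /a /b /N ?(ltr0_norm h1) //; lra.
have e2 : F (- N + h) = F (- N).
  have [h1|h1] := leP 0 h.
    by apply: constm; rewrite /a /b /N ?(ger0_norm h1) //; lra.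
  by apply/esym; apply: constm; rewrite /a /b /N; lra.
by rewrite e1 e2.
Qed.

Lemma int_gt0 M f t0 : 0 <= M -> (forall t, {for t, continuous f}) ->
  (forall t, M <= `|t| -> f t = 0) -> (forall t, 0 <= f t) -> 0 < f t0 ->
  0 < \int[mu]_t f t.
Proof.
move=> M0 cf f0 fge ft0.
rewrite (@int_support M (M + `|t0| + 1)) //; last 2 first.
- by rewrite -addrA lerDl addr_ge0.
- by move=> t; have [|/ltW/f0] := leP `|t| M; [right|left].
set N := M + _ + 1.
have N0 : 0 < N by rewrite /N ltr_wpDl// addr_ge0.
have cfo x y : cont_on x y f by move=> t _; exact: cf.
pose F (y : R) : R := \int[mu]_(t in `[- N - 1, y]) f t.
have dF x : - N - 1 < x < N + 1 -> is_derive x 1 F (f x).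
  by move=> axb; exact: (int_FTC1 (cfo _ (N + 1))).
have cF x : - N - 1 < x < N + 1 -> {for x, continuous F}.
  move=> /dF [d _]; apply: differentiable_continuous; exact/derivable1_diffP.
have E x y : - N <= x -> x <= y -> y <= N -> \int[mu]_(t in `[x, y]) f t = F y - F x.
  move=> Nx xy yN; apply: int_FTC2 => //.
    by move=> t tb; apply: dF; lra.
  by move=> t tb; apply: cF; lra.
have inc x y : - N <= x -> x <= y -> y <= N -> F x <= F y.
  move=> Nx xy yN; rewrite -subr_ge0 -E//; apply: Rintegral_ge0 => t _; exact: fge.
have t0N : - N < t0 < N.
  by rewrite -ltr_norml /N; have := normr_ge0 t0; lra.
rewrite E; [|lra|lra|lra].
have [r r0 Hr] : exists2 r : R, 0 < r & forall y, `|y - t0| < r -> f t0 / 2 <= f y.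
  have /continuous_epsP/(_ (f t0 / 2)) := cf t0.
  rewrite divr_gt0// => /(_ isT)[r r0 Hr]; exists r => // y /Hr.
  by rewrite ler_norml => /andP[]; lra.
pose s := Num.min (r / 2) (N - t0).
have s0 : 0 < s by rewrite lt_min divr_gt0//=; lra.
have sr : s <= r / 2 by rewrite ge_min lexx.
have sN : s <= N - t0 by rewrite ge_min lexx orbT.
have : F (t0 + s) - F t0 >= f t0 / 2 * s.
  rewrite -E; [|lra|lra|lra].
  have -> : f t0 / 2 * s = \int[mu]_(t in `[t0, t0 + s]) (f t0 / 2).
    by rewrite int_cst; [congr (_ * _); ring|lra].
  apply: int_le => //; first exact: cont_cst.
  move=> t tb; apply: Hr; rewrite ger0_norm; lra.
have := inc (- N) t0; have := inc (t0 + s) N.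
have : 0 < f t0 / 2 * s by rewrite mulr_gt0// divr_gt0.
lra.
Qed.

End OneDim.

(** Only [x] is confined to [K]; the modulus also serves points [y] slightly outside. *)
Lemma uniform_on_compact (R : realType) (V : normedModType R) (K : set V) (f : V -> R) :
  compact K -> (forall x, K x -> {for x, continuous f}) ->
  forall e, 0 < e -> exists2 r, 0 < r & forall x y, K x -> `|y - x| < r -> `|f y - f x| <= e.
Proof.
move=> /compact_near_coveringP cK cf e e0.
pose P (r : R) (x : V) := forall y, `|y - x| < r -> `|f y - f x| <= e.
have : \forall r \near 0^'+, K `<=` P r.
  apply: cK => x Kx; have /continuous_epsP/(_ (e / 2)) := cf _ Kx.
  rewrite divr_gt0// => /(_ isT)[s s0 Hs].
  exists ([set y | `|y - x| < s / 2], [set r | r < s / 2]).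
    split; first by apply/nbhs_epsP; exists (s / 2) => //; rewrite divr_gt0.
    by apply: nbhs_right_lt; rewrite divr_gt0.
  move=> [y r] [/= ys rs] z zy.
  have a : `|f z - f x| <= e / 2.
    apply: Hs; rewrite -(subrK y z) -addrA; apply: le_lt_trans (ler_normD _ _) _.
    by rewrite (splitr s) ltrD// (lt_trans zy).
  have b : `|f y - f x| <= e / 2 by apply: Hs; lra.
  rewrite (_ : f z - f y = (f z - f x) - (f y - f x)); last by ring.
  by apply: le_trans (ler_normB _ _) _; lra.
rewrite /at_right near_withinE => /nbhs_epsP[r r0 Hr].
exists (r / 2); first by rewrite divr_gt0.
move=> x y Kx; apply: (Hr (r / 2)) Kx _; last by rewrite divr_gt0.
by rewrite subr0 gtr0_norm ?divr_gt0//; lra.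
Qed.

Section RowCons.
Variables (R : realType) (m : nat).
Implicit Types (t : R) (y : 'rV[R]_m).

Definition rcons_row t y : 'rV[R]_m.+1 := row_mx (t%:M : 'rV[R]_1) y.

Lemma rcons_row0 t y : rcons_row t y 0 0 = t.
Proof.
have e : (t%:M : 'rV[R]_1) 0 0 = t by rewrite mxE eqxx.
rewrite -[RHS]e -[RHS](row_mxEl _ y 0 0).
by congr (row_mx _ _ _ _); exact/val_inj.
Qed.

Lemma rcons_rowS t y i : rcons_row t y 0 (lift ord0 i) = y 0 i.
Proof.
rewrite -(row_mxEr (t%:M : 'rV[R]_1) y 0 i).
by congr (row_mx _ _ _ _); exact/val_inj.
Qed.

Lemma rcons_row_eq (x : 'rV[R]_m.+1) : x = rcons_row (x 0 0) (\row_i x 0 (lift ord0 i)).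
Proof.
apply/rowP => i; case: (unliftP ord0 i) => [j ->|->].
  by rewrite rcons_rowS mxE.
by rewrite rcons_row0.
Qed.

Lemma rcons_rowD t y t' y' : rcons_row t y + rcons_row t' y' = rcons_row (t + t') (y + y').
Proof.
apply/rowP => i; case: (unliftP ord0 i) => [j ->|->]; rewrite mxE.
  by rewrite !rcons_rowS mxE.
by rewrite !rcons_row0.
Qed.

Lemma rcons_rowB t y t' y' : rcons_row t y - rcons_row t' y' = rcons_row (t - t') (y - y').
Proof.
by apply/eqP; rewrite subr_eq rcons_rowD !subrK.
Qed.

Lemma norm_rcons_row t y : `|rcons_row t y| = Num.max `|t| `|y|.
Proof.
apply/eqP; rewrite eq_le; apply/andP; split.
  apply/norm_mx_leP => [|i j]; first by rewrite le_max normr_ge0.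
  rewrite ord1; case: (unliftP ord0 j) => [k ->|->].
    by rewrite rcons_rowS le_max norm_mx_coord orbT.
  by rewrite rcons_row0 le_max lexx.
rewrite ge_max; apply/andP; split.
  by have := norm_mx_coord (rcons_row t y) 0 0; rewrite rcons_row0.
apply/norm_mx_leP => // i j; rewrite ord1 -(rcons_rowS t); exact: norm_mx_coord.
Qed.

End RowCons.

(** * Iterated integrals of compactly supported continuous functions *)

Section CompactSupport.
Variable R : realType.
Implicit Types (M K a : R).

Lemma compact_norm_ball n (p : 'rV[R]_n) (c : R) : compact [set x | `|x - p| <= c].
Proof.
apply: bounded_closed_compact.
  exists (c + `|p|); split; first exact: num_real.
  move=> r rM x /= xp; rewrite -(subrK p x); apply: le_trans (ler_normD _ _) _.
  by apply: le_trans (ltW rM); rewrite lerD2r.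
suff : closed ((fun x : 'rV[R]_n => `|x - p|) @^-1` [set r : R | r <= c]) by [].
apply: preimage_closed; last exact: closed_le.
move=> x _.
apply: continuous_comp; last exact: norm_continuous.
by apply: continuousB => //; exact: cst_continuous.
Qed.

(** The radius is explicit because the integral is bounded through the volume [(2 * M) ^+ n]. In the
    max norm the ball is a cube, so every slice inherits the same radius. *)
Definition cc n (M : R) (f : 'rV[R]_n -> R) :=
  (forall x, {for x, continuous f}) /\ (forall x, M <= `|x| -> f x = 0).

Lemma cc_le n M M' (f : 'rV[R]_n -> R) : M <= M' -> cc M f -> cc M' f.
Proof. by move=> MM [c z]; split => // x /(le_trans MM); exact: z. Qed.

(** Compactness gives the modulus on the ball of radius [M + 1]. Further out, two points at distance
    less than 1 both lie where [f] vanishes. *)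
Lemma cc_uniform n M (f : 'rV[R]_n -> R) : cc M f ->
  forall e, 0 < e -> exists2 r, 0 < r & forall x y, `|y - x| < r -> `|f y - f x| <= e.
Proof.
move=> [cf zf] e e0.
have cK := @compact_norm_ball _ (0 : 'rV[R]_n) (M + 1).
have [r r0 Hr] := uniform_on_compact cK (fun x _ => cf x) e0.
exists (Num.min r 1); first by rewrite lt_min r0 ltr01.
move=> x y; rewrite lt_min => /andP[xr x1].
have [xM|Mx] := leP `|x| (M + 1); first by apply: Hr => //=; rewrite subr0.
rewrite !zf ?subrr ?normr0; [exact: ltW| |].
  by apply: ltW; apply: lt_trans Mx; rewrite ltrDl.
have : `|x| <= `|y| + `|y - x|.
  by rewrite distrC -[leLHS](_ : `|y + (x - y)| = _) ?ler_normD// addrC subrK.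
by lra.
Qed.

Lemma cc_bounded n M (f : 'rV[R]_n -> R) : cc M f ->
  exists2 K, 0 <= K & forall x, `|f x| <= K.
Proof.
move=> [cf zf].
have cK := @compact_norm_ball _ (0 : 'rV[R]_n) `|M|.
have [||x0 _ Hx] := @compact_EVT_max _ R (fun x : 'rV[R]_n => `|f x|) _ _ cK.
- by exists 0; rewrite /= subrr normr0.
- apply: continuous_subspaceT => x; apply: continuous_comp; first exact: cf.
  exact: norm_continuous.
exists `|f x0| => // x; have [xM|Mx] := leP `|x| `|M|.
  by apply: Hx; rewrite inE/= subr0.
by rewrite zf ?normr0//; apply: ltW; apply: le_lt_trans (ler_norm _) Mx.
Qed.

Lemma cc_lin n M (f g : 'rV[R]_n -> R) a : cc M f -> cc M g -> cc M (fun x => f x + a * g x).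
Proof.
move=> [cf zf] [cg zg]; split => x; last by move=> Mx; rewrite zf ?zg// mulr0 addr0.
apply: continuousD; first exact: cf.
by apply: continuousM; [exact: cst_continuous|exact: cg].
Qed.

Lemma cc0 n M : cc M (fun _ : 'rV[R]_n => 0).
Proof. by split => // x; exact: cst_continuous. Qed.

Lemma cc_slice n M (f : 'rV[R]_n.+1 -> R) t : cc M f -> cc M (fun y => f (rcons_row t y)).
Proof.
move=> [cf zf]; split => y; last first.
  by move=> My; apply: zf; rewrite norm_rcons_row le_max My orbT.
apply: continuous_comp; last exact: cf.
apply/continuous_epsP => e e0; exists e => // z zy.
by rewrite rcons_rowB norm_rcons_row subrr normr0 max_r// ltW.
Qed.

Lemma rVintegralS n (f : 'rV[R]_n.+1 -> R) :
  rVintegral f = \int[@lebesgue_measure R]_t rVintegral (fun y => f (rcons_row t y)).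
Proof. by []. Qed.

Lemma rVintegral_ext n (f g : 'rV[R]_n -> R) : f =1 g -> rVintegral f = rVintegral g.
Proof. by move=> /funext ->. Qed.

(** The three claims go through one induction: in dimension [n + 1] the slice integral must be
    continuous in [t], and this follows from linearity and the bound in dimension [n]. *)
Lemma rVintegral_lin_bound n :
  (forall M (f g : 'rV[R]_n -> R) a, 0 <= M -> cc M f -> cc M g ->
     rVintegral (fun x => f x + a * g x) = rVintegral f + a * rVintegral g) /\
  (forall M (f : 'rV[R]_n -> R) K, 0 <= M -> 0 <= K -> cc M f -> (forall x, `|f x| <= K) ->
     `|rVintegral f| <= (2 * M) ^+ n * K) /\
  (forall M (f : 'rV[R]_n -> R), 0 <= M -> cc M f -> (forall x, 0 <= f x) -> 0 <= rVintegral f).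
Proof.
elim: n => [|n [lin [bnd pos]]].
  split; first by [].
  by split => [M f K _ _ _ H|M f _ _ H]; rewrite /= ?expr0 ?mul1r.
have int0 : rVintegral (fun _ : 'rV[R]_n => 0) = 0 :> R.
  have := bnd 0 (fun=> 0) 0 (lexx _) (lexx _) (cc0 _ _).
  by rewrite normr0 lexx mulr0 => /(_ (fun=> isT)); rewrite normr_le0 => /eqP.
have F0 M (f : 'rV[R]_n.+1 -> R) : cc M f -> forall t, M <= `|t| ->
    rVintegral (fun y => f (rcons_row t y)) = 0.
  move=> [cf zf] t Mt; rewrite -[RHS]int0; apply: rVintegral_ext => y.
  by apply: zf; rewrite norm_rcons_row le_max Mt.
have cF M (f : 'rV[R]_n.+1 -> R) : 0 <= M -> cc M f -> forall t : R,
    {for t, continuous (fun t => rVintegral (fun y => f (rcons_row t y)))}.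
  move=> M0 Hf t; apply/continuous_epsP => e e0.
  have c0 : 0 < (2 * M) ^+ n + 1 by rewrite ltr_wpDl// exprn_ge0// mulr_ge0.
  have [r r0 Hr] := cc_uniform Hf (divr_gt0 e0 c0).
  exists r => // s st.
  rewrite -mulN1r -(lin M)//; try exact: cc_slice.
  apply: le_trans (bnd M _ (e / ((2 * M) ^+ n + 1)) M0 _ _ _) _.
  - by rewrite ltW// divr_gt0.
  - by apply: cc_lin; exact: cc_slice.
  - move=> y; rewrite mulN1r; apply: Hr.
    by rewrite rcons_rowB subrr norm_rcons_row normr0 max_l.
  - rewrite mulrCA ler_piMr//; first exact: ltW.
    by rewrite ler_pdivrMr// mul1r lerDl.
have intE M (f : 'rV[R]_n.+1 -> R) : 0 <= M -> cc M f -> rVintegral f =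
    \int[@lebesgue_measure R]_(t in `[- M, M]) rVintegral (fun y => f (rcons_row t y)).
  move=> M0 Hf; rewrite rVintegralS; apply: (@int_support R M M) => // t.
  by have [|/ltW/(F0 _ _ Hf)] := leP `|t| M; [right|left].
have con M (f : 'rV[R]_n.+1 -> R) a b : 0 <= M -> cc M f ->
    cont_on a b (fun t => rVintegral (fun y => f (rcons_row t y))).
  by move=> M0 Hf t _; exact: cF M0 Hf t.
split; [|split].
- move=> M f g a M0 Hf Hg; rewrite !(intE M)//; last exact: cc_lin.
  rewrite -int_scale; last exact: con Hg.
  rewrite -int_add; [|exact: con Hf|]; last first.
    move=> t _; apply: continuousM; first exact: cst_continuous.
    exact: cF M0 Hg t.
  congr (Rintegral _ _ _); apply/funext => t; apply: (lin M) => //; exact: cc_slice.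
- move=> M f K M0 K0 Hf fK; rewrite (intE M)//.
  have -> : (2 * M) ^+ n.+1 * K = (2 * M) ^+ n * K * (M - - M) by rewrite exprS; ring.
  apply: int_bound; [lra|exact: con Hf|].
  move=> t _; apply: bnd => //; exact: cc_slice.
- move=> M f M0 Hf f0; rewrite (intE M)//; apply: Rintegral_ge0 => t _.
  apply: (pos M) => //; exact: cc_slice.
Qed.

Lemma rVintegral_lin n M (f g : 'rV[R]_n -> R) a : 0 <= M -> cc M f -> cc M g ->
  rVintegral (fun x => f x + a * g x) = rVintegral f + a * rVintegral g.
Proof. by have [H _] := rVintegral_lin_bound n; exact: H. Qed.

Lemma rVintegral_bound n M (f : 'rV[R]_n -> R) K : 0 <= M -> 0 <= K -> cc M f ->
  (forall x, `|f x| <= K) -> `|rVintegral f| <= (2 * M) ^+ n * K.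
Proof. by have [_ [H _]] := rVintegral_lin_bound n; exact: H. Qed.

Lemma rVintegral_ge0 n M (f : 'rV[R]_n -> R) : 0 <= M -> cc M f -> (forall x, 0 <= f x) ->
  0 <= rVintegral f.
Proof. by have [_ [_ H]] := rVintegral_lin_bound n; exact: H. Qed.

Lemma rVintegral0 n : rVintegral (fun _ : 'rV[R]_n => 0) = 0 :> R.
Proof.
have := @rVintegral_bound n 0 (fun=> 0) 0 (lexx _) (lexx _) (cc0 _ _).
by rewrite normr0 lexx mulr0 => /(_ (fun=> isT)); rewrite normr_le0 => /eqP.
Qed.

Lemma rVintegral_add n M (f g : 'rV[R]_n -> R) : 0 <= M -> cc M f -> cc M g ->
  rVintegral (fun x => f x + g x) = rVintegral f + rVintegral g.
Proof.
move=> M0 Hf Hg; rewrite -[X in _ + X]mul1r -(rVintegral_lin _ M0)//.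
by apply: rVintegral_ext => x; rewrite mul1r.
Qed.

Lemma rVintegral_sub n M (f g : 'rV[R]_n -> R) : 0 <= M -> cc M f -> cc M g ->
  rVintegral (fun x => f x - g x) = rVintegral f - rVintegral g.
Proof.
move=> M0 Hf Hg; rewrite -[X in _ - X]mul1r -mulNr -(rVintegral_lin _ M0)//.
by apply: rVintegral_ext => x; rewrite mulN1r.
Qed.

Lemma rVintegral_scale n M (f : 'rV[R]_n -> R) a : 0 <= M -> cc M f ->
  rVintegral (fun x => a * f x) = a * rVintegral f.
Proof.
move=> M0 Hf; rewrite -[RHS]add0r -[X in X + _](rVintegral0 n).
rewrite -(rVintegral_lin _ M0) //; last exact: cc0.
by apply: rVintegral_ext => x; rewrite add0r.
Qed.

Lemma rVintegral_le n M (f g : 'rV[R]_n -> R) : 0 <= M -> cc M f -> cc M g ->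
  (forall x, f x <= g x) -> rVintegral f <= rVintegral g.
Proof.
move=> M0 Hf Hg fg; rewrite -subr_ge0 -(rVintegral_sub M0)//.
apply: (@rVintegral_ge0 _ M) => // [|x]; last by rewrite subr_ge0.
have := cc_lin (-1) Hg Hf; congr cc; apply/funext => x; by rewrite mulN1r.
Qed.

Lemma slice_integral_zero n M (f : 'rV[R]_n.+1 -> R) t : cc M f -> M <= `|t| ->
  rVintegral (fun y => f (rcons_row t y)) = 0.
Proof.
move=> [cf zf] Mt; rewrite -[RHS](rVintegral0 n); apply: rVintegral_ext => y.
by apply: zf; rewrite norm_rcons_row le_max Mt.
Qed.

Lemma slice_integral_continuous n M (f : 'rV[R]_n.+1 -> R) : 0 <= M -> cc M f ->
  forall t : R, {for t, continuous (fun t => rVintegral (fun y => f (rcons_row t y)))}.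
Proof.
move=> M0 Hf t; apply/continuous_epsP => e e0.
have c0 : 0 < (2 * M) ^+ n + 1 by rewrite ltr_wpDl// exprn_ge0// mulr_ge0.
have [r r0 Hr] := cc_uniform Hf (divr_gt0 e0 c0).
exists r => // s st.
rewrite -(rVintegral_sub M0); try exact: cc_slice.
apply: le_trans (@rVintegral_bound _ M _ (e / ((2 * M) ^+ n + 1)) M0 _ _ _) _.
- by rewrite ltW// divr_gt0.
- have := cc_lin (-1) (cc_slice s Hf) (cc_slice t Hf); congr cc.
  by apply/funext => x; rewrite mulN1r.
- by move=> y; apply: Hr; rewrite rcons_rowB subrr norm_rcons_row normr0 max_l.
- rewrite mulrCA ler_piMr//; first exact: ltW.
  by rewrite ler_pdivrMr// mul1r lerDl.
Qed.

Lemma rVintegral_gt0 n M (f : 'rV[R]_n -> R) x0 : 0 <= M -> cc M f ->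
  (forall x, 0 <= f x) -> 0 < f x0 -> 0 < rVintegral f.
Proof.
move=> M0; elim: n f x0 => [|n IH] f x0 Hf fge f0.
  by rewrite /= (_ : 0 = x0)//; apply/rowP => -[].
move: f0; rewrite (rcons_row_eq x0) => f0; rewrite rVintegralS.
apply: (@int_gt0 R M _ (x0 0 0)) => //.
- exact: slice_integral_continuous M0 Hf.
- by move=> t; exact: slice_integral_zero.
- by move=> t; apply: (@rVintegral_ge0 _ M) => //; exact: cc_slice.
- exact: IH (cc_slice _ Hf) _ f0.
Qed.

Lemma rVintegral_translation n M (f : 'rV[R]_n -> R) v : 0 <= M -> cc M f ->
  rVintegral (fun x => f (x + v)) = rVintegral f.
Proof.
move=> M0; elim: n f v => [|n IH] f v Hf.
  by rewrite /= (_ : 0 + v = 0)//; apply/rowP => -[].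
rewrite !rVintegralS -[RHS](@int_translation R M _ (v 0 0)) //; last 2 first.
- exact: slice_integral_continuous M0 Hf.
- by move=> t; exact: slice_integral_zero.
congr (Rintegral _ _ _); apply/funext => t.
rewrite -[RHS](IH _ (\row_i v 0 (lift ord0 i)))//; last exact: cc_slice.
by apply: rVintegral_ext => y; rewrite {1}(rcons_row_eq v) rcons_rowD.
Qed.

End CompactSupport.

(** * Difference quotients under the integral sign and integration by parts *)

Section Translations.
Variable R : realType.
Implicit Types (M K e h : R).

Lemma small_zero (a C : R) : (forall e, 0 < e -> `|a| <= C * e) -> a = 0.
Proof.
move=> H; apply/eqP; rewrite -normr_le0 leNgt; apply/negP => a0.
have C0 : 0 < `|C| + 1 by rewrite ltr_wpDl.
have := H (`|a| / 2 / (`|C| + 1)); rewrite !divr_gt0// => /(_ isT).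
have : C * (`|a| / 2 / (`|C| + 1)) <= `|a| / 2.
  rewrite mulrC mulrAC ler_pdivrMr// ler_wpM2l//.
  by apply: le_trans (ler_norm C) _; rewrite lerDl.
by lra.
Qed.

Lemma is_derive_translate (V : normedModType R) (f : V -> R) (x v w : V) (d : R) :
  is_derive (x + w) v f d -> is_derive x v (fun y => f (y + w)) d.
Proof.
move=> /is_derive_epsP H; apply/is_derive_epsP => e /H[r r0 Hr].
by exists r => // h /Hr; rewrite (addrAC x w).
Qed.

Lemma is_derive_comp1 (V : normedModType R) (phi : R -> R) (L : V -> R) (x v : V) (l d : R) :
  is_derive (L x) 1 phi d -> is_derive x v L l -> is_derive x v (fun y => phi (L y)) (l * d).
Proof.
move=> /is_derive_epsP H dL.
have := @chain_rule R 1 (fun y => phi (y 0 0)) (fun=> d) V (fun y => (L y)%:M) x v (fun=> l).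
rewrite big_ord1 => G.
suff dG : is_derive x v (fun t => phi (((L t)%:M : 'rV[R]_1) 0 0)) (l * d).
  by apply: is_derive_near dG; apply: nearW => y; rewrite mxE eqxx mulr1n.
apply: G => [e e0|i]; last first.
  by apply: is_derive_near dL; apply: nearW => y; rewrite ord1 mxE eqxx mulr1n.
have [r r0 Hr] := H _ e0; exists r => // z.
rewrite (_ : `|z - _| = `|z 0 0 - L x|); last first.
  apply/eqP; rewrite eq_le; apply/andP; split.
    by apply/norm_mx_leP => // i j; rewrite !ord1 !mxE eqxx.
  by have := norm_mx_coord (z - (L x)%:M) 0 0; rewrite !mxE eqxx.
move=> /Hr; rewrite big_ord1 !mxE eqxx mulr1n /GRing.scale/= mulr1.
by rewrite (addrC (L x)) subrK.
Qed.

Lemma Ck_translate n k (f : 'rV[R]_n -> R) v : Ck setT k f -> Ck setT k (fun x => f (x + v)).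
Proof.
move=> Hf; apply: (@Ck_comp _ _ _ setT) Hf => //; try exact: openT.
move=> i; under eq_fun do rewrite mxE.
by apply: Ck_add; [exact: openT|apply: Ck_coord; exact: openT|apply: Ck_cst; exact: openT].
Qed.

Lemma partial_translate n (f : 'rV[R]_n -> R) v k x : Ck setT 1 f ->
  partial k (fun x => f (x + v)) x = partial k f (x + v).
Proof.
move=> Hf; apply: is_derive_partial; apply: is_derive_translate.
exact: Ck_deriv Hf _ _ _.
Qed.

Lemma cc_translate n M (f : 'rV[R]_n -> R) v : cc M f -> cc (M + `|v|) (fun x => f (x + v)).
Proof.
move=> [cf zf]; split => x.
  apply: continuous_comp; last exact: cf.
  by apply: continuousD => //; exact: cst_continuous.
move=> Mx; apply: zf.
have : `|x| <= `|x + v| + `|v| by rewrite -{1}(addrK v x); exact: ler_normB.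
by lra.
Qed.

Lemma cc_mul n M (a f : 'rV[R]_n -> R) : (forall x, {for x, continuous a}) -> cc M f ->
  cc M (fun x => a x * f x).
Proof.
move=> ca [cf zf]; split => x; last by move=> /zf ->; rewrite mulr0.
by apply: continuousM; [exact: ca|exact: cf].
Qed.

Lemma cc_sub n M (f g : 'rV[R]_n -> R) : cc M f -> cc M g -> cc M (fun x => f x - g x).
Proof.
move=> Hf Hg; have := cc_lin (-1) Hf Hg; congr cc.
by apply/funext => x; rewrite mulN1r.
Qed.

Lemma cc_add n M (f g : 'rV[R]_n -> R) : cc M f -> cc M g -> cc M (fun x => f x + g x).
Proof.
move=> Hf Hg; have := cc_lin 1 Hf Hg; congr cc.
by apply/funext => x; rewrite mul1r.
Qed.

Lemma cc_scale n M (f : 'rV[R]_n -> R) c : cc M f -> cc M (fun x => c * f x).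
Proof. by move=> Hf; apply: cc_mul => // x; exact: cst_continuous. Qed.

Lemma cc_sum n M (I : Type) (s : seq I) (F : I -> 'rV[R]_n -> R) : (forall i, cc M (F i)) ->
  cc M (fun x => \sum_(i <- s) F i x).
Proof.
move=> H; elim: s => [|i s IH].
  by under eq_fun do rewrite big_nil; exact: cc0.
by under eq_fun do rewrite big_cons; exact: cc_add.
Qed.

Lemma rVintegral_sum n M (I : Type) (s : seq I) (F : I -> 'rV[R]_n -> R) : 0 <= M ->
  (forall i, cc M (F i)) ->
  rVintegral (fun x => \sum_(i <- s) F i x) = \sum_(i <- s) rVintegral (F i).
Proof.
move=> M0 H; elim: s => [|i s IH].
  by under eq_fun do rewrite big_nil; rewrite big_nil rVintegral0.
under eq_fun do rewrite big_cons; rewrite big_cons -IH.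
by rewrite (rVintegral_add M0)//; exact: cc_sum.
Qed.

(** One extra unit of radius makes [f] vanish on a whole neighbourhood of the point. *)
Lemma cc_partial n M (f : 'rV[R]_n -> R) k : Ck setT 1 f -> cc M f -> cc (M + 1) (partial k f).
Proof.
move=> Hf [_ zf]; split => x.
  exact: Ck_cont (Ck_partial k Hf) _ _.
move=> Mx; apply: is_derive_partial.
have H0 := @is_derive_const R _ x (bas k) 0; apply: is_derive_near H0.
apply/nbhs_epsP; exists 1 => // y yx; rewrite zf//.
have : `|x| <= `|y| + `|y - x|.
  by rewrite distrC -[leLHS](_ : `|y + (x - y)| = _) ?ler_normD// addrC subrK.
by lra.
Qed.

Lemma uniform_difference n M (f : 'rV[R]_n -> R) k : Ck setT 1 f -> cc M f ->
  forall e, 0 < e -> exists2 r, 0 < r & forall h x, `|h| < r ->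
    `|f (x + h *: bas k) - f x - h * partial k f x| <= e * `|h|.
Proof.
move=> Hf ccf e e0.
have [r r0 Hr] := cc_uniform (cc_partial k Hf ccf) e0.
exists r => // h x hr.
have [|s sh ->] := @MVT_line _ _ f x (bas k) (partial k f) h.
  by move=> t _; exact: Ck_deriv Hf _ _ _.
rewrite -mulrBr normrM mulrC ler_wpM2r//; apply: Hr.
by rewrite addrAC subrr add0r norm_bas_scale; exact: le_lt_trans sh hr.
Qed.

(** This stands in for differentiation under the integral sign: by uniform continuity of the
    derivative the quotient of [f] converges uniformly, and everything lives on one cube. The weight
    [a] need not be differentiable. *)
Lemma integral_difference n M (a f : 'rV[R]_n -> R) K k : 0 <= M ->
  Ck setT 1 f -> cc M f -> (forall x, {for x, continuous a}) -> (forall x, `|a x| <= K) ->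
  forall e, 0 < e -> exists2 r, 0 < r & forall h, `|h| < r ->
    `|rVintegral (fun x => a x * (f (x + h *: bas k) - f x))
      - h * rVintegral (fun x => a x * partial k f x)| <= e * `|h|.
Proof.
move=> M0 Hf ccf ca aK e e0.
have K0 : 0 <= K by apply: le_trans (aK 0).
pose C := (2 * (M + 1)) ^+ n * K + 1.
have C0 : 0 < C by rewrite ltr_wpDl// mulr_ge0// exprn_ge0// mulr_ge0// addr_ge0.
have [r r0 Hr] := uniform_difference k Hf ccf (divr_gt0 e0 C0).
exists (Num.min r 1); first by rewrite lt_min r0 ltr01.
move=> h; rewrite lt_min => /andP[hr h1].
have M1 : 0 <= M + 1 by rewrite addr_ge0.
have c1 : cc (M + 1) (fun x => f (x + h *: bas k) - f x).
  apply: cc_sub; last by apply: cc_le ccf; rewrite lerDl.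
  by apply: cc_le (cc_translate (h *: bas k) ccf); rewrite lerD2l norm_bas_scale ltW.
have c2 := cc_partial k Hf ccf.
rewrite -(rVintegral_scale _ M1); last exact: cc_mul.
rewrite -(rVintegral_sub M1); [|exact: cc_mul|by apply: cc_scale; exact: cc_mul].
have eCh : 0 <= e / C * `|h| by rewrite mulr_ge0// ltW// divr_gt0.
apply: le_trans (@rVintegral_bound _ _ (M + 1) _ (K * (e / C * `|h|)) M1 _ _ _) _.
- by rewrite mulr_ge0.
- by apply: cc_sub; [exact: cc_mul|apply: cc_scale; exact: cc_mul].
- move=> x; rewrite mulrCA -mulrBr normrM ler_pM//; exact: Hr.
- rewrite !mulrA ler_wpM2r// -mulrA mulrC -!mulrA ler_piMr//; first exact: ltW.
  rewrite mulrC ler_pdivrMr// mul1r /C; lra.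
Qed.

(** By translation invariance every difference quotient has integral zero, hence so has its uniform
    limit. *)
Lemma rVintegral_partial n M (f : 'rV[R]_n -> R) k : 0 <= M -> Ck setT 1 f -> cc M f ->
  rVintegral (partial k f) = 0.
Proof.
move=> M0 Hf ccf; apply: (@small_zero _ 1) => e e0; rewrite mul1r.
have [||r r0 Hr] := @integral_difference n M (fun=> 1) f 1 k M0 Hf ccf _ _ _ e0.
- by move=> x; exact: cst_continuous.
- by move=> x; rewrite normr1.
have h0 : 0 < r / 2 by rewrite divr_gt0.
have := Hr (r / 2); rewrite gtr0_norm// => /(_ _)/wrap[]; first by lra.
rewrite (_ : rVintegral _ = 0); last first.
  have M1 : 0 <= M + `|(r / 2) *: (bas k : 'rV[R]_n)| by rewrite addr_ge0.
  under eq_fun do rewrite mul1r.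
  rewrite (rVintegral_sub M1); last 2 first.
  - exact: cc_translate.
  - by apply: cc_le ccf; rewrite lerDl.
  by rewrite (rVintegral_translation _ M0)// subrr.
under eq_fun do rewrite mul1r.
by rewrite sub0r normrN normrM gtr0_norm// mulrC ler_pM2r.
Qed.

(* Integrated form of the symmetry of second derivatives, for functions that
   are only C^1: difference quotients in direction [l] replace the second
   derivatives. *)
Lemma rVintegral_curl n M (f w : 'rV[R]_n -> R) k l : 0 <= M ->
  Ck setT 1 f -> cc M f -> Ck setT 1 w -> cc M w ->
  rVintegral (fun x => partial k f x * partial l w x) =
  rVintegral (fun x => partial l f x * partial k w x).
Proof.
move=> M0 Hf cf Hw cw; apply/eqP; rewrite -subr_eq0; apply/eqP.
apply: (@small_zero _ 2) => e e0.
have cpf i := cc_partial i Hf cf.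
have cpw i := cc_partial i Hw cw.
have [K1 K10 HK1] := cc_bounded (cpf k).
have [K2 K20 HK2] := cc_bounded (cpw k).
have [r1 r10 Hr1] := integral_difference l M0 Hw cw (proj1 (cpf k)) HK1 e0.
have [r2 r20 Hr2] := integral_difference l M0 Hf cf (proj1 (cpw k)) HK2 e0.
pose h := Num.min r1 r2 / 2.
have h0 : 0 < h by rewrite divr_gt0// lt_min r10.
have hr1 : h < r1.
  have : Num.min r1 r2 <= r1 by rewrite ge_min lexx.
  by rewrite /h; lra.
have hr2 : h < r2.
  have : Num.min r1 r2 <= r2 by rewrite ge_min lexx orbT.
  by rewrite /h; lra.
have := Hr1 h; rewrite gtr0_norm// => /(_ hr1).
have := Hr2 (- h); rewrite normrN gtr0_norm// => /(_ hr2).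
set I1 := rVintegral _; set J1 := rVintegral _; set I2 := rVintegral _; set J2 := rVintegral _.
have -> : rVintegral (fun x => partial l f x * partial k w x) = J1.
  by apply: rVintegral_ext => x; rewrite mulrC.
(* Discrete integration by parts: move [partial k] from [f] to the forward difference of [w], then
   translate by [- v], which leaves the backward difference of [f]. As [I2] is about [h * J2] and
   [I1] about [- h * J1], this gives [J1 = J2]. *)
suff II : I2 = - I1.
  rewrite II => a b.
  have : `|(J2 - J1) * h| <= 2 * e * h.
    have -> : (J2 - J1) * h = - (- I1 - h * J2) - (I1 - (- h) * J1) by ring.
    by apply: le_trans (ler_normB _ _) _; rewrite normrN; lra.
  by rewrite normrM (gtr0_norm h0) ler_pM2r.
pose v : 'rV[R]_n := h *: bas l.
pose N := M + `|v|.
have N0 : 0 <= N by rewrite addr_ge0.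
pose dw x := w (x + v) - w x.
have Hdw : Ck setT 1 dw by apply: Ck_sub; [exact: openT|exact: Ck_translate|exact: Hw].
have cdw : cc N dw by apply: cc_sub; [exact: cc_translate|apply: cc_le cw; rewrite lerDl].
have pdw x : partial k dw x = partial k w (x + v) - partial k w x.
  apply: is_derive_partial; apply: is_derive_sub; last exact: Ck_deriv Hw _ _ _.
  by apply: is_derive_translate; exact: Ck_deriv Hw _ _ _.
have ccf x : {for x, continuous f} by exact: (proj1 cf).
have := @rVintegral_partial n N (fun x => f x * dw x) k N0.
have E x : partial k (fun x => f x * dw x) x =
   partial k f x * dw x + (f x * partial k w (x + v) - f x * partial k w x).
  rewrite -mulrBr -pdw; apply: is_derive_partial.
  by apply: is_derive_mul; [exact: Ck_deriv Hf _ _ _|exact: Ck_deriv Hdw _ _ _].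
move=> /(_ (Ck_mul openT Hf Hdw) (cc_mul ccf cdw)).
rewrite (_ : partial k _ = fun x => partial k f x * dw x +
   (f x * partial k w (x + v) - f x * partial k w x)); last by apply/funext.
have N10 : 0 <= N + 1 by rewrite addr_ge0.
have cN : cc (N + 1) (fun x => partial k w (x + v)).
  by have := cc_translate v (cpw k); apply: cc_le; rewrite /N addrAC.
have cN' : cc (N + 1) (partial k w).
  by apply: cc_le (cpw k); rewrite lerD2r lerDl.
rewrite (rVintegral_add N10); last 2 first.
- apply: cc_mul; first exact: (proj1 (cpf k)).
  by apply: cc_le cdw; rewrite lerDl.
- by apply: cc_sub; exact: cc_mul.
rewrite (rVintegral_sub N10); [|exact: cc_mul|exact: cc_mul].
rewrite -[rVintegral (fun x => partial k f x * dw x)]/I2.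
move=> /eqP; rewrite addr_eq0 => /eqP ->.
congr (- _); rewrite /I1.
under [in RHS]eq_fun do rewrite scaleNr -/v mulrBr.
have c3 : cc (N + 1) (fun x => partial k w x * f (x - v)).
  have := cc_translate (- v) cf; rewrite normrN => c4.
  apply: cc_le (cc_mul (proj1 (cpw k)) c4); by rewrite lerDl.
rewrite (rVintegral_sub N10 c3); last first.
  apply: cc_le (cc_mul (proj1 (cpw k)) cf); rewrite /N -addrA lerDl addr_ge0//.
congr (_ - _); last by apply: rVintegral_ext => x; rewrite mulrC.
rewrite -[RHS](rVintegral_translation v N10 c3).
by apply: rVintegral_ext => x; rewrite addrK mulrC.
Qed.

End Translations.

(** * Bump functions *)

Section Bumps.
Variable R : realType.
Implicit Types (t v e r : R).

(** The simplest function that is C^1 and vanishes exactly on the negative half-line; test forms ask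
    for no more regularity. *)
Definition pos_sq t := (Num.max t 0) ^+ 2.

Lemma is_derive_pos_sq t : is_derive t 1 pos_sq (2 * Num.max t 0).
Proof.
apply/is_derive_epsP => e e0; exists e => // h he.
rewrite scaler1; apply: (@le_trans _ _ (`|h| * `|h|)); last first.
  by rewrite ler_wpM2r// ltW.
rewrite -normrM ger0_norm ?sqr_ge0 -?expr2 ?sqr_ge0// /pos_sq ler_norml.
by case: (leP t 0) => t0; case: (leP (t + h) 0) => th; apply/andP; split; nra.
Qed.

Lemma continuous_max0 : continuous (fun t : R => Num.max t 0).
Proof.
move=> t; apply/continuous_epsP => e e0; exists e => // s.
rewrite ltr_norml => /andP[a b]; rewrite ler_norml.
by case: (leP s 0) => s0; case: (leP t 0) => t0; apply/andP; split; lra.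
Qed.

Lemma Ck_pos_sq n (L : 'rV[R]_n -> R) : Ck setT 1 L -> Ck setT 1 (fun x => pos_sq (L x)).
Proof.
move=> HL; apply: (@Ck_build _ _ _ _ _ (fun i x => partial i L x * (2 * Num.max (L x) 0))).
- exact: openT.
- move=> x i _; apply: is_derive_comp1; first exact: is_derive_pos_sq.
  exact: Ck_deriv HL _ _ _.
- move=> i; apply: Ck_mul; [exact: openT|exact: Ck_partial|].
  apply: Ck_scale; first exact: openT.
  apply: Ck0 => x _; apply: (@continuous_comp _ _ _ L (fun t => Num.max t 0)).
    exact: Ck_cont HL _ _.
  exact: continuous_max0.
Qed.

Lemma pos_sq_ge0 t : 0 <= pos_sq t. Proof. exact: sqr_ge0. Qed.

Lemma pos_sq0 t : t <= 0 -> pos_sq t = 0.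
Proof. by move=> t0; rewrite /pos_sq max_r// expr0n. Qed.

Lemma pos_sq_gt0 t : 0 < t -> 0 < pos_sq t.
Proof. by move=> t0; rewrite /pos_sq max_l ?exprn_gt0// ltW. Qed.

Definition step t := pos_sq t / (pos_sq t + pos_sq (1 - t)).

Lemma step_den t : 0 < pos_sq t + pos_sq (1 - t).
Proof.
have [t0|t0] := leP t 0.
  by rewrite ltr_wpDl ?pos_sq_ge0// pos_sq_gt0//; lra.
by rewrite ltr_pwDl ?pos_sq_ge0// pos_sq_gt0.
Qed.

Lemma step_ge0 t : 0 <= step t.
Proof. by rewrite divr_ge0 ?pos_sq_ge0// ltW// step_den. Qed.

Lemma step_le1 t : step t <= 1.
Proof. by rewrite ler_pdivrMr ?step_den// mul1r lerDl pos_sq_ge0. Qed.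

Lemma step0 t : t <= 0 -> step t = 0.
Proof. by move=> /pos_sq0 t0; rewrite /step t0 mul0r. Qed.

Lemma step1 t : 1 <= t -> step t = 1.
Proof.
move=> t1; rewrite /step [pos_sq (1 - t)]pos_sq0 ?addr0 ?divff// ?subr_le0//.
by rewrite gt_eqF// pos_sq_gt0//; lra.
Qed.

Lemma Ck_step n (L : 'rV[R]_n -> R) : Ck setT 1 L -> Ck setT 1 (fun x => step (L x)).
Proof.
move=> HL; apply: Ck_mul; [exact: openT|exact: Ck_pos_sq|].
have oT : open [set: 'rV[R]_n] by exact: openT.
apply: Ck_inv; [exact: oT|by move=> x _; rewrite gt_eqF// step_den|].
apply: Ck_add; [exact: oT|exact: Ck_pos_sq|].
by apply: Ck_pos_sq; apply: Ck_sub; [exact: oT|exact: Ck_cst|exact: HL].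
Qed.

(** In each coordinate the arguments of [step] remain at least 1 up to distance [r], and one of them
    drops to 0 at distance [2 * r]; a product over coordinates fits the max norm. *)
Definition bump n (p : 'rV[R]_n) r (x : 'rV[R]_n) : R :=
  \prod_i (step (2 - (x 0 i - p 0 i) / r) * step (2 + (x 0 i - p 0 i) / r)).

Section BumpTheory.
Variables (n : nat) (p : 'rV[R]_n) (r : R).
Hypothesis r0 : 0 < r.

Lemma Ck_bump : Ck setT 1 (bump p r).
Proof.
have oT : open [set: 'rV[R]_n] by exact: openT.
have H i : Ck setT 1 (fun x : 'rV[R]_n => (x 0 i - p 0 i) / r).
  apply: Ck_mul => //; last exact: Ck_cst.
  by apply: Ck_sub => //; [exact: Ck_coord|exact: Ck_cst].
apply: Ck_prod => // i _; apply: Ck_mul => //; apply: Ck_step.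
  by apply: Ck_sub => //; exact: Ck_cst.
by apply: Ck_add => //; exact: Ck_cst.
Qed.

Lemma bump_ge0 x : 0 <= bump p r x.
Proof. by apply: prodr_ge0 => i _; rewrite mulr_ge0 ?step_ge0. Qed.

Lemma bump_le1 x : bump p r x <= 1.
Proof.
apply: prodr_ile1 => i _; rewrite mulr_ge0 ?step_ge0//=.
by rewrite mulr_ile1 ?step_ge0 ?step_le1.
Qed.

Lemma bump1 x : `|x - p| <= r -> bump p r x = 1.
Proof.
move=> xp; rewrite /bump big1// => i _.
have : `|x 0 i - p 0 i| <= r.
  by apply: le_trans xp; have := norm_mx_coord (x - p) 0 i; rewrite !mxE.
rewrite ler_norml => /andP[a b].
rewrite !step1 ?mulr1//.
  have : - 1 <= (x 0 i - p 0 i) / r by rewrite ler_pdivlMr// mulN1r.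
  by lra.
have : (x 0 i - p 0 i) / r <= 1 by rewrite ler_pdivrMr// mul1r.
by lra.
Qed.

Lemma bump0 x : 2 * r <= `|x - p| -> bump p r x = 0.
Proof.
move=> xp.
have [i Hi] : exists i, 2 * r <= `|x 0 i - p 0 i|.
  apply: contrapT => H; have : `|x - p| < 2 * r.
    apply/norm_mx_ltP => [|i j]; first by rewrite mulr_gt0.
    by rewrite ord1 !mxE ltNge; apply/negP => Hj; apply: H; exists j.
  by rewrite ltNge xp.
rewrite /bump (bigD1 i)//= .
suff -> : step (2 - (x 0 i - p 0 i) / r) * step (2 + (x 0 i - p 0 i) / r) = 0 by rewrite mul0r.
have [s|s] := leP 0 (x 0 i - p 0 i).
  rewrite step0 ?mul0r//; have : 2 <= (x 0 i - p 0 i) / r.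
    by rewrite ler_pdivlMr// -(ger0_norm s).
  by lra.
rewrite [X in _ * X]step0 ?mulr0//; have : (x 0 i - p 0 i) / r <= - 2.
  by rewrite ler_pdivrMr// mulNr lerNr -(ltr0_norm s).
by lra.
Qed.

Lemma bump_cc : cc (`|p| + 2 * r) (bump p r).
Proof.
split => x; first exact: Ck_cont Ck_bump _ _.
move=> Hx; apply: bump0.
have : `|x| <= `|x - p| + `|p| by rewrite -{1}(subrK p x); exact: ler_normD.
by lra.
Qed.

End BumpTheory.
End Bumps.

Section Localization.
Variables (R : realType) (n : nat).
Implicit Types (U V K : set 'rV[R]_n) (f g : 'rV[R]_n -> R).

(** [U] and the complement of [K] are open and cover the space, and [f] is C^k on each. *)
Lemma Ck_zero_off U K k f : open U -> closed K -> K `<=` U -> (forall x, ~ K x -> f x = 0) ->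
  Ck U k f -> Ck setT k f.
Proof.
move=> Uo Kc KU f0 Hf.
have Ko : open (~` K) by exact: closed_openC.
have : Ck (U `|` ~` K) k f.
  by apply: Ck_union => //; apply: Ck_ext (Ck_cst k 0 Ko) => // x /f0.
apply: Ck_subset => x _; have [Kx|Kx] := pselect (K x); [left; exact: KU|by right].
Qed.

Lemma closed_norm_ball (p : 'rV[R]_n) (c : R) : closed [set x | `|x - p| <= c].
Proof. by apply: compact_closed; [exact: norm_hausdorff|exact: compact_norm_ball]. Qed.

Lemma cc_mul_bump V f (p : 'rV[R]_n) (r : R) : open V -> 0 < r ->
  [set x | `|x - p| <= 2 * r] `<=` V -> (forall x, V x -> {for x, continuous f}) ->
  cc (`|p| + 2 * r) (fun x => f x * bump p r x).
Proof.
move=> Vo r0 rV cf; split; last by move=> x Hx; rewrite (proj2 (bump_cc p r0))// mulr0.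
suff H : Ck setT 0 (fun x => f x * bump p r x) by move=> x; exact: Ck_cont H _ _.
apply: (@Ck_zero_off _ _ _ _ Vo (@closed_norm_ball p (2 * r)) rV).
  by move=> x Hx; rewrite bump0 ?mulr0// ltW// ltNge; apply/negP.
apply: Ck_mul; [exact: Vo|exact: Ck0|].
apply: (@Ck_subset _ _ setT V) => //; apply: CkS; exact: Ck_bump.
Qed.

(** If [f x0] were positive, [f] would be nonnegative on a small ball, and the integral against a
    bump supported there would be positive. *)
Lemma bump_fundamental V f (x0 : 'rV[R]_n) : open V -> V x0 ->
  (forall x, V x -> {for x, continuous f}) ->
  (forall r, 0 < r -> [set x | `|x - x0| <= 2 * r] `<=` V ->
     rVintegral (fun x => f x * bump x0 r x) = 0) ->
  f x0 = 0.
Proof.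
move=> Vo Vx0.
wlog f0 : f / 0 < f x0.
  move=> W cf If; have [f0|f0|//] := ltrgtP 0 (f x0); first by have := W f f0 cf If.
  apply/eqP; rewrite -oppr_eq0; apply/eqP; apply: (W (fun x => - f x)).
  - by rewrite oppr_gt0.
  - by move=> x /cf; exact: continuousN.
  - move=> r r0 rV; rewrite -[RHS](oppr0 R); rewrite -(If r r0 rV).
    rewrite -mulN1r -(rVintegral_scale _ _ (cc_mul_bump Vo r0 rV cf)).
      by apply: rVintegral_ext => x; rewrite mulN1r mulNr.
    by rewrite addr_ge0// mulr_ge0// ltW.
move=> cf If; exfalso.
have [r1 r10 Hr1] : exists2 r, 0 < r & forall y, `|y - x0| < r -> V y.
  by apply/nbhs_epsP; exact: open_near.
have [r2 r20 Hr2] : exists2 r, 0 < r & forall y, `|y - x0| < r -> 0 <= f y.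
  have /continuous_epsP/(_ _ f0)[r r0 Hr] := cf _ Vx0.
  by exists r => // y /Hr; rewrite ler_norml => /andP[]; lra.
pose r := Num.min r1 r2 / 3.
have r0 : 0 < r by rewrite divr_gt0// lt_min r10.
have rr1 : 2 * r < r1.
  have : Num.min r1 r2 <= r1 by rewrite ge_min lexx.
  by move: r0; rewrite /r; lra.
have rr2 : 2 * r < r2.
  have : Num.min r1 r2 <= r2 by rewrite ge_min lexx orbT.
  by move: r0; rewrite /r; lra.
have rV : [set x | `|x - x0| <= 2 * r] `<=` V.
  by move=> x /= xr; apply: Hr1; exact: le_lt_trans rr1.
have := If r r0 rV; apply/eqP; rewrite gt_eqF//.
apply: (@rVintegral_gt0 _ _ (`|x0| + 2 * r) _ x0).
- by rewrite addr_ge0// mulr_ge0// ltW.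
- exact: cc_mul_bump rV cf.
- move=> x; have [xr|xr] := leP (2 * r) `|x - x0|; first by rewrite bump0// mulr0.
  by rewrite mulr_ge0 ?bump_ge0//; apply: Hr2; exact: lt_trans rr2.
- by rewrite bump1 ?mulr1// subrr normr0 ltW.
Qed.

End Localization.

(** * Radial primitives of one-forms *)

Section UnitInterval.
Variable R : realType.
Local Notation mu := (@lebesgue_measure R).
Implicit Types (t s e h M K : R).

(** The retraction of the line onto the unit interval. Composing with it extends a function
    continuous at the points of [[0, 1]] to a continuous one on the line. *)
Definition clamp t := (1 + `|t| - `|t - 1|) / 2.

Lemma clampE t : 0 <= t <= 1 -> clamp t = t.
Proof.
by move=> /andP[t0 t1]; rewrite /clamp ger0_norm// ler0_norm ?subr_le0//; field.
Qed.

Lemma clamp_itv t : 0 <= clamp t <= 1.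
Proof. by rewrite /clamp; case: (ler0P t) => ?; case: (ler0P (t - 1)) => ?; lra. Qed.

Lemma continuous_clamp : continuous clamp.
Proof.
move=> t; apply/continuous_epsP => e e0; exists e => // s st.
have := lerB_dist s t; have := lerB_dist t s.
have := lerB_dist (s - 1) (t - 1); have := lerB_dist (t - 1) (s - 1).
rewrite (distrC t s) [t - 1 - (s - 1)](_ : _ = t - s); last by ring.
rewrite [s - 1 - (t - 1)](_ : _ = s - t); last by ring.
by rewrite (distrC t s) ler_norml /clamp; lra.
Qed.

(** By the substitution [t * s] the function is the primitive of [f] from 0 to [t]. The clamped
    extension lets the fundamental theorem be applied on an interval larger than [[0, 1]]. *)
Lemma scaled_primitive (f : R -> R) t : cont_on 0 1 f -> 0 < t < 1 ->
  is_derive t 1 (fun t => t * \int[mu]_(s in `[0, 1]) f (t * s)) (f t).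
Proof.
move=> cf t01.
pose g s := f (clamp s).
have cg s : {for s, continuous g}.
  apply: continuous_comp; first exact: continuous_clamp.
  by apply: cf; exact: clamp_itv.
have gf s : 0 <= s <= 1 -> g s = f s by move=> /clampE; rewrite /g => ->.
pose P (y : R) : R := \int[mu]_(s in `[-1, y]) g s.
have cgo a b : cont_on a b g by move=> s _; exact: cg.
have dP s : - 1 < s < 2 -> is_derive s 1 P (g s).
  by move=> s2; exact: (int_FTC1 (cgo _ 2)).
have PE s : 0 <= s <= 1 -> s * \int[mu]_(r in `[0, 1]) f (s * r) = P s - P 0.
  move=> /andP[s0 s1].
  have sr r : 0 <= r <= 1 -> 0 <= s * r <= 1.
    by move=> /andP[r0 r1]; rewrite mulr_ge0//= mulr_ile1.
  have csr r : {for r, continuous (fun r => s * r)}.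
    by apply: continuousM => //; exact: cst_continuous.
  rewrite -int_scale; last first.
    move=> r /sr sr1; apply: (@continuous_comp _ _ _ (fun r => s * r) f); first exact: csr.
    exact: cf.
  transitivity (\int[mu]_(r in `[0, 1]) (s * g (s * r))).
    by apply: eq_Rintegral => r; rewrite inE/= in_itv/= => /sr /gf ->.
  transitivity (P (s * 1) - P (s * 0)); last by rewrite mulr1 mulr0.
  apply: (@int_FTC2 R 0 1 (fun r => P (s * r)) (fun r => s * g (s * r))) => //.
  - move=> r _; apply: continuousM; first exact: cst_continuous.
    by apply: (@continuous_comp _ _ _ (fun r => s * r) g); [exact: csr|exact: cg].
  - move=> r r01; apply: is_derive_comp1.
      by apply: dP; have := sr r; lra.
    have := @is_derive_line R _ id 0 s r s.
    move=> /(_ (is_derive_id _ _)); apply: is_derive_ext => y.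
    by rewrite /= add0r mulrC.
  - move=> r r01; apply: (@continuous_comp _ _ _ (fun r => s * r) P); first exact: csr.
    have [d _] : is_derive (s * r) 1 P (g (s * r)) by apply: dP; have := sr r r01; lra.
    apply: differentiable_continuous; exact/derivable1_diffP.
have dPt : is_derive t 1 (fun s => P s - P 0) (f t).
  rewrite -[f t]subr0 -gf; last by lra.
  have H0 : is_derive t 1 P (g t) by apply: dP; lra.
  exact: is_derive_sub H0 (is_derive_const _ _ _).
apply: is_derive_near dPt.
apply/nbhs_epsP; exists (Num.min t (1 - t)); first by rewrite lt_min; lra.
move=> s; rewrite lt_min !ltr_norml => /andP[/andP[a b] /andP[c d]].
by rewrite PE//; lra.
Qed.

Lemma mean_value01 (F D : R -> R) K : cont_on 0 1 F -> F 0 = 0 ->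
  (forall t, 0 < t < 1 -> is_derive t 1 F (D t)) -> (forall t, 0 < t < 1 -> `|D t| <= K) ->
  forall t, 0 <= t <= 1 -> `|F t| <= K.
Proof.
move=> cF F0 dF DK t /andP[t0 t1].
have K0 : 0 <= K by apply: le_trans (DK (2^-1) _) => //; lra.
have [t00|tn0] := eqVneq t 0; first by rewrite t00 F0 normr0.
have tp : 0 < t by rewrite lt_neqAle eq_sym tn0.
have [||s] := @MVT R F D 0 t tp.
- by move=> s; rewrite in_itv/= => st; apply: dF; lra.
- by apply: cont_on_within => s st; apply: cF; lra.
rewrite in_itv/= => st; rewrite F0 !subr0 => ->.
rewrite normrM (gtr0_norm tp) -[leRHS]mulr1 ler_pM ?normr_ge0//.
by apply: DK; lra.
Qed.

End UnitInterval.

Section Radial.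
Variables (R : realType) (n : nat) (p : 'rV[R]_n).
Local Notation mu := (@lebesgue_measure R).
Implicit Types (A C : 'I_n -> 'rV[R]_n -> R) (w : R -> R) (t s e h M K : R).

Definition ray (x : 'rV[R]_n) t : 'rV[R]_n := p + t *: (x - p).

(** The homotopy operator of Poincare's lemma with centre [p]: weight 1 for a one-form, and weight
    [t] for a two-form with one index held fixed. *)
Definition radial w A (x : 'rV[R]_n) : R :=
  \int[mu]_(t in `[0, 1]) (w t * \sum_i A i (ray x t) * (x - p) 0 i).

Lemma ray0 x : ray x 0 = p. Proof. by rewrite /ray scale0r addr0. Qed.
Lemma ray1 x : ray x 1 = x. Proof. by rewrite /ray scale1r addrC subrK. Qed.

Lemma ray_ray x t s : ray (ray x t) s = ray x (t * s).
Proof. by rewrite /ray addrAC subrr add0r scalerA [s * t]mulrC. Qed.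

Lemma ray_sub x t : ray x t - p = t *: (x - p).
Proof. by rewrite /ray addrAC subrr add0r. Qed.

Lemma ray_step x t h k : ray (x + h *: bas k) t = ray x t + (t * h) *: bas k.
Proof. by rewrite /ray addrAC scalerDr addrA scalerA. Qed.

Lemma ray_dist x y t : 0 <= t <= 1 -> `|ray x t - ray y t| <= `|x - y|.
Proof.
move=> /andP[t0 t1]; rewrite /ray opprD addrACA subrr add0r -scalerBr opprB addrA subrK.
by rewrite normrZ ger0_norm// ler_piMl.
Qed.

Lemma ray_norm x t : 0 <= t <= 1 -> `|ray x t - p| <= `|x - p|.
Proof. by move=> t01; rewrite ray_sub normrZ ger0_norm ?ler_piMl//; case/andP: t01. Qed.

Lemma continuous_ray x t : {for t, continuous (ray x)}.
Proof.
apply: continuousD; first exact: cst_continuous.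
exact: scalel_continuous.
Qed.

Lemma continuous_along x (f : 'rV[R]_n -> R) : (forall y, {for y, continuous f}) ->
  forall t, {for t, continuous (fun t => f (ray x t))}.
Proof.
move=> cf t; apply: (@continuous_comp _ _ _ (ray x) f); [exact: continuous_ray|exact: cf].
Qed.

Lemma continuous_bigsum (V : normedModType R) (I : Type) (r : seq I) (F : I -> V -> R) (x : V) :
  (forall i, {for x, continuous (F i)}) -> {for x, continuous (fun y => \sum_(i <- r) F i y)}.
Proof.
move=> H; elim: r => [|i r IH].
  apply: (@continuous_near _ _ (fun=> 0)); last exact: cst_continuous.
  by apply: nearW => y; rewrite big_nil.
apply: (@continuous_near _ _ (fun y => F i y + \sum_(i <- r) F i y)).
  by apply: nearW => y; rewrite big_cons.
by apply: continuousD; [exact: H|exact: IH].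
Qed.

Section ContinuousForm.
Variables (M : R) (A : 'I_n -> 'rV[R]_n -> R) (w : R -> R).
Hypothesis cA : forall i, cc M (A i).
Hypothesis cw : forall t, {for t, continuous w}.
Hypothesis w1 : forall t, 0 <= t <= 1 -> `|w t| <= 1.

Lemma continuous_radial_sum x t :
  {for t, continuous (fun t => \sum_i A i (ray x t) * (x - p) 0 i)}.
Proof.
apply: continuous_bigsum => i; apply: continuousM; last exact: cst_continuous.
by apply: continuous_along; exact: (proj1 (cA i)).
Qed.

Lemma continuous_radial_integrand x t :
  {for t, continuous (fun t => w t * \sum_i A i (ray x t) * (x - p) 0 i)}.
Proof. by apply: continuousM; [exact: cw|exact: continuous_radial_sum]. Qed.

Lemma radial_bound x K : (forall i y, `|y - p| <= `|x - p| -> `|A i y| <= K) ->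
  `|radial w A x| <= n%:R * (K * `|x - p|).
Proof.
move=> AK; rewrite /radial -[leRHS]mulr1 -[X in _ * X](subr0 1).
apply: int_bound => // [t _|t t01]; first exact: continuous_radial_integrand.
rewrite normrM -[leRHS]mul1r; apply: ler_pM => //; first exact: w1.
apply: le_trans (ler_norm_sum _ _ _) _.
have -> : n%:R * (K * `|x - p|) = \sum_(i < n) K * `|x - p|.
  by rewrite sumr_const card_ord mulr_natl.
apply: ler_sum => i _; rewrite normrM ler_pM// ?norm_mx_coord//; apply: AK; exact: ray_norm.
Qed.

Lemma continuous_radial x : {for x, continuous (radial w A)}.
Proof.
apply/continuous_epsP => e e0.
have [K K0 AK] : exists2 K, 0 <= K & forall i y, `|A i y| <= K.
  have /choice[K HK] : forall i, exists K, 0 <= K /\ forall y, `|A i y| <= K.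
    by move=> i; have [K K0 H] := cc_bounded (cA i); exists K.
  exists (\sum_i K i); first by apply: sumr_ge0 => i _; have [] := HK i.
  move=> i y; apply: le_trans (proj2 (HK i) y) _.
  by rewrite (bigD1 i)//= lerDl sumr_ge0// => j _; have [] := HK j.
(* Each of the [n] terms changes by at most [e / L] times [|y - p|], which is at most [|x - p| + 1],
   plus [K] times [|y - x|], which is below [e / L]. *)
pose L := n%:R * (K + `|x - p| + 1) + 1.
have L0 : 0 < L by rewrite ltr_wpDl// mulr_ge0// !addr_ge0.
have eL : 0 < e / L by rewrite divr_gt0.
have [r r0 Hr] : exists2 r, 0 < r & forall y,  y < r -> forall i (a b : 'rV[R]_n),
    `|b - a| <= y -> `|A i b - A i a| <= e / L.
  apply: (@common_radius R _ _ (fun y => y)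
    (fun i y => forall (a b : 'rV[R]_n), `|b - a| <= y -> `|A i b - A i a| <= e / L)) => i.
  have [r r0 Hr] := cc_uniform (cA i) eL; exists r => // y yr a b ab.
  by apply: Hr; apply: le_lt_trans ab yr.
exists (Num.min r (Num.min 1 (e / L))); first by rewrite !lt_min r0 ltr01.
move=> y; rewrite !lt_min => /and3P[yr y1 yL].
have -> : radial w A y - radial w A x = \int[mu]_(t in `[0, 1])
   (w t * \sum_i A i (ray y t) * (y - p) 0 i + -1 * (w t * \sum_i A i (ray x t) * (x - p) 0 i)).
  rewrite int_add ?int_scale; first by rewrite mulN1r.
  - by move=> t _; exact: continuous_radial_integrand.
  - by move=> t _; exact: continuous_radial_integrand.
  - move=> t _; apply: continuousM; first exact: cst_continuous.
    exact: continuous_radial_integrand.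
rewrite -[leRHS]mulr1 -[X in _ * X](subr0 1).
apply: int_bound => // [t _|t t01].
  apply: continuousD; first exact: continuous_radial_integrand.
  apply: continuousM; first exact: cst_continuous.
  exact: continuous_radial_integrand.
rewrite mulN1r -mulrBr normrM -[leRHS]mul1r; apply: ler_pM => //; first exact: w1.
rewrite -sumrB; apply: le_trans (ler_norm_sum _ _ _) _.
apply: (@le_trans _ _ (\sum_(i < n) (e / L * (K + `|x - p| + 1)))); last first.
  rewrite sumr_const card_ord -[leLHS]mulr_natl; apply: (@le_trans _ _ (e / L * L)).
    by rewrite mulrCA ler_wpM2l ?lerDl// ltW.
  by rewrite divfK// gt_eqF.
apply: ler_sum => i _.
have -> : A i (ray y t) * (y - p) 0 i - A i (ray x t) * (x - p) 0 i =
  (A i (ray y t) - A i (ray x t)) * (y - p) 0 i + A i (ray x t) * (y - x) 0 i.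
  by rewrite !mxE; ring.
have yp : `|y - p| <= `|x - p| + 1.
  rewrite -(subrK x y) -addrA addrC; apply: le_trans (ler_normD _ _) _.
  by rewrite lerD2l ltW.
apply: le_trans (ler_normD _ _) _; have -> : e / L * (K + `|x - p| + 1) = e / L * (`|x - p| + 1) + e / L * K by ring.
apply: lerD; last first.
  by rewrite normrM mulrC ler_pM//; apply: le_trans (norm_mx_coord _ _ _) (ltW yL).
rewrite normrM ler_pM//; last exact: le_trans (norm_mx_coord _ _ _) yp.
by apply: Hr yr _ _ _ _; exact: ray_dist.
Qed.

End ContinuousForm.

Definition radial1 := radial (fun=> 1).
Definition radialt := radial id.

Section Derivatives.
Variables (M : R) (A : 'I_n -> 'rV[R]_n -> R).
Hypothesis cA : forall i, cc M (A i).

Lemma continuous_radial1 x : {for x, continuous (radial1 A)}.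
Proof.
apply: (continuous_radial cA); first by move=> t; exact: cst_continuous.
by move=> t _; rewrite normr1.
Qed.

Lemma continuous_radialt x : {for x, continuous (radialt A)}.
Proof.
apply: (continuous_radial cA) => [t|t /andP[t0 t1]]; first exact: cvg_id.
by rewrite ger0_norm.
Qed.

Lemma radial1_p : radial1 A p = 0.
Proof.
have := @radial_bound M A (fun=> 1) cA _ _ p 0.
rewrite subrr normr0 mulr0 mulr0 normr_le0.
have [K _ HK] : exists2 K, true & forall i y, `|y - p| <= 0 -> `|A i y| <= K.
  exists (\sum_i `|A i p|) => // i y; rewrite normr_le0 subr_eq0 => /eqP ->.
  by rewrite (bigD1 i)//= lerDl sumr_ge0.
have := @radial_bound M A (fun=> 1) cA _ _ p K.
rewrite subrr normr0 !mulr0 normr_le0 => H _; apply/eqP; apply: H => //.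
- by move=> t; exact: cst_continuous.
- by move=> t _; rewrite normr1.
Qed.

Lemma is_derive_radial1 x t : 0 < t < 1 ->
  is_derive t 1 (fun t => radial1 A (ray x t)) (\sum_i A i (ray x t) * (x - p) 0 i).
Proof.
move=> t01; have := @scaled_primitive R (fun t => \sum_i A i (ray x t) * (x - p) 0 i) t.
have cs s : {for s, continuous (fun t => \sum_i A i (ray x t) * (x - p) 0 i)}.
  exact: continuous_radial_sum.
move=> /(_ (fun s _ => cs s) t01) H; apply: is_derive_ext H => s.
rewrite -int_scale; last first.
  move=> r _; apply: (@continuous_comp _ _ _ (fun r => s * r)
    (fun t => \sum_i A i (ray x t) * (x - p) 0 i)); last exact: (continuous_radial_sum cA).
  by apply: continuousM => //; exact: cst_continuous.
rewrite /radial1 /radial; congr (Rintegral _ _ _); apply/funext => r.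
rewrite mul1r mulr_sumr; apply: eq_bigr => i _.
by rewrite ray_ray ray_sub [in RHS]mxE mulrCA.
Qed.

(** Rescaling the ray yields only one factor [t] from [ray_sub]; the second one needed by the weight
    [t] has to be put in front of [radialt]. *)
Lemma is_derive_radialt x t : 0 < t < 1 ->
  is_derive t 1 (fun t => t * radialt A (ray x t)) (t * \sum_i A i (ray x t) * (x - p) 0 i).
Proof.
move=> t01; have := @scaled_primitive R (fun t => t * \sum_i A i (ray x t) * (x - p) 0 i) t.
have cs s : {for s, continuous (fun t => t * \sum_i A i (ray x t) * (x - p) 0 i)}.
  by apply: continuousM => //; exact: continuous_radial_sum.
move=> /(_ (fun s _ => cs s) t01) H; apply: is_derive_ext H => s.
congr (_ * _).
rewrite /radialt /radial; congr (Rintegral _ _ _); apply/funext => r.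
rewrite mulrAC mulrC; congr (_ * _).
rewrite mulr_sumr; apply: eq_bigr => i _.
by rewrite ray_ray ray_sub [in RHS]mxE mulrCA.
Qed.

End Derivatives.

(* The radial primitive of a C^1 one-form is differentiated by the mean value
   theorem along rays, so that no integral depending on a parameter has to be
   differentiated. *)
Lemma partial_radial1_C1 M rho A C k x : (forall i, Ck setT 1 (A i)) -> (forall i, cc M (A i)) ->
  (forall i, cc M (C i)) ->
  (forall i y, `|y - p| < rho -> partial k (A i) y - partial i (A k) y = - C i y) ->
  `|x - p| < rho ->
  is_derive x (bas k) (radial1 A) (A k x - radialt C x).
Proof.
move=> A1 cA cC AC xrho; apply/is_derive_epsP => e e0.
pose v := x - p; pose L := 1 + \sum_i `|v 0 i|.
have L0 : 0 < L by rewrite ltr_pwDl// sumr_ge0.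
have eL : 0 < e / L by rewrite divr_gt0.
have [r1 r10 Hr1] := cc_uniform (cA k) eL.
have [r2 r20 Hr2] : exists2 r, 0 < r & forall y, y < r -> forall i (a b : 'rV[R]_n),
    `|b - a| <= y -> `|partial k (A i) b - partial k (A i) a| <= e / L.
  apply: (@common_radius R _ _ (fun y => y) (fun i y => forall (a b : 'rV[R]_n),
     `|b - a| <= y -> `|partial k (A i) b - partial k (A i) a| <= e / L)) => i.
  have [r r0 Hr] := cc_uniform (cc_partial k (A1 i) (cA i)) eL; exists r => // y yr a b ab.
  by apply: Hr; apply: le_lt_trans ab yr.
exists (Num.min r1 r2); first by rewrite lt_min r10.
move=> h; rewrite lt_min => /andP[hr1 hr2].
pose x' := x + h *: bas k.
(* At [t = 1] this is the error of the linear approximation. Its derivative [D] is computed from the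
   pairing of [A] with the rays; the relation between [partial k (A i)] and [partial i (A k)] leaves
   only terms that are small by uniform continuity. *)
pose F t := radial1 A (ray x' t) - radial1 A (ray x t)
  - h * (t * A k (ray x t) - t * radialt C (ray x t)).
pose a t := \sum_i A i (ray x t) * v 0 i.
pose a' t := \sum_i A i (ray x' t) * (x' - p) 0 i.
pose c t := \sum_i C i (ray x t) * v 0 i.
pose D t := a' t - a t - h * ((A k (ray x t) + t * \sum_i v 0 i * partial i (A k) (ray x t)) - t * c t).
suff : `|F 1| <= `|h| * (e / L) * L.
  by rewrite /F !ray1 !mul1r => /le_trans; apply; rewrite -mulrA divfK ?gt_eqF// mulrC.
apply: (@mean_value01 R F D) => //; last 1 first.
- by rewrite ler01 lexx.
- have cr y t : {for t, continuous (fun t => radial1 A (ray y t))}.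
    by apply: continuous_along; exact: (continuous_radial1 cA).
  have ct t : {for t, continuous (fun t => radialt C (ray x t))}.
    by apply: continuous_along; exact: (continuous_radialt cC).
  have ck t : {for t, continuous (fun t => A k (ray x t))}.
    by apply: continuous_along; exact: (proj1 (cA k)).
  move=> t _; apply: continuousB; first by apply: continuousB; exact: cr.
  apply: continuousM; first exact: cst_continuous.
  by apply: continuousB; (apply: continuousM; first exact: cvg_id); [exact: ck|exact: ct].
- by rewrite /F !ray0 !mul0r !subrr mulr0 subrr.
- move=> t t01; apply: is_derive_sub.
    by apply: is_derive_sub; exact: (is_derive_radial1 cA).
  have H2 := is_derive_radialt cC x t01.
  have H1 : is_derive t 1 (fun t => t * A k (ray x t))
     (1 * A k (ray x t) + t * \sum_i v 0 i * partial i (A k) (ray x t)).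
    have Hk : is_derive t 1 (fun t => A k (ray x t))
      (\sum_i v 0 i * partial i (A k) (ray x t)).
      by apply: (@Ck_line _ _ setT 0) => //; exact: openT.
    exact: is_derive_mul (is_derive_id _ _) Hk.
  have := is_derive_mul (is_derive_const t 1 h) (is_derive_sub H1 H2).
  by rewrite mul0r add0r mul1r.
move=> t /andP[t0 t1].
have t01 : 0 <= t <= 1 by rewrite !ltW.
have th : `|t * h| <= `|h| by rewrite normrM gtr0_norm// ler_piMl// ltW.
have mv i : exists2 s, `|s| <= `|h| & A i (ray x' t) - A i (ray x t) =
    (t * h) * partial k (A i) (ray x t + s *: bas k).
  rewrite ray_step.
  have [s _|s sh ->] := @MVT_line R _ (A i) (ray x t) (bas k) (partial k (A i)) (t * h).
    exact: Ck_deriv (A1 i) _ _ _.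
  by exists s => //; exact: le_trans th.
have xv i : (x' - p) 0 i = v 0 i + h * (i == k)%:R.
  by rewrite /x' addrAC !mxE eqxx/=.
have ck : A k (ray x' t) - A k (ray x t) = A k (ray x t + (t * h) *: bas k) - A k (ray x t).
  by rewrite ray_step.
have -> : D t = h * (A k (ray x' t) - A k (ray x t)) +
   \sum_i (A i (ray x' t) - A i (ray x t) - t * h * partial k (A i) (ray x t)) * v 0 i.
  have E : t * \sum_i v 0 i * partial i (A k) (ray x t) - t * c t =
     t * \sum_i v 0 i * partial k (A i) (ray x t).
    rewrite /c -mulrBr -sumrB; congr (_ * _); apply: eq_bigr => i _.
    have := AC i (ray x t); rewrite (le_lt_trans (ray_norm x t01) xrho) => /(_ isT).
    move=> /(canRL (addrK _)); rewrite opprK => ->.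
    by ring.
  have E' : a' t = \sum_i A i (ray x' t) * v 0 i + h * A k (ray x' t).
    rewrite /a'; under eq_bigr do rewrite xv mulrDr.
    rewrite big_split/=; congr (_ + _); rewrite (bigD1 k)//= eqxx mulr1 mulrC big1 ?addr0//.
    by move=> i /negbTE ->; rewrite !mulr0.
  have -> : \sum_i (A i (ray x' t) - A i (ray x t) - t * h * partial k (A i) (ray x t)) * v 0 i =
    \sum_i A i (ray x' t) * v 0 i - a t - h * (t * \sum_i v 0 i * partial k (A i) (ray x t)).
    rewrite /a !mulr_sumr -!sumrB; apply: eq_bigr => i _; ring.
  rewrite /D E' -[_ + _ - t * c t]addrA E; ring.
have At : `|A k (ray x' t) - A k (ray x t)| <= e / L.
  apply: Hr1; rewrite ray_step addrAC subrr add0r norm_bas_scale.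
  exact: le_lt_trans hr1.
have LE : L = 1 + \sum_i `|v 0 i| by [].
rewrite [X in _ <= _ * X]LE [leRHS]mulrDr mulr1; apply: le_trans (ler_normD _ _) _; apply: lerD.
  by rewrite normrM ler_wpM2l.
apply: le_trans (ler_norm_sum _ _ _) _; rewrite mulr_sumr; apply: ler_sum => i _.
rewrite normrM ler_wpM2r//; have [s sh ->] := mv i.
rewrite -mulrBr normrM ler_pM//; apply: Hr2 hr2 _ _ _ _.
by rewrite addrAC subrr add0r norm_bas_scale.
Qed.

End Radial.

(** * Mollification and one-forms with a prescribed distributional differential *)

Section Mollification.
Variables (R : realType) (n : nat).
Implicit Types (F G : 'rV[R]_n -> R) (e r M K : R) (z : 'rV[R]_n).

Lemma rVintegral_norm_le M F G : 0 <= M -> cc M F -> cc M G ->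
  (forall x, `|F x| <= G x) -> `|rVintegral F| <= rVintegral G.
Proof.
move=> M0 cF cG FG; rewrite ler_norml; apply/andP; split.
  rewrite -mulN1r -(rVintegral_scale _ M0 cG); apply: (rVintegral_le M0) => //.
    exact: cc_scale.
  by move=> x; rewrite mulN1r; have := FG x; rewrite ler_norml => /andP[].
by apply: (rVintegral_le M0) => // x; apply: le_trans (ler_norm _) _.
Qed.

Definition bump_mass e : R := rVintegral (bump (0 : 'rV[R]_n) e).

Definition mollify e F (z : 'rV[R]_n) : R :=
  (bump_mass e)^-1 * rVintegral (fun x => F x * bump 0 e (x - z)).

Lemma bump_mass_gt0 e : 0 < e -> 0 < bump_mass e.
Proof.
move=> e0; apply: (@rVintegral_gt0 _ _ (`|0 : 'rV[R]_n| + 2 * e) _ 0).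
- by rewrite addr_ge0// mulr_ge0// ltW.
- exact: bump_cc.
- by move=> x; exact: bump_ge0.
- by rewrite bump1// subrr normr0 ltW.
Qed.

Lemma bump_translate_cc e z : 0 < e ->
  cc (`|0 : 'rV[R]_n| + 2 * e + `|z|) (fun x => bump 0 e (x - z)).
Proof. by move=> e0; rewrite -(normrN z); exact: cc_translate (bump_cc _ e0). Qed.

Lemma bump_translate_mass e z : 0 < e -> rVintegral (fun x => bump 0 e (x - z)) = bump_mass e.
Proof.
move=> e0; apply: rVintegral_translation (bump_cc _ e0).
by rewrite addr_ge0// mulr_ge0// ltW.
Qed.

Lemma partial_bump_translate e z k x : 0 < e ->
  partial k (fun x => bump 0 e (x - z)) x = partial k (bump (0 : 'rV[R]_n) e) (x - z).
Proof.
by move=> e0; apply: (partial_translate (f := bump (0 : 'rV[R]_n) e)); exact: Ck_bump.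
Qed.

Lemma mollify_close M F : cc M F -> forall eta, 0 < eta -> exists2 r, 0 < r &
  forall e, 0 < e -> e < r -> forall z, `|mollify e F z - F z| <= eta.
Proof.
move=> cF eta eta0; have [r r0 Hr] := cc_uniform cF eta0.
exists (r / 2); first by rewrite divr_gt0.
move=> e e0 er z.
set N := `|0 : 'rV[R]_n| + 2 * e + `|z|.
have N0 : 0 <= N by rewrite !addr_ge0// mulr_ge0// ltW.
have cb := bump_translate_cc z e0.
have cFc := proj1 cF.
have -> : mollify e F z - F z =
    (bump_mass e)^-1 * rVintegral (fun x => (F x - F z) * bump 0 e (x - z)).
  rewrite -[X in _ = _ * X](_ : rVintegral (fun x => F x * bump 0 e (x - z)) -
     F z * bump_mass e = _).
    by rewrite mulrBr mulrCA mulVf ?mulr1// gt_eqF// bump_mass_gt0.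
  rewrite -(bump_translate_mass z e0) -(rVintegral_scale _ N0 cb).
  rewrite -(rVintegral_sub N0); [|exact: cc_mul|exact: cc_scale].
  by apply: rVintegral_ext => x; rewrite mulrBl.
have m0 := bump_mass_gt0 e0.
rewrite normrM normfV (gtr0_norm m0) mulrC ler_pdivrMr//.
rewrite -(bump_translate_mass z e0) -(rVintegral_scale _ N0 cb).
apply: (rVintegral_norm_le N0); [|exact: cc_scale|].
  apply: cc_mul => // x; apply: continuousB; first exact: cFc.
  exact: cst_continuous.
move=> x; rewrite normrM [X in _ * X]ger0_norm ?bump_ge0//.
have [xz|xz] := leP (2 * e) `|x - z|; first by rewrite bump0 ?subr0// !mulr0.
by rewrite ler_wpM2r ?bump_ge0//; apply: Hr; lra.
Qed.

Lemma integral_translate_continuous M N F G : 0 <= M -> cc M F -> cc N G ->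
  forall z, {for z, continuous (fun z : 'rV[R]_n => rVintegral (fun x => F x * G (x - z)))}.
Proof.
move=> M0 cF cG z; apply/continuous_epsP => e e0.
have [K K0 HK] := cc_bounded cF.
pose L := (2 * M) ^+ n * K + 1.
have L0 : 0 < L by rewrite ltr_wpDl// mulr_ge0// exprn_ge0// mulr_ge0.
have [r r0 Hr] := cc_uniform cG (divr_gt0 e0 L0).
exists r => // y yz.
have cm a : cc M (fun x => F x * G (x - a)).
  under eq_fun do rewrite mulrC; apply: cc_mul => // x.
  exact: (proj1 (cc_translate (- a) cG)).
rewrite -(rVintegral_sub M0)//.
apply: le_trans (@rVintegral_bound _ _ M _ (K * (e / L)) M0 _ (cc_sub (cm y) (cm z)) _) _.
- by rewrite mulr_ge0// ltW// divr_gt0.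
- move=> x; rewrite -mulrBr normrM ler_pM//; apply: Hr.
  by rewrite opprB addrC addrA subrK distrC.
- rewrite mulrA mulrC mulrAC ler_pdivrMr// ler_wpM2l//; first exact: ltW.
  by rewrite /L lerDl.
Qed.

Lemma is_derive_mollify M F e k z : 0 <= M -> cc M F -> 0 < e ->
  is_derive z (bas k) (mollify e F)
   (- ((bump_mass e)^-1 * rVintegral (fun x => F x * partial k (bump 0 e) (x - z)))).
Proof.
move=> M0 cF e0; apply/is_derive_epsP => eta eta0.
have m0 := bump_mass_gt0 e0.
have [K K0 HK] := cc_bounded cF.
set N := `|0 : 'rV[R]_n| + 2 * e + `|z|.
have N0 : 0 <= N by rewrite !addr_ge0// mulr_ge0// ltW.
have C1 : Ck setT 1 (fun x => bump 0 e (x - z)) by apply: Ck_translate; exact: Ck_bump.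
have em : 0 < eta * bump_mass e by rewrite mulr_gt0.
have [r r0 Hr] := integral_difference k N0 C1 (bump_translate_cc z e0) (proj1 cF) HK em.
exists r => // h hr.
(* Moving [z] by [h] moves the argument [x - z] of the bump by [- h]. *)
have := Hr (- h); rewrite normrN => /(_ hr).
have cm a : cc M (fun x => F x * bump 0 e (x - a)).
  under eq_fun do rewrite mulrC; apply: cc_mul => // x.
  exact: (proj1 (bump_translate_cc a e0)).
rewrite (_ : rVintegral (fun x => F x * (_ - _)) =
   rVintegral (fun x => F x * bump 0 e (x - (z + h *: bas k))) -
   rVintegral (fun x => F x * bump 0 e (x - z))); last first.
  rewrite -(rVintegral_sub M0)//; apply: rVintegral_ext => x.
  by rewrite -mulrBr opprD addrA scaleNr addrAC.
rewrite (_ : rVintegral (fun x => F x * partial k (fun x => bump 0 e (x - z)) x) =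
   rVintegral (fun x => F x * partial k (bump 0 e) (x - z))); last first.
  by apply: rVintegral_ext => x; rewrite partial_bump_translate.
set I1 := rVintegral _; set I2 := rVintegral _; set I3 := rVintegral _ => H.
rewrite /mollify -/I1 -/I2.
have -> : (bump_mass e)^-1 * I1 - (bump_mass e)^-1 * I2 - h * - ((bump_mass e)^-1 * I3) =
  (bump_mass e)^-1 * (I1 - I2 - - h * I3) by ring.
by rewrite normrM normfV (gtr0_norm m0) mulrC ler_pdivrMr// mulrAC.
Qed.

Lemma Ck_mollify M F e : 0 <= M -> cc M F -> 0 < e -> Ck setT 1 (mollify e F).
Proof.
move=> M0 cF e0.
apply: (@Ck_build _ _ _ _ _ (fun k z =>
   - ((bump_mass e)^-1 * rVintegral (fun x => F x * partial k (bump 0 e) (x - z))))).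
- exact: openT.
- by move=> z k _; exact: is_derive_mollify cF e0.
- move=> k; apply: Ck0 => z _; apply: continuousN; apply: continuousM.
    exact: cst_continuous.
  apply: (integral_translate_continuous M0 cF).
  by apply: (cc_partial k) (bump_cc _ e0); exact: Ck_bump.
Qed.

Lemma mollify_cc M F e : 0 <= M -> cc M F -> 0 < e -> cc (M + 2 * e) (mollify e F).
Proof.
move=> M0 cF e0; split => z; first exact: Ck_cont (Ck_mollify M0 cF e0) _ _.
move=> Mz; rewrite /mollify (rVintegral_ext (g := fun=> 0)) ?rVintegral0 ?mulr0// => x.
have [xM|xM] := leP M `|x|; first by rewrite (proj2 cF)// mul0r.
rewrite bump0 ?mulr0// subr0 distrC.
have : `|z| <= `|z - x| + `|x| by rewrite -{1}(subrK x z); exact: ler_normD.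
by lra.
Qed.

(** Mollification differentiates the translated bump only, and that bump is an admissible [chi] as
    long as its support, of radius [2 * e] about [z], stays in the ball of radius [rho]. *)
Lemma mollify_weak M (Ak Al C : 'rV[R]_n -> R) k l (p : 'rV[R]_n) rho e z :
  0 <= M -> cc M Ak -> cc M Al -> cc M C -> 0 < e -> `|z - p| < rho - 2 * e ->
  (forall chi, Ck setT 1 chi -> (forall x, rho <= `|x - p| -> chi x = 0) ->
    rVintegral (fun x => - (Al x * partial k chi x) + Ak x * partial l chi x + chi x * C x) = 0) ->
  partial k (mollify e Al) z - partial l (mollify e Ak) z = - mollify e C z.
Proof.
move=> M0 cAk cAl cC e0 zp W.
have C1 : Ck setT 1 (fun x => bump 0 e (x - z)) by apply: Ck_translate; exact: Ck_bump.
rewrite (is_derive_partial (is_derive_mollify k z M0 cAl e0)).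
rewrite (is_derive_partial (is_derive_mollify l z M0 cAk e0)).
have := W _ C1; rewrite (_ : rVintegral _ =
  - rVintegral (fun x => Al x * partial k (bump 0 e) (x - z))
  + rVintegral (fun x => Ak x * partial l (bump 0 e) (x - z))
  + rVintegral (fun x => C x * bump 0 e (x - z))).
  rewrite /mollify => H.
  have : - rVintegral (fun x => Al x * partial k (bump 0 e) (x - z))
  + rVintegral (fun x => Ak x * partial l (bump 0 e) (x - z))
  + rVintegral (fun x => C x * bump 0 e (x - z)) = 0.
    apply: H => x xp; apply: bump0 => //; rewrite subr0.
    have : `|x - p| <= `|x - z| + `|z - p|.
      exact: ler_distD.
    by lra.
  move=> /eqP; rewrite addr_eq0 => /eqP H2.
  by rewrite -[RHS]mulrN -H2 mulrDr mulrN opprK.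
have cp (i : 'I_n) : cc (`|0 : 'rV[R]_n| + 2 * e + 1) (partial i (bump 0 e)).
  by apply: cc_partial (bump_cc _ e0); exact: Ck_bump.
have c1 F i : cc M F -> cc M (fun x => F x * partial i (bump 0 e) (x - z)).
  move=> cF; under eq_fun do rewrite mulrC; apply: cc_mul => // x.
  exact: (proj1 (cc_translate (- z) (cp i))).
have c2 : cc M (fun x => C x * bump 0 e (x - z)).
  under eq_fun do rewrite mulrC; apply: cc_mul => // x.
  exact: (proj1 (bump_translate_cc z e0)).
rewrite -[- rVintegral _]mulN1r -(rVintegral_scale _ M0); last exact: c1.
rewrite -(rVintegral_add M0); [|by apply: cc_scale; exact: c1|exact: c1].
rewrite -(rVintegral_add M0); [|apply: cc_add; [by apply: cc_scale; exact: c1|exact: c1]|exact: c2].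
apply: rVintegral_ext => x; rewrite (partial_bump_translate z k x e0).
by rewrite (partial_bump_translate z l x e0) mulN1r (mulrC (C x)).
Qed.

(** The classical theorem on uniform limits of functions together with their derivatives, by the
    mean value theorem for the approximating [B']. *)
Lemma is_derive_limit (B E : 'rV[R]_n -> R) x k r : 0 < r -> {for x, continuous E} ->
  (forall eta, 0 < eta -> exists B' E' : 'rV[R]_n -> R, forall y, `|y - x| < r ->
     [/\ is_derive y (bas k) B' (E' y), `|B' y - B y| <= eta & `|E' y - E y| <= eta]) ->
  is_derive x (bas k) B (E x).
Proof.
move=> r0 cE H; apply/is_derive_epsP => e e0.
have e20 : 0 < e / 2 by rewrite divr_gt0.
have /continuous_epsP/(_ _ e20)[s s0 Hs] := cE.
exists (Num.min r s); first by rewrite lt_min r0.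
move=> h; rewrite lt_min => /andP[hr hs].
have [->|h0] := eqVneq h 0; first by rewrite scale0r addr0 subrr mul0r subr0 normr0 mulr0.
have hp : 0 < `|h| by rewrite normr_gt0.
(* The approximation is chosen after [h]: two values of [B'] and [h] times one of [E'] cost
   [(2 + |h|) * eta], which is half of the allowed error. *)
pose eta := `|h| * e / 2 / (2 + `|h|).
have d0 : 0 < 2 + `|h| by rewrite ltr_wpDr.
have eta0 : 0 < eta by rewrite !divr_gt0// mulr_gt0.
have [B' [E' HB]] := H _ eta0.
have xh t : `|x + t *: bas k - x| = `|t| by rewrite addrAC subrr add0r norm_bas_scale.
have [t th|t th Ht] := @MVT_line _ _ B' x (bas k) E' h.
  by have [] := HB (x + t *: bas k); rewrite ?xh; first exact: le_lt_trans hr.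
have [] := HB (x + h *: bas k); rewrite ?xh// => _ b1 _.
have [] := HB x; rewrite ?subrr ?normr0// => _ b2 _.
have [] := HB (x + t *: bas k); rewrite ?xh; first exact: le_lt_trans hr.
move=> _ _ b3; have := Hs (x + t *: bas k); rewrite xh => /(_ (le_lt_trans th hs)) b4.
set y := x + t *: bas k in Ht b3 b4; set x' := x + h *: bas k in Ht b1 *.
have -> : B x' - B x - h * E x = - (B' x' - B x') + (B' x - B x) + h * (E' y - E y)
   + h * (E y - E x).
  have : h * E' y = B' x' - B' x by rewrite Ht.
  by rewrite !mulrBr => ->; ring.
have n1 : `|h * (E' y - E y)| <= `|h| * eta by rewrite normrM ler_wpM2l.
have n2 : `|h * (E y - E x)| <= `|h| * (e / 2) by rewrite normrM ler_wpM2l.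
have n3 : (2 + `|h|) * eta = `|h| * e / 2 by rewrite mulrC /eta divfK// gt_eqF.
apply: le_trans (ler_normD _ _) _; apply: le_trans (lerD (ler_normD _ _) n2) _.
apply: le_trans (lerD (lerD (ler_normD _ _) n1) (lexx _)) _; rewrite normrN.
rewrite mulrDl in n3; lra.
Qed.

Lemma radial_dist M (p : 'rV[R]_n) (w : R -> R) (A A' : 'I_n -> 'rV[R]_n -> R) K x :
  (forall i, cc M (A i)) -> (forall i, cc M (A' i)) ->
  (forall t, {for t, continuous w}) -> (forall t, 0 <= t <= 1 -> `|w t| <= 1) ->
  (forall i y, `|A i y - A' i y| <= K) ->
  `|radial p w A x - radial p w A' x| <= n%:R * (K * `|x - p|).
Proof.
move=> cA cA' cw w1 HK.
have cD i : cc M (fun y => A i y - A' i y) by exact: cc_sub.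
rewrite (_ : _ - _ = radial p w (fun i y => A i y - A' i y) x).
  by apply: (radial_bound cD) => // i y _; exact: HK.
rewrite /radial -mulN1r -int_scale; last by move=> t _; exact: (continuous_radial_integrand cA').
rewrite -int_add.
- congr (Rintegral _ _ _); apply/funext => t; rewrite mulN1r -mulrBr -sumrB; congr (_ * _).
  by apply: eq_bigr => i _; rewrite mulrBl.
- by move=> t _; exact: (continuous_radial_integrand cA).
- move=> t _; apply: continuousM; first exact: cst_continuous.
  exact: (continuous_radial_integrand cA').
Qed.

(* The assumption on the integrals is d_i A_k - d_k A_i = C_i in the sense of
   distributions; mollifying [A] and [C] reduces the claim to [partial_radial1_C1]. *)
Theorem partial_radial1_weak M rho (p : 'rV[R]_n) (A C : 'I_n -> 'rV[R]_n -> R) k x :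
  0 <= M -> (forall i, cc M (A i)) -> (forall i, cc M (C i)) ->
  (forall i chi, Ck setT 1 chi -> (forall x, rho <= `|x - p| -> chi x = 0) ->
    rVintegral (fun x => - (A i x * partial k chi x) + A k x * partial i chi x + chi x * C i x) = 0) ->
  `|x - p| < rho -> is_derive x (bas k) (radial1 p A) (A k x - radialt p C x).
Proof.
move=> M0 cA cC W xrho; pose r := (rho - `|x - p|) / 2.
have r0 : 0 < r by rewrite divr_gt0// subr_gt0.
apply: (is_derive_limit (E := fun x => A k x - radialt p C x) r0).
  apply: continuousB; first exact: (proj1 (cA k)).
  exact: (continuous_radialt cC).
move=> eta eta0.
(* The error of [A k] is at most [eta'] and that of a radial integral at most [n * eta' * rho];
   together this is [eta]. *)
pose L := 1 + n%:R * rho.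
have rho0 : 0 < rho by apply: le_lt_trans xrho.
have L0 : 0 < L by rewrite ltr_pwDl// mulr_ge0// ltW.
pose eta' := eta / L.
have eta'0 : 0 < eta' by rewrite divr_gt0.
have [s1 s10 H1] : exists2 s, 0 < s & forall e, e < s -> forall i, 0 < e ->
    forall z, `|mollify e (A i) z - A i z| <= eta'.
  apply: (@common_radius R _ _ id (fun i e => 0 < e -> forall z, `|mollify e (A i) z - A i z| <= eta')).
  by move=> i; have [s s0 Hs] := mollify_close (cA i) eta'0; exists s => // e es e0; exact: Hs.
have [s2 s20 H2] : exists2 s, 0 < s & forall e, e < s -> forall i, 0 < e ->
    forall z, `|mollify e (C i) z - C i z| <= eta'.
  apply: (@common_radius R _ _ id (fun i e => 0 < e -> forall z, `|mollify e (C i) z - C i z| <= eta')).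
  by move=> i; have [s s0 Hs] := mollify_close (cC i) eta'0; exists s => // e es e0; exact: Hs.
(* With [2 * e <= r] the ball of radius [r] about [x] lies where the mollified equation holds, at
   distance less than [rho - 2 * e] from [p]. *)
pose e := Num.min r (Num.min s1 s2) / 2.
have e0 : 0 < e by rewrite divr_gt0// !lt_min r0 s10.
have er : 2 * e <= r by rewrite /e mulrC divfK// ge_min lexx.
have es1 : e < s1.
  have : 2 * e <= s1 by rewrite /e mulrC divfK// !ge_min lexx !orbT.
  by lra.
have es2 : e < s2.
  have : 2 * e <= s2 by rewrite /e mulrC divfK// !ge_min lexx !orbT.
  by lra.
have cA' i : cc (M + 2 * e) (mollify e (A i)) by exact: mollify_cc.
have cC' i : cc (M + 2 * e) (mollify e (C i)) by exact: mollify_cc.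
have Me : M <= M + 2 * e by lra.
exists (radial1 p (fun i => mollify e (A i))).
exists (fun y => mollify e (A k) y - radialt p (fun i => mollify e (C i)) y) => y yx.
have yp : `|y - p| < rho - 2 * e.
  have : `|y - p| <= `|y - x| + `|x - p| by exact: ler_distD.
  by move: er yx; rewrite /r; lra.
have bnd a : a <= n%:R * (eta' * `|y - p|) -> a <= n%:R * (eta' * rho).
  by move=> /le_trans; apply; rewrite ler_wpM2l// ler_wpM2l; [|exact: ltW|lra].
have nle : n%:R * (eta' * rho) + eta' = eta.
  by rewrite mulrCA -[X in _ + X]mulr1 -mulrDr addrC -/L divfK// gt_eqF.
split.
- apply: (partial_radial1_C1 (rho := rho - 2 * e) _ cA' cC') => //.
    by move=> i; exact: Ck_mollify (cA i) e0.
  move=> i z zp; apply: mollify_weak M0 (cA k) (cA i) (cC i) e0 zp _.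
  exact: W.
- rewrite /radial1; have : `|radial p (fun=> 1) (fun i => mollify e (A i)) y - radial p (fun=> 1) A y| <= n%:R * (eta' * `|y - p|).
    apply: (@radial_dist (M + 2 * e) p (fun=> 1) (fun i => mollify e (A i)) A eta' y cA').
    + by move=> i; exact: cc_le (cA i).
    + by move=> t; exact: cst_continuous.
    + by move=> t _; rewrite normr1.
    + by move=> i z; apply: H1.
  by move=> /bnd; lra.
- rewrite /radialt; have : `|radial p id (fun i => mollify e (C i)) y - radial p id C y| <= n%:R * (eta' * `|y - p|).
    apply: (@radial_dist (M + 2 * e) p id (fun i => mollify e (C i)) C eta' y cC').
    + by move=> i; exact: cc_le (cC i).
    + by move=> t; exact: cvg_id.
    + by move=> t /andP[t0 t1]; rewrite ger0_norm.
    + by move=> i z; apply: H2.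
  move=> /bnd b; have := H1 _ es1 k e0 y.
  set a1 := mollify _ _ _; set a2 := radial _ _ _ _ in b *; set a3 := radial _ _ _ _ in b * => b2.
  have -> : a1 - a2 - (A k y - a3) = (a1 - A k y) - (a2 - a3) by ring.
  by apply: le_trans (ler_normB _ _) _; lra.
Qed.

End Mollification.

(** * Parallel frames of flat connections *)

Section GeometricLimit.
Variable R : realType.

(** Subtracting and adding the remaining tail [2 * 2^-1 ^+ j] gives an increasing sequence below a
    decreasing one; the supremum of the former is the limit, with the explicit error. *)
Lemma geometric_limit (u : nat -> R) : (forall j, `|u j.+1 - u j| <= 2^-1 ^+ j) ->
  exists l, forall j, `|l - u j| <= 2 * 2^-1 ^+ j.
Proof.
move=> H.
pose v j := u j - 2 * 2^-1 ^+ j; pose w j := u j + 2 * 2^-1 ^+ j.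
have hj j : 2 * 2^-1 ^+ j.+1 = 2^-1 ^+ j :> R by rewrite exprS mulrA divff// mul1r.
have h2 j : 2 * 2^-1 ^+ j = 2^-1 ^+ j + 2^-1 ^+ j :> R by ring.
have vS j : v j <= v j.+1.
  by rewrite /v hj h2; have := H j; rewrite ler_norml => /andP[]; lra.
have wS j : w j.+1 <= w j.
  by rewrite /w hj h2; have := H j; rewrite ler_norml => /andP[]; lra.
have vm i j : v i <= v (i + j)%N.
  by elim: j => [|j IH]; rewrite ?addn0// addnS; exact: le_trans (vS _).
have wm i j : w (i + j)%N <= w i.
  by elim: j => [|j IH]; rewrite ?addn0// addnS; apply: le_trans (wS _) IH.
have vw i j : v i <= w j.
  have vwi k : v k <= w k.
    have : 0 <= 2 * 2^-1 ^+ k :> R by rewrite mulr_ge0// exprn_ge0.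
    by rewrite /v /w; lra.
  apply: le_trans (vm i j) _; apply: le_trans (vwi _) _; rewrite addnC; exact: wm.
exists (sup (range v)) => j.
have sv : has_sup (range v).
  by split; [exists (v 0%N), 0%N|exists (w 0%N) => _ [i _ <-]].
have a : v j <= sup (range v) by apply: ub_le_sup; [exact: (proj2 sv)|exists j].
have b : sup (range v) <= w j by apply: ge_sup; [exact: (proj1 sv)|move=> _ [i _ <-]].
by rewrite ler_norml; move: a b; rewrite /v /w; lra.
Qed.

Lemma geometric_zero (a C : R) : (forall j, `|a| <= C * 2^-1 ^+ j) -> a = 0.
Proof.
move=> H; apply: (@small_zero _ _ `|C|) => e e0.
have [j Hj] : exists j, 2^-1 ^+ j <= e :> R.
  have hh : `|2^-1 : R| < 1 by rewrite ger0_norm//; lra.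
  have /cvgrPdist_le /(_ _ e0) [j _ /(_ j (leqnn j))] := cvg_expr hh.
  rewrite sub0r normrN => Hj; exists j; apply: le_trans Hj; exact: ler_norm.
apply: le_trans (H j) _; apply: le_trans (ler_norm _) _.
by rewrite normrM ler_wpM2l// ger0_norm// exprn_ge0.
Qed.

End GeometricLimit.

Section Transport.
Variables (R : realType) (n m : nat) (p : 'rV[R]_n).
Local Notation mu := (@lebesgue_measure R).
Implicit Types (t s e h M K : R) (N : 'I_n -> 'rV[R]_n -> 'M[R]_m)
  (Z : 'rV[R]_n -> 'M[R]_m).

Definition contmx Z := forall a b x, {for x, continuous (fun x => Z x a b)}.

Definition ccmx M N := forall i a b, cc M (fun x => N i x a b).

Definition form_action N Z a b (i : 'I_n) (y : 'rV[R]_n) : R := (N i y *m Z y) a b.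

Lemma cc_form_action M N Z a b : ccmx M N -> contmx Z -> forall i, cc M (form_action N Z a b i).
Proof.
move=> cN cZ i; rewrite /form_action; under eq_fun do rewrite mxE.
apply: cc_sum => c; under eq_fun do rewrite mulrC.
by apply: cc_mul; [exact: cZ|exact: cN].
Qed.

Lemma ccmx_bounded M N : ccmx M N -> exists2 K, 0 <= K & forall i x, `|N i x| <= K.
Proof.
move=> cN.
have /choice[K HK] : forall ijk : 'I_n * ('I_m * 'I_m), exists K, 0 <= K /\
    forall y, `|N ijk.1 y ijk.2.1 ijk.2.2| <= K.
  by move=> [i [a b]]; have [K K0 H] := cc_bounded (cN i a b); exists K.
have K0 : 0 <= \sum_ijk K ijk by apply: sumr_ge0 => ijk _; have [] := HK ijk.
exists (\sum_ijk K ijk) => // i x; apply/norm_mx_leP => // a b.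
apply: le_trans (proj2 (HK (i, (a, b))) x) _.
by rewrite (bigD1 (i, (a, b)))//= lerDl sumr_ge0// => j _; have [] := HK j.
Qed.

(** The cutoff makes the map a contraction for the sup norm over the whole space, so that the
    iteration needs no invariant ball. *)
Definition transport_step (sigma : R) N Z (x : 'rV[R]_n) : 'M[R]_m :=
  \matrix_(a, b) ((1%:M : 'M[R]_m) a b +
    bump p sigma x * radial1 p (form_action N Z a b) x).

Lemma transport_step_cont M sigma N Z : 0 < sigma -> ccmx M N -> contmx Z ->
  contmx (transport_step sigma N Z).
Proof.
move=> s0 cN cZ a b x.
apply: (@continuous_ext _ _ (fun x => (1%:M : 'M[R]_m) a b +
    bump p sigma x * radial1 p (form_action N Z a b) x)).
  by move=> y; rewrite [in RHS]mxE.
apply: continuousD; first exact: cst_continuous.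
apply: continuousM; first exact: (proj1 (bump_cc p s0)).
by apply: (@continuous_radial1 _ _ _ M); exact: cc_form_action.
Qed.

(** Where the bump is nonzero, [|x - p|] is below [2 * sigma]; the bound [4^-1] thus yields the
    factor 1/2. *)
Lemma transport_step_contract M sigma K N Z Z' d : 0 < sigma -> 0 <= K ->
  n%:R * (m%:R * K) * sigma <= 4^-1 -> ccmx M N -> (forall i x, `|N i x| <= K) ->
  contmx Z -> contmx Z' -> (forall y, `|Z y - Z' y| <= d) -> forall x,
  `|transport_step sigma N Z x - transport_step sigma N Z' x| <= d / 2.
Proof.
move=> s0 K0 sK cN NK cZ cZ' dZ x.
have d0 : 0 <= d by apply: le_trans (dZ 0).
apply/norm_mx_leP => [|a b]; first by rewrite divr_ge0.
rewrite !mxE.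
have -> : (a == b)%:R + bump p sigma x * radial1 p (form_action N Z a b) x -
   ((a == b)%:R + bump p sigma x * radial1 p (form_action N Z' a b) x) =
  bump p sigma x * (radial1 p (form_action N Z a b) x - radial1 p (form_action N Z' a b) x) by ring.
have [xs|xs] := leP (2 * sigma) `|x - p|.
  by rewrite bump0// mul0r normr0 divr_ge0.
have H : `|radial1 p (form_action N Z a b) x - radial1 p (form_action N Z' a b) x|
    <= n%:R * (m%:R * (K * d) * `|x - p|).
  apply: (@radial_dist _ _ M p (fun=> 1)).
  - exact: cc_form_action.
  - exact: cc_form_action.
  - by move=> t; exact: cst_continuous.
  - by move=> t _; rewrite normr1.
  - move=> i y; rewrite /form_action.
    have -> : (N i y *m Z y) a b - (N i y *m Z' y) a b = (N i y *m (Z y - Z' y)) a b.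
      by rewrite mulmxBr !mxE.
    apply: le_trans (norm_mx_coord _ _ _) _; apply: le_trans (norm_mulmx _ _) _.
    by rewrite ler_wpM2l// ler_pM.
rewrite normrM -[leRHS]mul1r; apply: ler_pM => //.
  by rewrite ger0_norm ?bump_ge0 ?bump_le1.
apply: le_trans H _.
have c0 : 0 <= n%:R * (m%:R * K) :> R by rewrite !mulr_ge0.
have -> : n%:R * (m%:R * (K * d) * `|x - p|) = n%:R * (m%:R * K) * `|x - p| * d by ring.
rewrite mulrC ler_wpM2l//; apply: (@le_trans _ _ (n%:R * (m%:R * K) * (2 * sigma))).
  by rewrite ler_wpM2l// ltW.
by move: sK; lra.
Qed.

(* Picard iteration; the equation is the integrated form of d Z = N Z along the
   rays issued from [p]. *)
Lemma transport_fixpoint M N K sigma : 0 <= M -> ccmx M N -> 0 <= K ->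
  (forall i x, `|N i x| <= K) -> 0 < sigma -> n%:R * (m%:R * K) * sigma <= 4^-1 ->
  exists Z : 'rV[R]_n -> 'M[R]_m, [/\ contmx Z, forall x, `|Z x| <= 3 &
    forall x, `|x - p| <= sigma -> forall a b,
      Z x a b = (1%:M : 'M[R]_m) a b + radial1 p (form_action N Z a b) x].
Proof.
move=> M0 cN K0 NK s0 sK.
pose T := transport_step sigma N.
pose W j := iter j T (fun=> 1%:M).
have cW j : contmx (W j).
  elim: j => [|j IH] a b x; first exact: cst_continuous.
  exact: (transport_step_cont s0 cN IH).
have n1 : `|1%:M : 'M[R]_m| <= 1.
  by apply/norm_mx_leP => // a b; rewrite mxE; case: (a == b); rewrite ?normr1 ?normr0.
have dW j x : `|W j.+1 x - W j x| <= 2^-1 ^+ j.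
  elim: j x => [|j IH] x; last first.
    have := transport_step_contract s0 K0 sK cN NK (cW j.+1) (cW j) IH x.
    by rewrite exprSr.
  (* The starting point is itself the image of 0, so the contraction estimate also bounds the first
     increment. *)
  have T0 : T (fun=> 0) = fun=> 1%:M.
    apply/funext => y; apply/matrixP => a b; rewrite !mxE.
    rewrite (_ : radial1 _ _ _ = 0) ?mulr0 ?addr0//.
    rewrite /radial1 /radial (_ : (fun t => _) = fun=> 0); first by rewrite int_cst// mul0r.
    apply/funext => t; rewrite big1 ?mulr0// => i _.
    by rewrite /form_action mulmx0 mxE mul0r.
  have c0 : contmx (fun=> 0 : 'M[R]_m).
    move=> a b y; apply: (@continuous_ext _ _ (fun=> 0)); first by move=> z; rewrite mxE.
    exact: cst_continuous.
  have := @transport_step_contract M sigma K N (W 0%N) (fun=> 0) 1 s0 K0 sK cN NK (cW 0%N) c0 _ x.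
  rewrite -/T T0 => H; apply: le_trans (H _) _; first by move=> y; rewrite subr0.
  by rewrite expr0; lra.
have /choice[Zl HZ] : forall xab : 'rV[R]_n * ('I_m * 'I_m), exists l,
    forall j, `|l - W j xab.1 xab.2.1 xab.2.2| <= 2 * 2^-1 ^+ j.
  move=> [x [a b]] /=; apply: geometric_limit => j.
  apply: le_trans (dW j x); have := norm_mx_coord (W j.+1 x - W j x) a b; by rewrite !mxE.
pose Z x : 'M[R]_m := \matrix_(a, b) Zl (x, (a, b)).
have ZW j x : `|Z x - W j x| <= 2 * 2^-1 ^+ j.
  apply/norm_mx_leP => [|a b]; first by rewrite mulr_ge0// exprn_ge0.
  by rewrite !mxE; exact: (HZ (x, (a, b)) j).
have cZ : contmx Z.
  move=> a b x; apply/continuous_epsP => e e0.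
  have e4 : 0 < e / 4 / 2 by rewrite !divr_gt0.
  have [j Hj] : exists j, 2^-1 ^+ j <= e / 4 / 2 :> R.
    have hh : `|2^-1 : R| < 1 by rewrite ger0_norm//; lra.
    have /cvgrPdist_le /(_ _ e4) [j _ /(_ j (leqnn j))] := cvg_expr hh.
    rewrite sub0r normrN => Hj; exists j; apply: le_trans Hj; exact: ler_norm.
  have e2 : 0 < e / 2 by rewrite divr_gt0.
  have /continuous_epsP/(_ _ e2)[r r0 Hr] := cW j a b x.
  exists r => // y /Hr Hy.
  have h1 : `|Z y a b - W j y a b| <= e / 4.
    have := norm_mx_coord (Z y - W j y) a b; rewrite !mxE; have := ZW j y; lra.
  have h2 : `|Z x a b - W j x a b| <= e / 4.
    have := norm_mx_coord (Z x - W j x) a b; rewrite !mxE; have := ZW j x; lra.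
  have -> : Z y a b - Z x a b = (Z y a b - W j y a b) + (W j y a b - W j x a b)
     - (Z x a b - W j x a b) by ring.
  apply: le_trans (ler_normB _ _) _; apply: le_trans (lerD (ler_normD _ _) (lexx _)) _; lra.
have TZ x : T Z x = Z x.
  apply/eqP; rewrite -subr_eq0 -normr_eq0; apply/eqP.
  apply: (@geometric_zero _ _ 2) => j; rewrite normr_id.
  have h1 := transport_step_contract s0 K0 sK cN NK cZ (cW j) (ZW j) x.
  have h2 := ZW j.+1 x.
  have -> : T Z x - Z x = (T Z x - W j.+1 x) - (Z x - W j.+1 x) by rewrite opprB addrA subrK.
  apply: le_trans (ler_normB _ _) _; rewrite -/T in h1.
  have : 2 * 2^-1 ^+ j.+1 = 2^-1 ^+ j :> R by rewrite exprS mulrA divff// mul1r.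
  by move: h1 h2; rewrite -[W j.+1]/(T (W j)); lra.
(* The bound 3 is 1 for the initial identity matrix plus 2 for the sum of all increments. *)
exists Z; split => // x.
  have := ZW 0%N x; rewrite expr0 mulr1 /= => h.
  rewrite -(subrK 1%:M (Z x)); apply: le_trans (ler_normD _ _) _; lra.
by move=> xs a b; rewrite -{1}TZ mxE bump1// mul1r.
Qed.

End Transport.

(** * Derivatives of matrix-valued functions and a Gronwall estimate *)

Section MatrixDerivative.
Variable R : realType.
Implicit Types (t : R).

Definition is_derive_mx (V : normedModType R) q r (x v : V) (F : V -> 'M[R]_(q, r)) (D : 'M[R]_(q, r)) :=
  forall a b, is_derive x v (fun y => F y a b) (D a b).

Lemma is_derive_mx_mul (V : normedModType R) q r s (x v : V) (F : V -> 'M[R]_(q, r))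
    (G : V -> 'M[R]_(r, s)) DF DG :
  is_derive_mx x v F DF -> is_derive_mx x v G DG ->
  is_derive_mx x v (fun y => F y *m G y) (DF *m G x + F x *m DG).
Proof.
move=> HF HG a b; apply: (@is_derive_ext _ _ (fun y => \sum_c F y a c * G y c b)).
  by move=> y; rewrite mxE.
rewrite 3!mxE -big_split/=; apply: is_derive_bigsum => c _; exact: is_derive_mul.
Qed.

Lemma is_derive_mx_sub (V : normedModType R) q r (x v : V) (F G : V -> 'M[R]_(q, r)) DF DG :
  is_derive_mx x v F DF -> is_derive_mx x v G DG ->
  is_derive_mx x v (fun y => F y - G y) (DF - DG).
Proof.
move=> HF HG a b; apply: (@is_derive_ext _ _ (fun y => F y a b - G y a b)).
  by move=> y; rewrite !mxE.
by rewrite !mxE; exact: is_derive_sub.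
Qed.

Lemma is_derive_mx_scale (V : normedModType R) q r (x v : V) (c : R) (F : V -> 'M[R]_(q, r)) DF :
  is_derive_mx x v F DF -> is_derive_mx x v (fun y => c *: F y) (c *: DF).
Proof.
move=> HF a b; apply: (@is_derive_ext _ _ (fun y => c * F y a b)).
  by move=> y; rewrite !mxE.
by have := is_derive_mul (is_derive_const x v c) (HF a b); rewrite mul0r add0r mxE.
Qed.

Lemma is_derive_mx_tr (V : normedModType R) q r (x v : V) (F : V -> 'M[R]_(q, r)) DF :
  is_derive_mx x v F DF -> is_derive_mx x v (fun y => (F y)^T) DF^T.
Proof.
move=> HF a b; apply: (@is_derive_ext _ _ (fun y => F y b a)).
  by move=> y; rewrite !mxE.
by rewrite mxE.
Qed.

Lemma is_derive_mx_cst (V : normedModType R) q r (x v : V) (C : 'M[R]_(q, r)) :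
  is_derive_mx x v (fun=> C) 0.
Proof. by move=> a b; rewrite mxE; exact: is_derive_const. Qed.

Lemma is_derive_mxsub (V : normedModType R) p q p' q' (h : 'I_p' -> 'I_p) (h' : 'I_q' -> 'I_q) (x v : V)
    (F : V -> 'M[R]_(p, q)) D :
  is_derive_mx x v F D -> is_derive_mx x v (fun y => mxsub h h' (F y)) (mxsub h h' D).
Proof.
move=> H a b; rewrite mxE; apply: (is_derive_ext _ (H (h a) (h' b))) => y; by rewrite mxE.
Qed.

Lemma is_derive_mx_unique (V : normedModType R) p q (x v : V) (F : V -> 'M[R]_(p, q)) D D' :
  is_derive_mx x v F D -> is_derive_mx x v F D' -> D = D'.
Proof. by move=> H H'; apply/matrixP => a b; exact: is_derive_unique (H a b) (H' a b). Qed.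

Lemma is_derive_mx_near (V : normedModType R) p q (x v : V) (F F' : V -> 'M[R]_(p, q)) D :
  (\forall y \near x, F y = F' y) -> is_derive_mx x v F D -> is_derive_mx x v F' D.
Proof.
by move=> FF H a b; apply: is_derive_near (H a b); apply: filterS FF => y ->.
Qed.

Lemma is_derive_mx_row (V : normedModType R) p q (a : 'I_p) (x v : V) (F : V -> 'M[R]_(p, q)) D :
  is_derive_mx x v F D -> is_derive_mx x v (fun y => row a (F y)) (row a D).
Proof.
move=> H i j; rewrite mxE; apply: (is_derive_ext _ (H a j)) => y; by rewrite mxE.
Qed.

Lemma is_derive_mx_smul (V : normedModType R) p q (x v : V) (c : V -> R) (F : V -> 'M[R]_(p, q)) dc D :
  is_derive x v c dc -> is_derive_mx x v F D ->
  is_derive_mx x v (fun y => c y *: F y) (dc *: F x + c x *: D).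
Proof.
move=> Hc HF i j; rewrite mxE [X in X + _]mxE [X in _ + X]mxE.
by apply: (is_derive_ext _ (is_derive_mul Hc (HF i j))) => y; rewrite mxE.
Qed.

Definition cont01_mx q r (F : R -> 'M[R]_(q, r)) := forall a b, cont_on 0 1 (fun t => F t a b).

Lemma cont01_mx_mul q r s (F : R -> 'M[R]_(q, r)) (G : R -> 'M[R]_(r, s)) :
  cont01_mx F -> cont01_mx G -> cont01_mx (fun t => F t *m G t).
Proof.
move=> cF cG a b t t01; apply: (@continuous_ext _ _ (fun t => \sum_c F t a c * G t c b)).
  by move=> y; rewrite mxE.
by apply: continuous_bigsum => c; apply: continuousM; [exact: cF|exact: cG].
Qed.

Lemma cont01_mx_sub q r (F G : R -> 'M[R]_(q, r)) :
  cont01_mx F -> cont01_mx G -> cont01_mx (fun t => F t - G t).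
Proof.
move=> cF cG a b t t01; apply: (@continuous_ext _ _ (fun t => F t a b - G t a b)).
  by move=> y; rewrite !mxE.
by apply: continuousB; [exact: cF|exact: cG].
Qed.

Lemma cont01_mx_scale q r (c : R) (F : R -> 'M[R]_(q, r)) :
  cont01_mx F -> cont01_mx (fun t => c *: F t).
Proof.
move=> cF a b t t01; apply: (@continuous_ext _ _ (fun t => c * F t a b)).
  by move=> y; rewrite !mxE.
by apply: continuousM; [exact: cst_continuous|exact: cF].
Qed.

Lemma cont01_mx_t q r (F : R -> 'M[R]_(q, r)) :
  cont01_mx F -> cont01_mx (fun t => t *: F t).
Proof.
move=> cF a b t t01; apply: (@continuous_ext _ _ (fun t => t * F t a b)).
  by move=> y; rewrite !mxE.
by apply: continuousM; [exact: cvg_id|exact: cF].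
Qed.

(* On an interval of length 1 a Lipschitz constant 1/2 makes Gronwall's lemma a
   consequence of the mean value theorem. *)
Lemma small_gronwall q r (F D : R -> 'M[R]_(q, r)) eta : cont01_mx F -> F 0 = 0 ->
  (forall t, 0 < t < 1 -> is_derive_mx t 1 F (D t)) ->
  (forall t, 0 < t < 1 -> `|D t| <= 2^-1 * `|F t| + eta) ->
  forall t, 0 <= t <= 1 -> `|F t| <= 2 * eta.
Proof.
move=> cF F0 dF DF.
(* A bound [K] improves to [K / 2 + eta]; iterating drives any initial bound down to the fixed point
   [2 * eta]. *)
have key K : (forall t, 0 <= t <= 1 -> `|F t| <= K) ->
    forall t, 0 <= t <= 1 -> `|F t| <= 2^-1 * K + eta.
  move=> FK t t01.
  have Kb s : 0 < s < 1 -> `|D s| <= 2^-1 * K + eta.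
    move=> s01; apply: le_trans (DF s s01) _; rewrite lerD2r ler_wpM2l//.
    by apply: FK; lra.
  have K0 : 0 <= 2^-1 * K + eta by apply: le_trans (Kb (2^-1) _) => //; lra.
  apply/norm_mx_leP => // a b.
  apply: (@mean_value01 R (fun t => F t a b) (fun t => D t a b)) => //.
  - by rewrite F0 mxE.
  - by move=> s /dF; exact.
  - by move=> s s01; apply: le_trans (norm_mx_coord _ _ _) (Kb s s01).
have [K HK] : exists K, forall t, 0 <= t <= 1 -> `|F t| <= K.
  have /choice[k Hk] : forall ab : 'I_q * 'I_r, exists k, forall t, 0 <= t <= 1 ->
      `|F t ab.1 ab.2| <= k.
    move=> [a b] /=.
    have c : {within `[0, 1], continuous (fun t => `|F t a b|)}.
      apply: cont_on_within => t t01; apply: continuous_comp; first exact: cF.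
      exact: norm_continuous.
    have [t0 _ Ht] := @EVT_max R (fun t => `|F t a b|) 0 1 ler01 c.
    by exists `|F t0 a b| => t t01; apply: Ht; rewrite in_itv.
  exists (\sum_ab `|k ab|) => t t01; apply/norm_mx_leP => [|a b]; first exact: sumr_ge0.
  apply: le_trans (Hk (a, b) t t01) _; rewrite (bigD1 (a, b))//=.
  by apply: le_trans (ler_norm _) _; rewrite lerDl sumr_ge0.
have it j : forall t, 0 <= t <= 1 -> `|F t| <= 2^-1 ^+ j * (K - 2 * eta) + 2 * eta.
  elim: j => [|j IH] t t01; first by rewrite expr0 mul1r subrK; exact: HK.
  by apply: le_trans (key _ IH t t01) _; rewrite exprS; lra.
move=> t t01; rewrite leNgt; apply/negP => lt.
have : `|F t| - 2 * eta = 0; last by lra.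
apply: (@geometric_zero _ _ (K - 2 * eta)) => j; rewrite ger0_norm; last by lra.
by have := it j t t01; rewrite mulrC; lra.
Qed.

End MatrixDerivative.

(** The left side is the derivative along the ray of the error [F] in [parallel_frame]. The bracket
    brought in by the derivative of [t *: Q] combines with the others so that the source contains
    only [g] and [h] times [a' - a], both of order o(h). *)
Lemma transport_algebra (R : comRingType) m (a a' b Q n Z Z' : 'M[R]_m) (h t : R)
    (g := b - h *: (t *: (n - Q))) (q := t *: Q) :
  (a' *m Z' - a *m Z) - ((a' - a) *m Z + b *m (a *m Z))
    - h *: ((t *: (a *m n - n *m a)) *m Z + q *m (a *m Z))
  = a' *m (Z' - Z - b *m Z - h *: (q *m Z))
    + (a' *m g - g *m a + (h * t) *: ((a' - a) *m n)) *m Z.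
Proof.
rewrite /g /q !(mulmxBl, mulmxBr, mulmxDl, mulmxDr, scalerBr, scalerDr).
rewrite -!(scalemxAl, scalemxAr) !scalerA.
rewrite !(mulmxBl, mulmxDl, mulNmx, opprB, opprD, scalerBr) -?scalemxAl ?scalerA !mulmxA.
move: (a' *m Z') (a *m Z) (a' *m Z) (b *m a *m Z) (a *m n *m Z) (n *m a *m Z).
move: (Q *m a *m Z) (a' *m b *m Z) (a' *m Q *m Z) (a' *m n *m Z).
move=> ? ? ? ? ? ? ? ? ? ?; apply/matrixP => i j; rewrite !mxE; ring.
Qed.

Section ParallelFrame.
Variables (R : realType) (n m : nat) (p : 'rV[R]_n).
Variables (M rho : R) (N : 'I_n -> 'rV[R]_n -> 'M[R]_m).
Hypothesis M0 : 0 <= M.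
Hypothesis rho0 : 0 < rho.
Hypothesis cN : ccmx M N.

(** The value that d_i N_k - d_k N_i must have for d Z = N Z to be integrable. *)
Definition form_bracket k i (x : 'rV[R]_n) : 'M[R]_m := N i x *m N k x - N k x *m N i x.

Hypothesis weak_flat : forall k l a b chi, Ck setT 1 chi ->
  (forall x, rho <= `|x - p| -> chi x = 0) ->
  rVintegral (fun x => - (N l x a b * partial k chi x) + N k x a b * partial l chi x
    + chi x * form_bracket k l x a b) = 0.

Let cform a b i : cc M (fun x => N i x a b). Proof. exact: cN. Qed.

Let cbracket k a b i : cc M (fun x => form_bracket k i x a b).
Proof.
rewrite (_ : (fun x => _) = (fun x => (N i x *m N k x) a b - (N k x *m N i x) a b)); last first.
  by apply/funext => x; rewrite /form_bracket mxE [X in _ + X]mxE.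
apply: cc_sub; under eq_fun do rewrite mxE.
  by apply: cc_sum => c; apply: cc_mul; [exact: (proj1 (cN _ _ _))|exact: cN].
by apply: cc_sum => c; apply: cc_mul; [exact: (proj1 (cN _ _ _))|exact: cN].
Qed.

(** [B] and [Q] are the homotopy operators applied to the connection and to its bracket; then d_k B
    = [E k] on the ball, although [N] is only continuous. *)
Let B x : 'M[R]_m := \matrix_(a, b) radial1 p (fun i x => N i x a b) x.
Let Q k x : 'M[R]_m := \matrix_(a, b) radialt p (fun i x => form_bracket k i x a b) x.
Let E k x : 'M[R]_m := N k x - Q k x.

Let contE k : contmx (E k).
Proof.
move=> a b x; apply: (@continuous_ext _ _ (fun x => N k x a b
   - radialt p (fun i x => form_bracket k i x a b) x)).
  by move=> y; rewrite !mxE.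
apply: continuousB; first exact: (proj1 (cN _ _ _)).
by apply: (continuous_radialt (M := M)) => i; exact: cbracket.
Qed.

Let dB k x a b : `|x - p| < rho -> is_derive x (bas k) (fun x => B x a b) (E k x a b).
Proof.
move=> xr; apply: (@is_derive_ext _ _ (radial1 p (fun i x => N i x a b))).
  by move=> y; rewrite mxE.
rewrite !mxE; apply: (@partial_radial1_weak _ _ M rho p (fun i x => N i x a b)
  (fun i x => form_bracket k i x a b)) => //.
by move=> i chi c1 c2; exact: weak_flat.
Qed.

(* [Z] solves the equation along rays. That it is parallel in the direction [k]
   too follows by comparing the equations on the rays to [x] and [x + h e_k]:
   by flatness their difference is a linear equation with an o(h) source. *)
Theorem parallel_frame : exists sigma, exists Z : 'rV[R]_n -> 'M[R]_m,
  [/\ 0 < sigma, Z p = 1%:M, contmx Z & forall x k, `|x - p| < sigma ->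
    is_derive_mx x (bas k) Z (N k x *m Z x)].
Proof.
have [K K0 NK] := ccmx_bounded cN.
(* The single condition [L * sigma <= 4^-1] serves the contraction in [transport_fixpoint] and the
   Lipschitz constant 1/2 in [small_gronwall]. *)
pose L := n%:R * (m.+1%:R * K) + 1.
have L0 : 0 < L by rewrite ltr_wpDl// !mulr_ge0.
pose sigma := Num.min rho (4^-1 / L).
have s0 : 0 < sigma by rewrite lt_min rho0 divr_gt0.
have srho : sigma <= rho by rewrite ge_min lexx.
have sL : L * sigma <= 4^-1.
  have : sigma <= 4^-1 / L by rewrite ge_min lexx orbT.
  by rewrite ler_pdivlMr// mulrC.
have nL q : q <= m.+1%:R -> n%:R * (q * K) <= L.
  move=> qm; rewrite /L; apply: (@le_trans _ _ (n%:R * (m.+1%:R * K))).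
    by rewrite ler_wpM2l// ler_wpM2r.
  by rewrite lerDl.
have m1 : m%:R <= m.+1%:R :> R by rewrite ler_nat.
have sK : n%:R * (m%:R * K) * sigma <= 4^-1.
  by apply: le_trans sL; rewrite ler_wpM2r// ?nL// ltW.
have [Z [cZ Z3 ZE]] := transport_fixpoint p M0 cN K0 NK s0 sK.
pose along x t : 'M[R]_m := \sum_i (x - p) 0 i *: N i (ray p x t).
have alongE x t a b : along x t a b = \sum_i N i (ray p x t) a b * (x - p) 0 i.
  by rewrite /along summxE; apply: eq_bigr => i _; rewrite mxE mulrC.
have along_half x t : `|x - p| <= sigma -> m.+1%:R * `|along x t| <= 2^-1.
  move=> xs; have : `|along x t| <= n%:R * (sigma * K).
    apply: le_trans (ler_norm_sum _ _ _) _.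
    rewrite (_ : n%:R * _ = \sum_(i < n) (sigma * K)); last by rewrite sumr_const card_ord mulr_natl.
    apply: ler_sum => i _; rewrite normrZ ler_pM//.
    by apply: le_trans (norm_mx_coord _ _ _) xs.
  move=> h; apply: (@le_trans _ _ (m.+1%:R * (n%:R * (sigma * K)))); first by rewrite ler_wpM2l.
  have -> : m.+1%:R * (n%:R * (sigma * K)) = n%:R * (m.+1%:R * K) * sigma by ring.
  apply: (@le_trans _ _ (L * sigma)); last by lra.
  by rewrite ler_wpM2r// ?nL// ltW.
have raysig x t : 0 <= t <= 1 -> `|x - p| <= sigma -> `|ray p x t - p| <= sigma.
  by move=> t01; apply: le_trans; exact: ray_norm.
have dZ x t : 0 < t < 1 -> `|x - p| < sigma ->
    is_derive_mx (t : R) (1 : R) (fun t : R => Z (ray p x t)) (along x t *m Z (ray p x t)).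
  move=> t01 xs a b.
  have H := is_derive_radial1 p (cc_form_action a b cN cZ) x t01.
  have H2 := is_derive_add (is_derive_const t 1 ((1%:M : 'M[R]_m) a b)) H.
  have -> : (along x t *m Z (ray p x t)) a b =
     0 + \sum_i form_action N Z a b i (ray p x t) * (x - p) 0 i.
    rewrite add0r /along mulmx_suml summxE; apply: eq_bigr => i _.
    by rewrite -scalemxAl mxE mulrC.
  apply: is_derive_near H2.
  apply/nbhs_epsP; exists (Num.min t (1 - t)); first by rewrite lt_min; lra.
  move=> s; rewrite lt_min !ltr_norml => /andP[/andP[c1 c2] /andP[c3 c4]].
  rewrite -ZE//; apply: raysig; [lra|exact: ltW].
have dBr x t : 0 < t < 1 -> is_derive_mx (t : R) (1 : R) (fun t : R => B (ray p x t)) (along x t).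
  move=> t01 a b; rewrite alongE.
  have H := is_derive_radial1 p (cform a b) x t01.
  by apply: is_derive_ext H => s; rewrite mxE.
have dQr k x t : 0 < t < 1 -> is_derive_mx (t : R) (1 : R) (fun t : R => t *: Q k (ray p x t))
    (t *: (along x t *m N k (ray p x t) - N k (ray p x t) *m along x t)).
  move=> t01 a b.
  have H := is_derive_radialt p (cbracket k a b) x t01.
  have -> : (t *: (along x t *m N k (ray p x t) - N k (ray p x t) *m along x t)) a b =
    t * \sum_i form_bracket k i (ray p x t) a b * (x - p) 0 i.
    rewrite mxE; congr (_ * _); rewrite /along mulmx_suml mulmx_sumr -sumrB summxE.
    apply: eq_bigr => i _; rewrite -scalemxAl -scalemxAr -scalerBr mxE mulrC; congr (_ * _).
  by apply: is_derive_ext H => s; rewrite !mxE.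
have cray (F : 'rV[R]_n -> 'M[R]_m) x : contmx F -> cont01_mx (fun t => F (ray p x t)).
  by move=> cF a b t _; apply: (continuous_along (f := fun x => F x a b)); exact: cF.
have contB : contmx B.
  move=> a b x; apply: (@continuous_ext _ _ (radial1 p (fun i x => N i x a b))).
    by move=> y; rewrite mxE.
  exact: (continuous_radial1 (cform a b)).
have contQ k : contmx (Q k).
  move=> a b x; apply: (@continuous_ext _ _ (radialt p (fun i x => form_bracket k i x a b))).
    by move=> y; rewrite mxE.
  exact: (continuous_radialt (cbracket k a b)).
exists sigma, Z; split => //.
  apply/matrixP => a b; rewrite ZE ?subrr ?normr0 ?(ltW s0)//.
  by rewrite (radial1_p p (cc_form_action a b cN cZ)) addr0.
move=> x k xs a b; apply/is_derive_epsP => e e0.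
(* [P * (eta * |h|)] bounds the source of the equation for [F], with 3 the bound of [Z]. Gronwall
   doubles it, and the term [g 1 *m Z x] adds [3 * m]: this is [L2]. *)
pose P := 3 * m%:R * (1 + m%:R * K).
have P0 : 0 <= P by rewrite !mulr_ge0// addr_ge0// mulr_ge0.
pose L2 := 2 * P + 3 * m%:R + 1.
have L20 : 0 < L2 by rewrite ltr_wpDl// addr_ge0// mulr_ge0.
pose eta := e / L2.
have eta0 : 0 < eta by rewrite divr_gt0.
pose e1 := eta / 2 / (n%:R * sigma + 1).
have ns0 : 0 < n%:R * sigma + 1 by rewrite ltr_wpDl// mulr_ge0// ltW.
have e10 : 0 < e1 by rewrite !divr_gt0.
have [r1 r10 Hr1] : exists2 r, 0 < r & forall d, d < r ->
    forall (iab : 'I_n * ('I_m * 'I_m)) (y z : 'rV[R]_n), `|z - y| <= d ->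
    `|N iab.1 z iab.2.1 iab.2.2 - N iab.1 y iab.2.1 iab.2.2| <= e1.
  apply: (@common_radius R _ _ id (fun (iab : 'I_n * ('I_m * 'I_m)) d =>
    forall y z : 'rV[R]_n, `|z - y| <= d ->
    `|N iab.1 z iab.2.1 iab.2.2 - N iab.1 y iab.2.1 iab.2.2| <= e1)) => -[i [u v]] /=.
  have [r r0 Hr] := cc_uniform (cN i u v) e10; exists r => // d dr y z yz.
  by apply: Hr; apply: le_lt_trans yz dr.
have cball := @compact_norm_ball R n p `|x - p|.
have [r2 r20 Hr2] : exists2 r, 0 < r & forall d, d < r ->
    forall (ab : 'I_m * 'I_m) (y z : 'rV[R]_n), `|y - p| <= `|x - p| -> `|z - y| <= d ->
    `|E k z ab.1 ab.2 - E k y ab.1 ab.2| <= eta.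
  apply: (@common_radius R _ _ id (fun (ab : 'I_m * 'I_m) d =>
    forall y z : 'rV[R]_n, `|y - p| <= `|x - p| -> `|z - y| <= d ->
    `|E k z ab.1 ab.2 - E k y ab.1 ab.2| <= eta)) => -[u v] /=.
  have [r r0 Hr] := uniform_on_compact cball (fun y _ => @contE k u v y) eta0.
  by exists r => // d dr y z yp yz; apply: Hr => //; exact: le_lt_trans yz dr.
pose r3 := eta / 2 / (K + 1).
have K1 : 0 < K + 1 by rewrite ltr_wpDl.
have r30 : 0 < r3 by rewrite !divr_gt0.
pose r4 := sigma - `|x - p|.
have r40 : 0 < r4 by rewrite subr_gt0.
exists (Num.min (Num.min r1 r2) (Num.min r3 r4)); first by rewrite !lt_min r10 r20 r30.
move=> h; rewrite !lt_min => /andP[/andP[hr1 hr2] /andP[hr3 hr4]].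
pose x' := x + h *: bas k.
have xh (y : 'rV[R]_n) (u : R) : `|y + u *: bas k - y| = `|u|.
  by rewrite addrAC subrr add0r norm_bas_scale.
have xs' : `|x' - p| < sigma.
  have : `|x' - p| <= `|x' - x| + `|x - p| by exact: ler_distD.
  by move: hr4; rewrite xh /r4; lra.
pose bt t := B (ray p x' t) - B (ray p x t).
(* The expected increment of [Z] is [h * t] times [N k] applied to [Z], which cannot be
   differentiated in [t]. The sum of [bt t] and [h * t] times [Q k] differs from this coefficient by
   [g t] only, which is o(h), and it is differentiable along the ray. *)
pose F t := Z (ray p x' t) - Z (ray p x t) - bt t *m Z (ray p x t)
   - h *: ((t *: Q k (ray p x t)) *m Z (ray p x t)).
pose g t := bt t - h *: (t *: (N k (ray p x t) - Q k (ray p x t))).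
have th t : 0 <= t <= 1 -> `|t * h| <= `|h|.
  by move=> /andP[t0 t1]; rewrite normrM ger0_norm// ler_piMl.
have gb t : 0 <= t <= 1 -> `|g t| <= eta * `|h|.
  move=> t01; apply/norm_mx_leP => [|u v]; first by rewrite mulr_ge0// ltW.
  have yp := ray_norm p x t01.
  have -> : g t u v = B (ray p x' t) u v - B (ray p x t) u v - t * h * E k (ray p x t) u v.
    rewrite /g /bt /E.
    move: (B (ray p x' t)) (B (ray p x t)) (N k (ray p x t)) (Q k (ray p x t)) => b1 b2 b3 b4.
    by rewrite !mxE; ring.
  rewrite /x' ray_step.
  have [d dh|d dh ->] := @MVT_line _ _ (fun y => B y u v) (ray p x t) (bas k)
     (fun y => E k y u v) (t * h).
    apply: dB; have : `|ray p x t + d *: bas k - p| <= `|ray p x t + d *: bas k - ray p x t|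
      + `|ray p x t - p| by exact: ler_distD.
    by move: hr4 (th t t01) dh yp; rewrite xh /r4; lra.
  rewrite -mulrBr normrM mulrC ler_pM//; last exact: th.
  apply: (Hr2 _ hr2 (u, v)) => //; rewrite xh; exact: le_trans (th t t01).
have ab' t : 0 <= t <= 1 -> `|along x' t - along x t| <= eta.
  move=> t01.
  have -> : along x' t - along x t =
     \sum_i (x' - p) 0 i *: (N i (ray p x' t) - N i (ray p x t)) + h *: N k (ray p x t).
    have -> : h *: N k (ray p x t) = \sum_i (h *: (bas k : 'rV[R]_n)) 0 i *: N i (ray p x t).
      rewrite (bigD1 k)//= big1 ?addr0; first by rewrite !mxE !eqxx mulr1.
      by move=> i /negbTE ik; rewrite !mxE ik andbF mulr0 scale0r.
    rewrite /along -sumrB -big_split/=; apply: eq_bigr => i _.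
    have -> : (x' - p) 0 i = (x - p) 0 i + (h *: (bas k : 'rV[R]_n)) 0 i.
      by rewrite /x' !mxE; ring.
    move: ((x - p) 0 i) ((h *: (bas k : 'rV[R]_n)) 0 i) (N i (ray p x' t)) (N i (ray p x t)).
    move=> c1 c2 N1 N2; apply/matrixP => u v; rewrite !mxE; ring.
  apply: le_trans (ler_normD _ _) _.
  have s1 : `|\sum_i (x' - p) 0 i *: (N i (ray p x' t) - N i (ray p x t))| <= eta / 2.
    apply: le_trans (ler_norm_sum _ _ _) _.
    apply: (@le_trans _ _ (\sum_(i < n) (sigma * e1))).
      apply: ler_sum => i _; rewrite normrZ ler_pM//.
        by apply: le_trans (norm_mx_coord _ _ _) (ltW xs').
      apply/norm_mx_leP => [|u v]; first exact: ltW.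
      rewrite !mxE; apply: (Hr1 _ hr1 (i, (u, v))) => /=.
      by apply: le_trans (ray_dist p _ _ t01) _; rewrite xh.
    rewrite sumr_const card_ord -[leLHS]mulr_natl mulrA /e1.
    rewrite mulrA ler_pdivrMr// mulrC ler_wpM2l ?lerDl//.
    by rewrite divr_ge0// ltW.
  have s2 : `|h *: N k (ray p x t)| <= eta / 2.
    rewrite normrZ; apply: (@le_trans _ _ (r3 * (K + 1))).
      by rewrite ler_pM// ?(ltW hr3)//; apply: le_trans (NK _ _) _; rewrite lerDl.
    by rewrite /r3 divfK// gt_eqF.
  by lra.
have F1 : `|F 1| <= 2 * (P * (eta * `|h|)).
  apply: (@small_gronwall R _ _ F (fun t => along x' t *m F t +
    (along x' t *m g t - g t *m along x t + (h * t) *: ((along x' t - along x t) *m N k (ray p x t)))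
      *m Z (ray p x t))); last by rewrite ler01 lexx.
  - apply: cont01_mx_sub; last first.
      apply: cont01_mx_scale; apply: cont01_mx_mul; last exact: cray.
      by apply: cont01_mx_t; exact: cray.
    apply: cont01_mx_sub; first by apply: cont01_mx_sub; exact: cray.
    by apply: cont01_mx_mul; [apply: cont01_mx_sub|]; exact: cray.
  - by rewrite /F /bt !ray0 !subrr mul0mx scale0r mul0mx scaler0 !subr0.
  - move=> t t01; rewrite /F /g -transport_algebra.
    have d1 := dZ x t t01 xs; have d1' := dZ x' t t01 xs'.
    have d2 := is_derive_mx_sub (dBr x' t t01) (dBr x t t01).
    have d3 := dQr k x t t01.
    apply: is_derive_mx_sub; last first.
      apply: is_derive_mx_scale; exact: is_derive_mx_mul d3 d1.
    by apply: is_derive_mx_sub; [exact: is_derive_mx_sub|exact: is_derive_mx_mul].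
  move=> t /andP[t0 t1]; have t01 : 0 <= t <= 1 by rewrite !ltW.
  have ah := along_half x t (ltW xs); have ah' := along_half x' t (ltW xs').
  have mm (A A' : 'M[R]_m) : m.+1%:R * `|A| <= 2^-1 -> m%:R * (`|A| * `|A'|) <= 2^-1 * `|A'|.
    move=> hA; rewrite mulrA ler_wpM2r//; apply: le_trans hA; rewrite ler_wpM2r//.
  apply: le_trans (ler_normD _ _) _; apply: lerD.
    by apply: le_trans (norm_mulmx _ _) _; exact: mm.
  apply: le_trans (norm_mulmx _ _) _.
  have hg := gb t t01; have ha := ab' t t01.
  have n1 : `|along x' t *m g t| <= 2^-1 * (eta * `|h|).
    apply: le_trans (norm_mulmx _ _) _; apply: le_trans (mm _ _ ah') _; exact: ler_wpM2l.
  have n2 : `|g t *m along x t| <= 2^-1 * (eta * `|h|).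
    apply: le_trans (norm_mulmx _ _) _; rewrite [X in _ * X]mulrC.
    apply: le_trans (mm _ _ ah) _; exact: ler_wpM2l.
  have n3 : `|(h * t) *: ((along x' t - along x t) *m N k (ray p x t))| <= `|h| * (m%:R * (eta * K)).
    rewrite normrZ mulrC [h * t]mulrC mulrC; apply: ler_pM => //; first exact: th.
    by apply: le_trans (norm_mulmx _ _) _; rewrite ler_wpM2l// ler_pM.
  have -> : P * (eta * `|h|) = m%:R * ((eta * `|h| + `|h| * (m%:R * (eta * K))) * 3).
    by rewrite /P; ring.
  rewrite ler_wpM2l// ler_pM//.
  apply: le_trans (ler_normD _ _) _; apply: lerD => //.
  by apply: le_trans (ler_normB _ _) _; lra.
have -> : Z (x + h *: bas k) a b - Z x a b - h * (N k x *m Z x) a b =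
    (F 1 + g 1 *m Z x) a b.
  have -> : F 1 + g 1 *m Z x = Z x' - Z x - h *: (N k x *m Z x).
    rewrite /F /g !ray1 !scale1r.
    have -> : (bt 1 - h *: (N k x - Q k x)) *m Z x =
        bt 1 *m Z x - h *: (N k x *m Z x - Q k x *m Z x).
      by rewrite mulmxDl mulNmx -scalemxAl (mulmxBl (N k x)).
    move: (bt 1 *m Z x) (Q k x *m Z x) (N k x *m Z x) => X1 X2 X3.
    by apply/matrixP => u v; rewrite !mxE; ring.
  by move: (N k x *m Z x) => X; rewrite !mxE.
apply: le_trans (norm_mx_coord _ _ _) _; apply: le_trans (ler_normD _ _) _.
have g1 : `|g 1 *m Z x| <= m%:R * (eta * `|h| * 3).
  apply: le_trans (norm_mulmx _ _) _; rewrite ler_wpM2l// ler_pM//.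
  by apply: gb; rewrite ler01 lexx.
have -> : e * `|h| = L2 * (eta * `|h|) by rewrite mulrA /eta [L2 * _]mulrC divfK// gt_eqF.
have eh : 0 <= eta * `|h| by rewrite mulr_ge0// ltW.
move: F1 g1; rewrite /L2; lra.
Qed.

End ParallelFrame.

(** * The inverse function theorem *)

Section InverseFunction.
Variables (R : realType) (n : nat).
Implicit Types (U V W : set 'rV[R]_n) (x y p : 'rV[R]_n).

Lemma open_epsP U : (forall x, U x -> exists2 r : R, 0 < r & forall y, `|y - x| < r -> U y) -> open U.
Proof. by move=> H; rewrite openE => x /H ?; apply/nbhs_epsP. Qed.

Lemma open_norm_ball (q : 'rV[R]_n) (d : R) : open [set x | `|x - q| < d].
Proof.
apply: open_epsP => x /= xq; exists (d - `|x - q|); first by rewrite subr_gt0.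
move=> y yx; have : `|y - q| <= `|y - x| + `|x - q|.
  by rewrite (_ : y - q = (y - x) + (x - q)) ?ler_normD// addrA subrK.
by lra.
Qed.

Lemma halves_small (e : R) : 0 < e -> exists j, 2^-1 ^+ j <= e.
Proof.
move=> e0; have hh : `|2^-1 : R| < 1 by rewrite ger0_norm//; lra.
have /cvgrPdist_le /(_ _ e0) [j _ /(_ j (leqnn j))] := cvg_expr hh.
by rewrite sub0r normrN => Hj; exists j; apply: le_trans Hj; exact: ler_norm.
Qed.

(** The condition [d <= 1] makes the first increment at most 1, as [geometric_limit] requires. *)
Lemma row_fixpoint (T : 'rV[R]_n -> 'rV[R]_n) p (d : R) : 0 < d -> d <= 1 ->
  (forall x, `|x - p| <= d -> `|T x - p| <= d) ->
  (forall x y, `|x - p| <= d -> `|y - p| <= d -> `|T x - T y| <= 2^-1 * `|x - y|) ->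
  exists2 x, `|x - p| <= d & T x = x.
Proof.
move=> d0 d1 Tb Tc.
pose u j := iter j T p.
have ub j : `|u j - p| <= d.
  by elim: j => [|j IH]; [rewrite subrr normr0 ltW|exact: Tb].
have du j : `|u j.+1 - u j| <= 2^-1 ^+ j.
  elim: j => [|j IH]; first by rewrite expr0; apply: le_trans (ub 1%N) d1.
  apply: le_trans (Tc _ _ (ub j.+1) (ub j)) _.
  by rewrite exprS ler_wpM2l.
have /choice[l Hl] : forall i, exists l, forall j, `|l - u j 0 i| <= 2 * 2^-1 ^+ j.
  move=> i; apply: geometric_limit => j.
  by apply: le_trans (du j); have := norm_mx_coord (u j.+1 - u j) 0 i; rewrite !mxE.
pose x : 'rV[R]_n := \row_i l i.
have xu j : `|x - u j| <= 2 * 2^-1 ^+ j.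
  apply/norm_mx_leP => [|a i]; first by rewrite mulr_ge0// exprn_ge0.
  by rewrite ord1 !mxE; exact: Hl.
have xp : `|x - p| <= d.
  rewrite leNgt; apply/negP => dx.
  have [j Hj] : exists j, 2^-1 ^+ j <= (`|x - p| - d) / 4.
    by apply: halves_small; rewrite divr_gt0// subr_gt0.
  have : `|x - p| <= `|x - u j| + `|u j - p| by exact: ler_distD.
  by have := xu j; have := ub j; lra.
exists x => //; apply/eqP; rewrite -subr_eq0 -normr_eq0; apply/eqP.
apply: (@geometric_zero _ _ 2) => j; rewrite normr_id.
have : `|T x - x| <= `|T x - u j.+1| + `|u j.+1 - x| by exact: ler_distD.
have := Tc _ _ xp (ub j); have := xu j; have := xu j.+1; rewrite (distrC x (u j.+1)).
have : 2 * 2^-1 ^+ j.+1 = 2^-1 ^+ j :> R by rewrite exprS mulrA divff// mul1r.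
by rewrite -[u j.+1]/(T (u j)); lra.
Qed.

(** Points are row vectors, so the differential acts as right multiplication by the transpose. *)
Definition jacobian (phi : 'rV[R]_n -> 'rV[R]_n) x : 'M[R]_n :=
  \matrix_(i, s) partial s (fun x => phi x 0 i) x.

Lemma unitmx_ker (A : 'M[R]_n) : (forall v : 'rV_n, v *m A = 0 -> v = 0) -> A \in unitmx.
Proof.
move=> H; rewrite -row_free_unit -kermx_eq0; apply/rowV0P => v.
by move/sub_kermxP; exact: H.
Qed.

Variables (U : set 'rV[R]_n) (k : nat) (phi : 'rV[R]_n -> 'rV[R]_n).
Hypothesis Uo : open U.
Hypothesis phiC : forall i, Ck U k.+1 (fun x => phi x 0 i).
Local Notation J := (jacobian phi).

Lemma jacobian_strict p : U p -> forall e, 0 < e -> exists2 r, 0 < r &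
  forall x y, `|x - p| < r -> `|y - p| < r ->
    `|phi y - phi x - (y - x) *m (J p)^T| <= e * `|y - x|.
Proof.
move=> Up e e0.
have [r r0 Hr] : exists2 r, 0 < r & forall d, d < r -> forall i x y, `|x - p| <= d -> `|y - p| <= d ->
    `|phi y 0 i - phi x 0 i - \sum_s (y - x) 0 s * J p i s| <= e * `|y - x|.
  apply: (@common_radius R _ _ id (fun i d => forall x y, `|x - p| <= d -> `|y - p| <= d ->
    `|phi y 0 i - phi x 0 i - \sum_s (y - x) 0 s * J p i s| <= e * `|y - x|)) => i.
  have [||r r0 Hr] := @strict_diff R n U (fun x => phi x 0 i)
    (fun s => partial s (fun x => phi x 0 i)) Uo _ p Up _ e e0.
  - by move=> y s Uy; exact: Ck_deriv (phiC i) _ _ Uy.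
  - by move=> s; exact: Ck_cont (Ck_partial s (phiC i)) _ Up.
  exists r => // d dr x y xd yd; have := Hr x y (le_lt_trans xd dr) (le_lt_trans yd dr).
  suff -> : \sum_s (y - x) 0 s * J p i s =
     \sum_s (y - x) 0 s * partial s (fun x => phi x 0 i) p by [].
  by apply: eq_bigr => s _; rewrite [J p i s]mxE.
exists r => // x y xr yr; apply/norm_mx_leP => [|a i]; first by rewrite mulr_ge0// ltW.
rewrite ord1; pose d := Num.max `|x - p| `|y - p|.
have := Hr d _ i x y; rewrite gt_max xr yr !le_max !lexx orbT => /(_ isT isT isT).
suff -> : (phi y - phi x - (y - x) *m (J p)^T) 0 i =
  phi y 0 i - phi x 0 i - \sum_s (y - x) 0 s * J p i s by [].
by rewrite !mxE; congr (_ - _); apply: eq_bigr => s _; rewrite !mxE.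
Qed.

Theorem inverse_function p : U p -> J p \in unitmx ->
  exists V W (psi : 'rV[R]_n -> 'rV[R]_n),
  [/\ [/\ open V, V p, V `<=` U & open W],
      (forall x, V x -> W (phi x) /\ psi (phi x) = x),
      (forall y, W y -> V (psi y) /\ phi (psi y) = y),
      (forall i, Ck W k.+1 (fun y => psi y 0 i))
    & forall y, W y -> J (psi y) \in unitmx /\
        forall i a, partial a (fun y => psi y 0 i) y = invmx (J (psi y)) i a].
Proof.
move=> Up Jp.
pose D := (invmx (J p))^T.
have DU : D \in unitmx by rewrite unitmx_tr unitmx_inv.
have JD : (J p)^T *m D = 1%:M by rewrite -trmx_mul mulVmx// trmx1.
pose c := n%:R * `|D| + 1.
have c0 : 0 < c by rewrite ltr_wpDl// mulr_ge0.
have cn0 : c != 0 by rewrite gt_eqF.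
have c20 : 0 < 2 * c by rewrite mulr_gt0.
have mulD (v : 'rV[R]_n) : `|v *m D| <= c * `|v|.
  apply: le_trans (norm_mulmx _ _) _.
  have -> : n%:R * (`|v| * `|D|) = n%:R * `|D| * `|v| by ring.
  by rewrite ler_wpM2r// /c lerDl.
have [r1 r10 Hr1] : exists2 r : R, 0 < r & forall y, `|y - p| < r -> U y.
  by apply/nbhs_epsP; exact: open_near.
have ec : 0 < 2^-1 / c by rewrite divr_gt0.
have [r2 r20 Hr2] := jacobian_strict Up ec.
(* Halving makes the closed ball of radius [d] fit in the open ones, and 1 is what [row_fixpoint]
   asks for. *)
pose d := Num.min 1 (Num.min r1 r2 / 2).
have d0 : 0 < d by rewrite lt_min ltr01 divr_gt0// lt_min r10.
have d1 : d <= 1 by rewrite ge_min lexx.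
have dr : d < r1 /\ d < r2.
  have : d <= Num.min r1 r2 / 2 by rewrite ge_min lexx orbT.
  have a : Num.min r1 r2 <= r1 by rewrite ge_min lexx.
  have b : Num.min r1 r2 <= r2 by rewrite ge_min lexx orbT.
  by move: d0 => ? ?; split; lra.
have [dr1 dr2] := dr.
have bU x : `|x - p| <= d -> U x by move=> xd; apply: Hr1; exact: le_lt_trans dr1.
have strict x y : `|x - p| <= d -> `|y - p| <= d ->
    `|(phi y - phi x) *m D - (y - x)| <= 2^-1 * `|y - x|.
  move=> xd yd; have := Hr2 x y (le_lt_trans xd dr2) (le_lt_trans yd dr2) => H.
  have -> : (phi y - phi x) *m D - (y - x) = (phi y - phi x - (y - x) *m (J p)^T) *m D.
    by rewrite (mulmxBl (phi y - phi x)) -mulmxA JD mulmx1.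
  apply: le_trans (mulD _) _; apply: le_trans (ler_wpM2l (ltW c0) H) _.
  rewrite (_ : c * _ = 2^-1 * `|y - x|)//.
  by field.
have lips x y : `|x - p| <= d -> `|y - p| <= d -> `|y - x| <= 2 * c * `|phi y - phi x|.
  move=> xd yd; have := strict x y xd yd; have := mulD (phi y - phi x).
  have : `|y - x| <= `|(phi y - phi x) *m D| + `|(phi y - phi x) *m D - (y - x)|.
    by rewrite -[in leLHS](subKr ((phi y - phi x) *m D) (y - x)); exact: ler_normB.
  by lra.
(* Measured after applying [D], since this is the displacement of [p] under the Newton map for [y]:
   with the contraction factor 1/2 the ball of radius [d] is mapped into itself. *)
pose W := [set y | `|(y - phi p) *m D| < d / 2].
pose V := [set x | `|x - p| < d /\ W (phi x)].
have Wo : open W.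
  apply: open_epsP => y Wy; exists ((d / 2 - `|(y - phi p) *m D|) / c).
    by rewrite divr_gt0// subr_gt0.
  move=> z; rewrite ltr_pdivlMr// => zy; rewrite /W/=.
  have -> : (z - phi p) *m D = (z - y) *m D + (y - phi p) *m D.
    by rewrite -mulmxDl addrA subrK.
  by apply: le_lt_trans (ler_normD _ _) _; have := mulD (z - y); lra.
have cphi x : U x -> {for x, continuous phi}.
  by move=> Ux; apply: continuous_row => i; exact: Ck_cont (phiC i) _ Ux.
have Vo : open V.
  apply: open_epsP => x [xd Wx].
  have [s s0 Hs] : exists2 s : R, 0 < s & forall y, `|y - phi x| < s -> W y.
    by apply/nbhs_epsP; exact: open_near Wo Wx.
  have s2 : 0 < s / 2 by rewrite divr_gt0.
  have /continuous_epsP/(_ _ s2)[t t0 Ht] := cphi x (bU _ (ltW xd)).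
  exists (Num.min t (d - `|x - p|)); first by rewrite lt_min t0 subr_gt0.
  move=> y; rewrite lt_min => /andP[yt yd]; split.
    by have : `|y - p| <= `|y - x| + `|x - p| by [exact: ler_distD]; lra.
  by apply: Hs; have := Ht _ yt; lra.
have ex y : exists x, W y -> [/\ `|x - p| < d & phi x = y].
  have [Wy|] := pselect (W y); last by exists p.
  (* Newton's map with the derivative frozen at [p]; its fixed points are the preimages of [y]. *)
  pose T x := x + (y - phi x) *m D.
  have TE x x' : T x - T x' = - ((phi x - phi x') *m D - (x - x')).
    rewrite /T !mulmxBl; move: (phi x *m D) (phi x' *m D) (y *m D) => a1 a2 a3.
    by apply/rowP => i; rewrite !mxE; ring.
  have Tp x : `|x - p| <= d -> `|T x - p| <= 2^-1 * `|x - p| + `|(y - phi p) *m D|.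
    move=> xd; have -> : T x - p = (T x - T p) + (y - phi p) *m D.
      by rewrite /T opprD !addrA subrK.
    apply: le_trans (ler_normD _ _) _; rewrite lerD2r TE normrN.
    by apply: strict => //; rewrite subrr normr0 ltW.
  have [||x xd Tx] := @row_fixpoint T p d d0 d1.
  - by move=> x xd; apply: le_trans (Tp x xd) _; move: Wy; rewrite /W/=; lra.
  - by move=> x x' xd x'd; rewrite TE normrN; exact: strict.
  exists x => _; split.
    by have := Tp x xd; rewrite Tx; move: Wy; rewrite /W/=; lra.
  have : (y - phi x) *m D = 0 by apply: (addrI x); rewrite addr0.
  move=> /(congr1 (fun v => v *m invmx D)); rewrite mulmxK// mul0mx => /eqP.
  by rewrite subr_eq0 => /eqP.
have /choice[psi Hpsi] := ex.
have VP y : W y -> V (psi y) by move=> Wy; have [a b] := Hpsi y Wy; split; rewrite ?b.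
have psiK y : W y -> phi (psi y) = y by move=> Wy; have [] := Hpsi y Wy.
have dpsi y : W y -> `|psi y - p| <= d by move=> Wy; have [/ltW] := Hpsi y Wy.
have Jd x e : U x -> 0 < e -> exists2 r, 0 < r & forall v, `|v| < r ->
    `|phi (x + v) - phi x - v *m (J x)^T| <= e * `|v|.
  move=> Ux e0; have [r r0 Hr] := jacobian_strict Ux e0; exists r => // v vr.
  have := Hr x (x + v); rewrite subrr normr0 r0 [x + v - x]addrAC subrr add0r.
  by move=> /(_ isT vr).
(* Along a kernel vector [phi] moves by at most [|t v| / (4 c)], whereas [lips] bounds [|t v|] by
   [2 c] times this move, hence by half of itself. *)
have JU x : V x -> J x \in unitmx.
  move=> [xd Wx]; rewrite -unitmx_tr; apply: unitmx_ker => v vJ.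
  have e40 : 0 < 4^-1 / c by rewrite divr_gt0.
  have [r r0 Hr] := Jd x _ (bU _ (ltW xd)) e40.
  apply: contrapT => /eqP v0; have vn : 0 < `|v| by rewrite normr_gt0.
  pose t := Num.min r (d - `|x - p|) / 2 / `|v|.
  have m0 : 0 < Num.min r (d - `|x - p|) by rewrite lt_min r0 subr_gt0.
  have t0 : 0 < t by rewrite !divr_gt0.
  have tv : `|t *: v| = Num.min r (d - `|x - p|) / 2.
    by rewrite normrZ gtr0_norm// /t divfK// gt_eqF.
  have mr : Num.min r (d - `|x - p|) <= r by rewrite ge_min lexx.
  have md : Num.min r (d - `|x - p|) <= d - `|x - p| by rewrite ge_min lexx orbT.
  have tvr : `|t *: v| < r by rewrite tv; lra.
  have := Hr _ tvr; rewrite -scalemxAl vJ scaler0 subr0 => H.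
  have xv : `|x + t *: v - p| <= d.
    rewrite addrAC; apply: le_trans (ler_normD _ _) _; rewrite tv; lra.
  have := lips x (x + t *: v) (ltW xd) xv; rewrite [x + _ - x]addrAC subrr add0r.
  have c2 : 0 <= 2 * c by rewrite mulr_ge0// ltW.
  have := ler_wpM2l c2 H.
  have -> : 2 * c * (4^-1 / c * `|t *: v|) = 2^-1 * `|t *: v|.
    by field.
  have : 0 < `|t *: v| by rewrite tv divr_gt0.
  by lra.
have dP y a i : W y -> is_derive y (bas a) (fun y => psi y 0 i) (invmx (J (psi y)) i a).
  move=> Wy; apply/is_derive_epsP => e e0.
  have Vx := VP _ Wy; have Jx := JU _ Vx; have Ux := bU _ (dpsi _ Wy).
  set x := psi y in Vx Jx Ux *.
  pose Di := (invmx (J x))^T.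
  have JDi : (J x)^T *m Di = 1%:M by rewrite -trmx_mul mulVmx// trmx1.
  pose c' := n%:R * `|Di| + 1.
  have c'0 : 0 < c' by rewrite ltr_wpDl// mulr_ge0.
  have cc0 : 0 < 2 * c * c' by rewrite mulr_gt0.
  have c'n0 : c' != 0 by rewrite gt_eqF.
  have [r r0 Hr] := Jd x _ Ux (divr_gt0 e0 cc0).
  have [s s0 Hs] : exists2 s : R, 0 < s & forall z, `|z - y| < s -> W z.
    by apply/nbhs_epsP; exact: open_near Wo Wy.
  exists (Num.min s (r / (2 * c))); first by rewrite lt_min s0 (divr_gt0 r0 c20).
  move=> h; rewrite lt_min => /andP[hs]; rewrite (ltr_pdivlMr _ _ c20) => hr.
  have Wy' : W (y + h *: bas a) by apply: Hs; rewrite addrAC subrr add0r norm_bas_scale.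
  set x' := psi (y + h *: bas a).
  have vb : `|x' - x| <= 2 * c * `|h|.
    have := lips x x' (dpsi _ Wy) (dpsi _ Wy').
    by rewrite /x' /x !psiK// [y + _ - y]addrAC subrr add0r norm_bas_scale.
  have vr : `|x' - x| < r by apply: le_lt_trans vb _; rewrite mulrC.
  have := Hr _ vr; rewrite [x + _]addrC subrK /x' /x !psiK// [y + _ - y]addrAC subrr add0r -/x -/x' => H.
  have -> : x' 0 i - x 0 i - h * invmx (J x) i a =
      - ((h *: bas a - (x' - x) *m (J x)^T) *m Di) 0 i.
    rewrite mulmxBl -mulmxA JDi mulmx1 -scalemxAl -rowE.
    by rewrite !mxE; ring.
  rewrite normrN; apply: le_trans (norm_mx_coord _ _ _) _.
  apply: le_trans (norm_mulmx _ _) _.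
  have -> : e * `|h| = c' * (e / (2 * c * c') * (2 * c * `|h|)).
    rewrite -[X in X * _](divfK (lt0r_neq0 cc0)); move: (e / _) => E; ring.
  have nc : n%:R * `|Di| <= c' by rewrite /c' lerDl.
  rewrite [X in n%:R * X]mulrC mulrA ler_pM//.
  apply: le_trans H _; rewrite ler_wpM2l//.
  by rewrite ltW// divr_gt0.
exists V, W, psi; split.
- split => //; last by move=> x [/ltW/bU].
  split; first by rewrite subrr normr0.
  by rewrite /W/= subrr mul0mx normr0 divr_gt0.
- move=> x [xd Wx]; split => //; apply/eqP; rewrite -subr_eq0 -normr_le0.
  apply: le_trans (lips _ _ (ltW xd) (dpsi _ Wx)) _.
  by rewrite psiK// subrr normr0 mulr0.
- by move=> y Wy; split; [exact: VP|exact: psiK].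
- have CJ j : (j <= k)%N -> Ckmx U j J.
    move=> jk i s; apply: (@Ck_ext _ _ _ _ (partial s (fun x => phi x 0 i))) => //.
      by move=> x _; rewrite mxE.
    by apply: Ck_le jk _; exact: Ck_partial.
  (* Bootstrap: the derivative of [psi] is the inverse of [J] at [psi], so it is C^j as soon as
     [psi] is. *)
  suff H j : (j <= k.+1)%N -> forall i, Ck W j (fun y => psi y 0 i) by exact: H.
  elim: j => [_ i|j IH jk i].
    apply: Ck0 => y Wy; apply/continuous_epsP => e e0.
    have [s s0 Hs] : exists2 s : R, 0 < s & forall z, `|z - y| < s -> W z.
      by apply/nbhs_epsP; exact: open_near Wo Wy.
    exists (Num.min s (e / (2 * c))); first by rewrite lt_min s0 (divr_gt0 e0 c20).
    move=> z; rewrite lt_min (ltr_pdivlMr _ _ c20) => /andP[/Hs Wz ze].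
    have := norm_mx_coord (psi z - psi y) 0 i; rewrite !mxE => /le_trans; apply.
    apply: le_trans (lips _ _ (dpsi _ Wy) (dpsi _ Wz)) _.
    by rewrite !psiK// mulrC ltW.
  apply: (@Ck_build _ _ _ _ _ (fun a y => invmx (J (psi y)) i a)) => //.
  move=> a; apply: (@Ckmx_inv _ _ W j n (fun y => J (psi y))) => //.
    by move=> y /VP /JU.
  move=> u v; apply: (@Ck_comp _ _ _ U W j (fun x => J x u v) psi) => //.
  + by move=> y /dpsi /bU.
  + by apply: IH; exact: ltnW.
  + exact: CJ.
- move=> y Wy; split; first by apply: JU; exact: VP.
  by move=> i a; apply: is_derive_partial; exact: dP.
Qed.

End InverseFunction.

(** * Existence of adapted symbols *)

Section Skeleton.
Variable F : fieldType.

Lemma sub_rowsub m n p (A : 'M[F]_(n, p)) (f : 'I_m -> 'I_n) :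
  (\rank A <= \rank (rowsub f A))%N -> (A <= rowsub f A)%MS.
Proof. by move=> Af; rewrite -(geq_leqif (mxrank_leqif_sup (rowsub_sub f A))). Qed.

(** The chosen rows span the row space, so [A] is [W] times them; restricting to the columns [h]
    identifies [W]. *)
Lemma skeleton m n (A : 'M[F]_n) (f h : 'I_m -> 'I_n) : \rank A = m ->
  mxsub f h A \in unitmx ->
  colsub h A *m invmx (mxsub f h A) *m rowsub f A = A.
Proof.
move=> Am uA.
have : (A <= rowsub f A)%MS.
  apply: sub_rowsub; rewrite Am -[X in (X <= _)%N](mxrank_unit uA).
  rewrite (_ : mxsub f h A = rowsub f A *m colsub h 1%:M) ?mxrankM_maxl//.
  by rewrite mulmx_colsub mulmx1; apply/matrixP => i j; rewrite !mxE.
move=> /submxP[W AE].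
have -> : colsub h A = W *m mxsub f h A.
  rewrite {1}AE -mulmx_colsub; congr (_ *m _).
  by apply/matrixP => i j; rewrite !mxE.
by rewrite -[W *m _ *m _]mulmxA mulmxV// mulmx1 -AE.
Qed.

(** By symmetry the chosen rows are the principal submatrix times [W^T], so this submatrix has rank
    at least [m]. *)
Lemma principal_minor_unit m n (A : 'M[F]_n) (f : 'I_m -> 'I_n) : A^T = A ->
  \rank A = m -> row_free (rowsub f A) -> mxsub f f A \in unitmx.
Proof.
move=> As Am /eqP rB.
have /submxP[W AE] : (A <= rowsub f A)%MS by apply: sub_rowsub; rewrite rB Am.
have BE : rowsub f A = mxsub f f A *m W^T.
  rewrite -{1}As {1}AE trmx_mul -mul_rowsub_mx; congr (_ *m _).
  by apply/matrixP => i j; rewrite !mxE -{1}As mxE.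
rewrite -row_full_unit /row_full eqn_leq rank_leq_row /=.
by rewrite -{1}rB BE mxrankM_maxl.
Qed.

Lemma principal_minor n (A : 'M[F]_n) : A^T = A ->
  exists f : 'I_(\rank A) -> 'I_n, mxsub f f A \in unitmx.
Proof.
by move=> As; exists (maxrankfun A); apply: principal_minor_unit => //; exact: maxrowsub_free.
Qed.

End Skeleton.

Section GeneralizedInverse.
Variables (R : realType) (n m : nat).
Implicit Types A : 'M[R]_n.

Definition minors_sq A : R := \sum_(f : {ffun 'I_m -> 'I_n}) (\det (mxsub f f A)) ^+ 2.

(* The average, weighted by squared determinants, of the generalized inverses
   attached to the invertible principal [m x m] submatrices: unlike each of them
   it is a smooth function of a matrix of varying row space and rank [m]. *)
Definition geninv A : 'M[R]_n :=
  (minors_sq A)^-1 *: \sum_(f : {ffun 'I_m -> 'I_n}) \det (mxsub f f A) *: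
     (colsub f 1%:M *m \adj (mxsub f f A) *m rowsub f 1%:M).

Lemma minors_sq_neq0 A : A^T = A -> \rank A = m -> minors_sq A != 0.
Proof.
move=> As Am; have [f uf] : exists f : 'I_m -> 'I_n, mxsub f f A \in unitmx.
  by rewrite -Am; exact: principal_minor.
rewrite /minors_sq psumr_neq0; last by move=> i _; exact: sqr_ge0.
apply/hasP; exists [ffun i => f i]; first by rewrite mem_index_enum.
rewrite /= lt_def sqr_ge0 andbT sqrf_eq0 -unitfE.
rewrite (_ : mxsub _ _ A = mxsub f f A) -?unitmxE//.
by apply/matrixP => i j; rewrite !mxE !ffunE.
Qed.

(** Determinant times adjugate is the squared determinant times the inverse. By [skeleton] an
    invertible minor thus contributes its square times [A], and a vanishing one contributes
    nothing. *)
Lemma mul_geninv A : A^T = A -> \rank A = m -> A *m geninv A *m A = A.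
Proof.
move=> As Am; rewrite /geninv -scalemxAr -scalemxAl mulmx_sumr mulmx_suml.
rewrite (eq_bigr (fun f : {ffun 'I_m -> 'I_n} => (\det (mxsub f f A)) ^+ 2 *: A)) => [|f _].
  by rewrite -scaler_suml scalerA mulVf ?scale1r// minors_sq_neq0.
rewrite -scalemxAr -scalemxAl expr2 -scalerA.
have [->|dN] := eqVneq (\det (mxsub f f A)) 0; first by rewrite !scale0r.
congr (_ *: _).
have uf : mxsub f f A \in unitmx by rewrite unitmxE unitfE.
rewrite -!mulmxA -rowsubE 2!mulmxA mulmx_colsub mulmx1.
rewrite -{5}(skeleton Am uf) /invmx uf -scalemxAr -scalemxAl scalerA mulfV// scale1r.
by [].
Qed.

Lemma Ckmx_geninv (U : set 'rV[R]_n) k (g : 'rV[R]_n -> 'M[R]_n) : open U ->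
  (forall x, U x -> (g x)^T = g x) -> (forall x, U x -> \rank (g x) = m) ->
  Ckmx U k g -> Ckmx U k (fun x => geninv (g x)).
Proof.
move=> Uo gs gm gC i j.
have dC (f : {ffun 'I_m -> 'I_n}) : Ck U k (fun x => \det (mxsub f f (g x))).
  by apply: Ck_det => //; exact: Ckmx_sub.
apply: (@Ck_ext _ _ _ _ (fun x => (minors_sq (g x))^-1 *
   \sum_(f : {ffun 'I_m -> 'I_n}) \det (mxsub f f (g x)) *
     (colsub f 1%:M *m \adj (mxsub f f (g x)) *m rowsub f 1%:M) i j)) => //.
  move=> x Ux; rewrite /geninv [RHS]mxE summxE; congr (_ * _).
  by apply: eq_bigr => f _; rewrite [RHS]mxE.
apply: Ck_mul => //.
  apply: Ck_inv => //; first by move=> x Ux; apply: minors_sq_neq0; [exact: gs|exact: gm].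
  by apply: Ck_sum => // f _; exact: Ck_mul.
apply: Ck_sum => // f _; apply: Ck_mul => //.
apply: (Ckmx_mul _ (Ckmx_mul _ (Ckmx_cst _ _ _) _) (Ckmx_cst _ _ _)) => //.
by apply: Ckmx_adj => //; exact: Ckmx_sub.
Qed.

End GeneralizedInverse.

Section Symbols.
Variables (R : realType) (n : nat) (U : set 'rV[R]_n) (g : 'rV[R]_n -> 'M[R]_n).
Hypotheses (Uo : open U) (gs : symmetric_on U g).

Lemma partial_sym r i j k x : form_Ck U g r.+1 -> U x ->
  partial k (fun y => g y j i) x = partial k (fun y => g y i j) x.
Proof.
move=> gC Ux; apply: is_derive_partial.
apply: is_derive_near (Ck_deriv (gC i j) k Ux).
apply: filterS (open_near Uo Ux) => y Uy.
by rewrite -(gs Uy) mxE gs.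
Qed.

(** Double annihilator: by symmetry of [g] the columns of its cokernel matrix lie in the radical. *)
Lemma radical_sub x (c : 'rV[R]_n) : U x ->
  (forall v, radical g x v -> \sum_s c 0 s * v 0 s = 0) <-> (c <= g x)%MS.
Proof.
move=> Ux; split => [H|/submxP[d ->] v vr].
  rewrite submxE; apply/eqP/rowP => j; rewrite [LHS]mxE [RHS]mxE.
  have := H (col j (cokermx (g x)))^T.
  rewrite (eq_bigr (fun s => c 0 s * cokermx (g x) s j)) => [|s _]; last first.
    by rewrite [_^T _ _]mxE [col _ _ _ _]mxE.
  apply => w; rewrite -[X in _ *m X *m _](gs Ux) -trmx_mul.
  have -> : g x *m col j (cokermx (g x)) = col j (g x *m cokermx (g x)).
    by rewrite !colE mulmxA.
  by rewrite mulmx_coker; apply/matrixP => a b; rewrite !mxE big1// => s _; rewrite !mxE mul0r.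
have : d *m g x *m v^T = 0.
  by apply: trmx_inj; rewrite trmx0 !trmx_mul trmxK (gs Ux) mulmxA vr.
move=> /matrixP/(_ 0 0); rewrite [RHS]mxE => E; rewrite -[RHS]E [RHS]mxE.
by apply: eq_bigr => s _; rewrite [v^T _ _]mxE.
Qed.

Lemma adapted_exist r : form_Ck U g r.+1 -> constant_rank U g ->
  U !=set0 ->
  (forall x, U x -> forall v, radical g x v ->
       forall i j : 'I_n, \sum_s christoffel1 g i j s x * v 0 s = 0) ->
  exists Gam, adapted_symbols U g r.+1 Gam.
Proof.
move=> gC gr [p Up] grad.
pose m := \rank (g p).
have gm x : U x -> \rank (g x) = m by move=> Ux; exact: gr.
pose X x := geninv m (g x).
have XC : Ckmx U r.+1 X by apply: Ckmx_geninv.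
(* The index is raised with a generalized inverse defined on all of [U]; a single inverted minor
   would only do locally. *)
exists (fun s j k x => \sum_t X x s t * christoffel1 g j k t x).
have chS j k t x : U x -> christoffel1 g j k t x = christoffel1 g k j t x.
  by move=> Ux; rewrite /christoffel1 (partial_sym j k t gC Ux); ring.
split => [s j k|s j k x Ux|i j k x Ux].
- apply: Ck_sum => // t _; apply: Ck_mul => //; first exact: CkS.
  apply: Ck_scale => //; apply: Ck_sub => //; first apply: Ck_add => //; apply: Ck_partial; exact: gC.
- by apply: eq_bigr => t _; rewrite chS.
(* The hypothesis on the radical puts the symbols of the first kind in the row space of [g], where
   [g X] acts as the identity. *)
have lower a b c : \sum_s (\sum_t X x s t * christoffel1 g a b t x) * g x c s = christoffel1 g a b c x.
  pose ga : 'rV[R]_n := \row_s christoffel1 g a b s x.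
  have /(radical_sub _ Ux) /submxP[d gaE] : forall v, radical g x v -> \sum_s ga 0 s * v 0 s = 0.
    by move=> v vr; under eq_bigr do rewrite mxE; exact: grad.
  have : (g x *m X x *m ga^T) c 0 = ga^T c 0.
    by rewrite gaE trmx_mul (gs Ux) !mulmxA mul_geninv; [| exact: gs | exact: gm].
  rewrite -mulmxA mxE [in RHS]mxE [in RHS]mxE => <-.
  apply: eq_bigr => s _; rewrite mulrC mxE; congr (_ * _).
  by apply: eq_bigr => t _; rewrite !mxE.
rewrite big_split /= !lower /christoffel1.
rewrite (partial_sym j i k gC Ux) [partial i _ _](partial_sym k j i gC Ux).
rewrite [partial j (fun y => g y k i) x](partial_sym i k j gC Ux).
by field.
Qed.

End Symbols.

(** * The weak curvature condition *)

Section Mixed.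
Variables (R : realType) (n : nat).

(** The mean value theorem in direction [k] leaves an increment of [partial k f] between two points
    that both depend on [h]; this is why strict differentiability is used for it. *)
Lemma second_difference (U : set 'rV[R]_n) f x k l e : open U -> Ck U 2 f -> U x -> 0 < e ->
  exists2 r, 0 < r & forall h, 0 < h -> h < r ->
   `|f (x + h *: bas k + h *: bas l) - f (x + h *: bas k) - f (x + h *: bas l) + f x
     - h ^+ 2 * partial l (partial k f) x| <= e * h ^+ 2.
Proof.
move=> Uo Hf Ux e0; have Hk := Ck_partial k Hf.
have [r r0 Hr] := @strict_diff _ _ _ (partial k f) (fun i => partial i (partial k f)) Uo
   (fun y i Uy => Ck_deriv Hk i Uy) x Ux (fun i => Ck_cont (Ck_partial i Hk) Ux) e e0.
have /nbhs_epsP[s s0 Hs] := open_near Uo Ux.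
exists (Num.min r s / 2); first by rewrite divr_gt0// lt_min r0.
move=> h h0; rewrite ltr_pdivlMr// lt_min => /andP[hr hs].
have near t (v : 'rV[R]_n) (b : R) : `|t| <= h -> `|v| <= 1 -> `|b| <= h ->
    `|x + t *: bas k + b *: v - x| <= h * 2.
  move=> th v1 bh; rewrite -(addrA x) (addrAC x) subrr add0r.
  apply: le_trans (ler_normD _ _) _; rewrite norm_bas_scale normrZ mulr2n mulrDr mulr1 addrC lerD//.
  by rewrite -[leRHS]mulr1; apply: ler_pM.
have line t b : `|t| <= h -> `|b| <= h ->
    is_derive (x + t *: bas k) (bas k) (fun y => f (y + b *: bas l)) (partial k f (x + t *: bas k + b *: bas l)).
  move=> th bh; apply: (@is_derive_translate _ _ f _ _ (b *: bas l)) => //.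
  apply: Ck_deriv Hf _ _ _; apply: Hs; apply: le_lt_trans hs; apply: near => //.
  by rewrite norm_bas.
have H0 : `|0 : R| <= h by rewrite normr0 ltW.
have [|c ch] := @MVT_line _ _ (fun y => f (y + h *: bas l) - f (y + 0 *: bas l)) x (bas k)
   (fun y => partial k f (y + h *: bas l) - partial k f (y + 0 *: bas l)) h.
  move=> t; rewrite (gtr0_norm h0) => th; apply: is_derive_sub; apply: line => //.
  by rewrite gtr0_norm.
rewrite (gtr0_norm h0) in ch.
rewrite !scale0r !addr0 => E.
have -> : f (x + h *: bas k + h *: bas l) - f (x + h *: bas k) - f (x + h *: bas l) + f x
   = f (x + h *: bas k + h *: bas l) - f (x + h *: bas k) - (f (x + h *: bas l) - f x) by ring.
rewrite E.
have := Hr (x + c *: bas k) (x + c *: bas k + h *: bas l).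
have N1 : `|x + c *: bas k - x| < r.
  by apply: le_lt_trans hr; have := near c (bas l) 0 ch; rewrite scale0r addr0 norm_bas; apply.
have N2 : `|x + c *: bas k + h *: bas l - x| < r.
  by apply: le_lt_trans hr; apply: near => //; rewrite ?norm_bas// gtr0_norm.
move=> /(_ N1 N2).
have -> : x + c *: bas k + h *: bas l - (x + c *: bas k) = h *: bas l by rewrite addrC addKr.
rewrite (bigD1 l)//= big1 => [|i il]; last first.
  by rewrite !mxE eqxx (negPf il) mulr0 mul0r.
rewrite !mxE !eqxx mulr1 addr0 norm_bas_scale (gtr0_norm h0) => H.
move: (partial k f _ - _) (partial l _ _) H => a b H.
rewrite (_ : h * a - h ^+ 2 * b = h * (a - h * b)); last by ring.
rewrite normrM (gtr0_norm h0) (_ : e * h ^+ 2 = h * (e * h)); last by ring.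
by rewrite ler_pM2l.
Qed.

Lemma schwarz (U : set 'rV[R]_n) f x k l : open U -> Ck U 2 f -> U x ->
  partial k (partial l f) x = partial l (partial k f) x.
Proof.
move=> Uo Hf Ux; apply/eqP; rewrite -subr_eq0; apply/eqP.
apply: (@small_zero _ _ 2) => e e0.
have [r r0 Hr] := second_difference k l Uo Hf Ux e0.
have [s s0 Hs] := second_difference l k Uo Hf Ux e0.
pose h := Num.min r s / 2.
have h0 : 0 < h by rewrite divr_gt0// lt_min r0.
have hm : h < Num.min r s by rewrite ltr_pdivrMr// mulr2n mulrDr mulr1 ltrDl lt_min r0.
have [hr hs] : h < r /\ h < s by move: hm; rewrite lt_min => /andP.
move: (Hr h h0 hr) (Hs h h0 hs).
have -> : x + h *: bas l + h *: bas k = x + h *: bas k + h *: bas l by rewrite addrAC.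
move: (f _) (f _) (f _) (f _) (partial _ _ _) (partial _ _ _) => a b c d u v.
rewrite !ler_norml => /andP[A1 A2] /andP[B1 B2].
have hh : 0 < h ^+ 2 by rewrite exprn_gt0.
by apply/andP; split; rewrite -(ler_pM2r hh); lra.
Qed.

End Mixed.

(** * The weak condition in matrix form *)

Section Forms.
Variables (R : realType) (n : nat) (U : set 'rV[R]_n) (g : 'rV[R]_n -> 'M[R]_n).
Variable Gam : 'I_n -> 'I_n -> 'I_n -> 'rV[R]_n -> R.
Hypotheses (Uo : open U) (gs : symmetric_on U g).
Implicit Types (u : 'rV[R]_n -> 'rV[R]_n) (K : set 'rV[R]_n).

Definition Gmx k x : 'M[R]_n := \matrix_(a, s) Gam a k s x.

Definition drow k u x : 'rV[R]_n := \row_s partial k (fun y => u y 0 s) x.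

(** The integrand of the weak condition with [u] as a row vector; putting the lower index [j] last
    turns it into matrix products. *)
Definition weak_form j k l u x : R :=
  (drow l u x *m Gmx k x - drow k u x *m Gmx l x
   + u x *m (Gmx k x *m Gmx l x - Gmx l x *m Gmx k x)) 0 j.

Definition annihilator_form K u :=
  [/\ Ckmx setT 1 u, forall x, ~ K x -> u x = 0 & forall x, U x -> (u x <= g x)%MS].

Lemma drow_off K u k x : closed K -> (forall x, ~ K x -> u x = 0) -> ~ K x -> drow k u x = 0.
Proof.
move=> Kc u0 Kx; apply/rowP => s; rewrite !mxE; apply: is_derive_partial.
apply: is_derive_near (is_derive_const x (bas k) (0 : R)).
apply: filterS (open_near (closed_openC Kc) Kx) => y /u0 ->; by rewrite mxE.
Qed.

Lemma weak_formE K u j k l x : closed K -> K `<=` U -> (forall x, ~ K x -> u x = 0) ->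
  (forall s j k x, U x -> Gam s j k x = Gam s k j x) ->
  weak_form j k l u x = \sum_s
      (- Gam s j l x * partial k (fun y => u y 0 s) x + Gam s j k x * partial l (fun y => u y 0 s) x
       + u x 0 s * \sum_a (Gam s k a x * Gam a l j x - Gam s l a x * Gam a j k x)).
Proof.
move=> Kc KU u0 GS; rewrite /weak_form.
(* The symmetry of [Gam] is known on [U] only; off [K] both sides vanish with [u] and its
   derivatives. *)
have [Kx|Kx] := pselect (K x); last first.
  rewrite !(drow_off _ Kc u0 Kx) (u0 _ Kx) !mul0mx subr0 addr0 mxE big1// => s _.
  rewrite (mxE _ _ 0 s) mul0r.
  have /rowP/(_ s) := drow_off k Kc u0 Kx; rewrite !mxE => ->.
  have /rowP/(_ s) := drow_off l Kc u0 Kx; rewrite !mxE => ->.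
  by rewrite !mulr0 !addr0.
have Ux := KU _ Kx.
rewrite !mxE -sumrB -big_split/=; apply: eq_bigr => s _.
rewrite !mxE -sumrB (GS s j l _ Ux) (GS s j k _ Ux); congr (_ + _).
  by rewrite mulNr [X in _ - X]mulrC [X in X - _]mulrC addrC.
by congr (_ * _); apply: eq_bigr => a _; rewrite !mxE (GS a j k _ Ux).
Qed.

Lemma weakP : (forall s j k x, U x -> Gam s j k x = Gam s k j x) ->
  weak_curvature_zero U g Gam <->
  forall K u j k l, compact K -> K `<=` U -> annihilator_form K u ->
    rVintegral (weak_form j k l u) = 0.
Proof.
move=> GS; split => [H K u j k l Kc KU [uC u0 ug]|H j k l u [uC Kc KU ug]].
  have Kcl : closed K by apply: compact_closed Kc; exact: norm_hausdorff.
  rewrite -(H j k l (fun s x => u x 0 s)).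
    by apply: rVintegral_ext => x; exact: weak_formE Kcl KU u0 GS.
  have SK : closure [set x | exists s : 'I_n, u x 0 s != 0] `<=` K.
    apply: (@subset_trans _ (closure K)); last by rewrite -(closure_id K).1.
    apply: closureS => x [s us]; apply: contrapT => /u0 E.
    by rewrite E mxE eqxx in us.
  split.
  - by move=> s; apply: Ck_subset (uC 0 s).
  - by apply: subclosed_compact SK => //; exact: closed_closure.
  - by apply: subset_trans KU.
  - by move=> x v Ux; apply: (radical_sub gs _ Ux).2; exact: ug.
set K := closure _ in Kc KU.
pose w x : 'rV[R]_n := \row_s u s x.
have Kcl : closed K by exact: closed_closure.
have u0 s x : ~ K x -> u s x = 0.
  by move=> Kx; apply/eqP/negPn/negP => us; apply: Kx; apply: subset_closure; exists s.
have w0 x : ~ K x -> w x = 0.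
  by move=> Kx; apply/rowP => s; rewrite !mxE u0.
have E s : (fun y => w y 0 s) = u s by apply/funext => y; rewrite mxE.
apply: (etrans _ (H K w j k l Kc KU _)).
  apply: rVintegral_ext => x; rewrite (weak_formE _ _ _ _ Kcl KU w0 GS).
  by apply: eq_bigr => s _; rewrite !E [w x 0 s]mxE.
split => //.
  move=> i s; rewrite ord1 E; apply: (Ck_zero_off Uo Kcl KU) => [x Kx|]; [exact: u0|exact: uC].
move=> x Ux; apply: (radical_sub gs _ Ux).1 => v vr; rewrite -[RHS](ug x v Ux vr).
by apply: eq_bigr => s _; rewrite mxE.
Qed.

End Forms.

(** * From flat coordinates to zero curvature *)

Section Charts.
Variables (R : realType) (n : nat) (U : set 'rV[R]_n) (g : 'rV[R]_n -> 'M[R]_n).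
Variable Gam : 'I_n -> 'I_n -> 'I_n -> 'rV[R]_n -> R.
Variable r : nat.
Hypotheses (Uo : open U) (gs : symmetric_on U g) (gC : form_Ck U g r.+1).
Hypothesis adG : adapted_symbols U g r.+1 Gam.
Local Notation Gmx := (Gmx Gam).
Local Notation weak_form := (weak_form Gam).

Lemma adapted_metric k x : U x ->
  is_derive_mx x (bas k) g (g x *m Gmx k x + (Gmx k x)^T *m g x).
Proof.
case: adG => _ GS GE Ux i j.
have := Ck_deriv (gC i j) k Ux; rewrite -(GE i j k x Ux); congr is_derive.
rewrite [RHS]mxE [X in _ = X + _]mxE [X in _ = _ + X]mxE -big_split; apply: eq_bigr => s _ /=.
rewrite mxE [_^T _ _]mxE [Gmx _ _ _ _]mxE (GS s j k x Ux) (GS s i k x Ux) mulrC; congr (_ + _ * _).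
by rewrite -(gs Ux) mxE gs.
Qed.

Lemma chain_jacobian (V W : set 'rV[R]_n) (phi psi : 'rV[R]_n -> 'rV[R]_n) x :
  open V -> open W -> V x -> W (phi x) -> (forall x, V x -> psi (phi x) = x) ->
  (forall i : 'I_n, Ck V 1 (fun x => phi x 0 i)) ->
  (forall i : 'I_n, Ck W 1 (fun y => psi y 0 i)) ->
  jacobian psi (phi x) *m jacobian phi x = 1%:M.
Proof.
move=> Vo Wo Vx Wx psiphi phiC psiC; apply/matrixP => i j; rewrite !mxE.
have H1 := @Ck_chain _ _ _ _ _ _ phi x (bas j) _ Wo (psiC i) Wx (fun s => Ck_deriv (phiC s) j Vx).
have H2 : is_derive x (bas j) (fun t => psi (phi t) 0 i) ((bas j : 'rV[R]_n) 0 i).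
  apply: is_derive_near (is_derive_coord x (bas j) i).
  by apply: filterS (open_near Vo Vx) => y /psiphi ->.
rewrite (_ : (i == j)%:R = (bas j : 'rV[R]_n) 0 i); last by rewrite mxE eqxx eq_sym.
rewrite -(is_derive_unique H1 H2); apply: eq_bigr => s _; by rewrite !mxE mulrC.
Qed.

Lemma flat_chart p k : has_flat_coordinates U g k.+1 -> U p ->
  exists (V : set 'rV[R]_n) (phi : 'rV[R]_n -> 'rV[R]_n) (c : 'M[R]_n), [/\ open V, V p, V `<=` U, forall i : 'I_n, Ck V k.+1 (fun x => phi x 0 i)
    & c^T = c /\ forall x, V x -> jacobian phi x \in unitmx /\
        g x = (jacobian phi x)^T *m c *m jacobian phi x].
Proof.
move=> H /H [V [W [phi [psi [c [[Vo Vp VU Wo] VW WV HC Hc]]]]]].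
exists V, phi, c.
have J1 x : V x -> jacobian psi (phi x) *m jacobian phi x = 1%:M.
  move=> Vx; have [Wx _] := VW x Vx; apply: (chain_jacobian Vo Wo) => //.
  - by move=> y /VW[].
  - by move=> i; apply: Ck_le (HC i).1.
  - by move=> i; apply: Ck_le (HC i).2.
have cE x : V x -> c = (jacobian psi (phi x))^T *m g x *m jacobian psi (phi x).
  move=> Vx; have [Wx psix] := VW x Vx; apply/matrixP => a b; rewrite -(Hc _ a b Wx) psix.
  rewrite exchange_big mxE; apply: eq_bigr => j _.
  rewrite mxE mulr_suml; apply: eq_bigr => i _; by rewrite !mxE (mulrC (g _ _ _)).
split => //; first by move=> i; exact: (HC i).1.
split; first by rewrite (cE p Vp) !trmx_mul trmxK (gs (VU _ Vp)) mulmxA.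
move=> x Vx; split; first by have /mulmx1_unit[] := J1 x Vx.
rewrite (cE x Vx) !mulmxA -trmx_mul J1// trmx1 mul1mx -mulmxA J1// mulmx1.
by [].
Qed.

(** Alternating the skew symmetry in one pair of indices with the symmetry in another returns to the
    start after an odd number of sign changes. *)
Lemma koszul (T : 'I_n -> 'M[R]_n) : (forall k i j, T k i j = - T k j i) ->
  (forall k i j, T k i j = T j i k) -> forall k, T k = 0.
Proof.
move=> A S k; apply/matrixP => i j; rewrite mxE.
have H : T k i j = - T k i j by rewrite {1}A (S k j i) (A i) opprK (S i k j) (A j) (S j i k).
by lra.
Qed.

Lemma mulmx_entry_eq p q s s' (A : 'M[R]_(p, q)) (B : 'M[R]_(q, s)) (B' : 'M[R]_(q, s')) i j j' :
  (forall a, B a j = B' a j') -> (A *m B) i j = (A *m B') i j'.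
Proof. by move=> BB; rewrite [LHS]mxE [RHS]mxE; apply: eq_bigr => a _; rewrite BB. Qed.

Definition hess (phi : 'rV[R]_n -> 'rV[R]_n) k x : 'M[R]_n :=
  \matrix_(i, s) partial k (partial s (fun y => phi y 0 i)) x.

Lemma is_derive_jacobian (V : set 'rV[R]_n) (phi : 'rV[R]_n -> 'rV[R]_n) k x :
  (forall i : 'I_n, Ck V 2 (fun x => phi x 0 i)) -> V x ->
  is_derive_mx x (bas k) (jacobian phi) (hess phi k x).
Proof.
move=> phiC Vx i s; rewrite mxE.
apply: (is_derive_ext _ (Ck_deriv (Ck_partial s (phiC i)) k Vx)) => y; by rewrite mxE.
Qed.

(** The difference of g Gamma_k and J^T c d_k J is skew, as both have the symmetrization d_k g, and
    symmetric in the two lower indices by Schwarz. Only the invertible J^T can be cancelled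
    afterwards. *)
Lemma flat_christoffel (V : set 'rV[R]_n) (phi : 'rV[R]_n -> 'rV[R]_n) (c : 'M[R]_n) k x : open V -> V `<=` U ->
  (forall i : 'I_n, Ck V 2 (fun x => phi x 0 i)) -> c^T = c ->
  (forall x, V x -> jacobian phi x \in unitmx /\
        g x = (jacobian phi x)^T *m c *m jacobian phi x) -> V x ->
  c *m jacobian phi x *m Gmx k x = c *m hess phi k x.
Proof.
move=> Vo VU phiC cs HJ Vx; have [uJ gE] := HJ x Vx.
set J := jacobian phi x in uJ gE *.
pose T k := g x *m Gmx k x - J^T *m c *m hess phi k x.
have T0 : forall k, T k = 0.
  apply: koszul => [l i j|l i j]; last first.
    rewrite /T [LHS]mxE [RHS]mxE [X in _ + X = _]mxE [X in _ = _ + X]mxE.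
    congr (_ - _); apply: mulmx_entry_eq => s; rewrite [LHS]mxE [RHS]mxE.
      by case: adG => _ GS _; exact: GS (VU _ Vx).
    exact: schwarz Vo (phiC s) Vx.
  have D1 := adapted_metric l (VU _ Vx).
  have DJ := is_derive_jacobian l phiC Vx.
  have D2 := is_derive_mx_mul (is_derive_mx_mul (is_derive_mx_tr DJ) (is_derive_mx_cst x (bas l) c)) DJ.
  have E : g x *m Gmx l x + (Gmx l x)^T *m g x
      = ((hess phi l x)^T *m c + J^T *m 0) *m J + J^T *m c *m hess phi l x.
    apply/matrixP => a b; apply: is_derive_unique (D1 a b) _.
    apply: is_derive_near (D2 a b); apply: filterS (open_near Vo Vx) => y /HJ[_ ->].
    by [].
  have : T l + (T l)^T = 0.
    rewrite /T linearB /= !trmx_mul trmxK (gs (VU _ Vx)) cs addrACA E mulmx0 addr0 mulmxA.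
    rewrite -opprD [_ + J^T *m _ *m _]addrC subrr.
    by [].
  by move=> /matrixP/(_ i j); rewrite mxE [_^T _ _]mxE [RHS]mxE => /eqP; rewrite addr_eq0 => /eqP.
have /(congr1 (mulmx (invmx J^T))) := T0 k.
rewrite mulmx0 mulmxBr gE !mulmxA mulVmx ?unitmx_tr// mul1mx => /eqP.
by rewrite subr_eq0 => /eqP.
Qed.

End Charts.

Section Local.
Variables (R : realType) (n : nat) (U : set 'rV[R]_n) (g : 'rV[R]_n -> 'M[R]_n).
Variable Gam : 'I_n -> 'I_n -> 'I_n -> 'rV[R]_n -> R.
Variable r : nat.
Hypotheses (Uo : open U) (gs : symmetric_on U g) (gC : form_Ck U g r.+1).
Hypothesis adG : adapted_symbols U g r.+1 Gam.
Local Notation Gmx := (Gmx Gam).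
Local Notation weak_form := (weak_form Gam).
Implicit Types u : 'rV[R]_n -> 'rV[R]_n.

Lemma is_derive_drow u k x : Ckmx setT 1 u -> is_derive_mx x (bas k) u (drow k u x).
Proof.
move=> uC i s; rewrite mxE ord1; exact: (@Ck_deriv _ _ _ _ _ (uC 0 s) k x).
Qed.

(** The terms in which [y] is not differentiated are y c J times products of two Gamma matrices, and
    they cancel against the quadratic part of the integrand. *)
Lemma weak_form_pullback m (J : 'rV[R]_n -> 'M[R]_(m, n)) (H : 'I_n -> 'M[R]_(m, n)) (c : 'M[R]_m)
    u (y : 'rV[R]_n -> 'rV[R]_m) (dy : 'I_n -> 'rV[R]_m) j k l x :
  Ckmx setT 1 u -> (\forall z \near x, u z = y z *m c *m J z) ->
  (forall k, is_derive_mx x (bas k) J (H k)) ->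
  (forall k, is_derive_mx x (bas k) y (dy k)) ->
  (forall k, c *m J x *m Gmx k x = c *m H k) ->
  weak_form j k l u x = (dy l *m (c *m H k) - dy k *m (c *m H l)) 0 j.
Proof.
move=> uC uE DJ Dy cH.
have D k' : drow k' u x = dy k' *m c *m J x + y x *m (c *m H k').
  apply/matrixP => a b; apply: is_derive_unique (is_derive_drow k' x uC a b) _.
  have := is_derive_mx_mul (is_derive_mx_mul (Dy k') (is_derive_mx_cst x (bas k') c)) (DJ k').
  rewrite mulmx0 addr0 -[y x *m c *m _]mulmxA => /(_ a b); apply: is_derive_near.
  by apply: filterS uE => z ->.
rewrite /weak_form !D (nbhs_singleton uE) -!cH.
congr (fun_of_matrix _ 0 j).
rewrite !mulmxDl mulmxBr !mulmxA.
move: (dy l *m c *m J x *m _) (dy k *m c *m J x *m _) => A B.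
move: (y x *m c *m J x *m _ *m _) (y x *m c *m J x *m _ *m _) => C D'.
by apply/matrixP => a b; rewrite !mxE; ring.
Qed.

Lemma bilinear_entry m p (y1 y2 : 'rV[R]_m) (c : 'M[R]_m) (A B : 'M[R]_(m, p)) j :
  (y1 *m (c *m A) - y2 *m (c *m B)) 0 j =
  \sum_b \sum_a c a b * (y1 0 a * A b j - y2 0 a * B b j).
Proof.
rewrite !mulmxA [LHS]mxE [X in _ + X]mxE [X in X - _]mxE [X in _ - X]mxE -sumrB.
apply: eq_bigr => b _; rewrite mxE [X in _ - X * _]mxE !mulr_suml -sumrB.
by apply: eq_bigr => a _; ring.
Qed.

Lemma local_weak_zero (V : set 'rV[R]_n) (phi : 'rV[R]_n -> 'rV[R]_n) (c : 'M[R]_n) x0 rho u j k l :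
  open V -> V `<=` U ->
  (forall i : 'I_n, Ck V 2 (fun x => phi x 0 i)) -> c^T = c ->
  (forall x, V x -> jacobian phi x \in unitmx /\
        g x = (jacobian phi x)^T *m c *m jacobian phi x) ->
  0 < rho -> [set x | `|x - x0| <= 2 * (3 * rho)] `<=` V ->
  annihilator_form U g [set x | `|x - x0| <= 2 * rho] u ->
  rVintegral (weak_form j k l u) = 0.
Proof.
move=> Vo VU phiC cs HJ rho0 BV [uC u0 ug].
set J := jacobian phi in HJ.
set K := [set x | _] in u0.
have Kc : closed K by exact: closed_norm_ball.
have KB x : K x -> `|x - x0| < 3 * rho by rewrite /K /= => H; apply: le_lt_trans H _; lra.
have KV : K `<=` V by move=> x /KB H; apply: BV => /=; lra.
have JC : Ckmx V 1 J by move=> i s; under eq_fun do rewrite mxE; exact: Ck_partial (phiC i).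
(* [u] lies in the row space of c J, so [invmx (J x)] brings it into that of [c], where the constant
   [pinvmx c] solves for [y]; thus [y] is C^1 like [u] and [J]. *)
pose y x : 'rV[R]_n := u x *m invmx (J x) *m pinvmx c.
have y0 x : ~ K x -> y x = 0 by move=> /u0; rewrite /y => ->; rewrite !mul0mx.
have yC : Ckmx setT 1 y.
  move=> i s; apply: (Ck_zero_off Vo Kc KV).
    by move=> x /y0 ->; rewrite mxE.
  apply: (Ckmx_mul Vo (Ckmx_mul Vo _ (Ckmx_inv Vo _ JC)) (Ckmx_cst _ _ Vo)).
    by move=> a b; apply: Ck_subset (uC a b).
  by move=> x /HJ[].
have uE x : V x -> u x = y x *m c *m J x.
  move=> Vx; have [uJ gE] := HJ x Vx.
  rewrite /y mulmxKpV ?mulmxKV//.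
  have /submxP[d ->] := ug x (VU x Vx).
  by rewrite gE !mulmxA mulmxK// submxMl.
(* A global C^1 function with compact support that coincides with the entry of [J] near [K], as
   [rVintegral_curl] needs; [phi] itself has no global extension. *)
pose Pb b s x := J x b s * bump x0 (3 * rho) x.
have r3 : 0 < 3 * rho by lra.
have PC b s : Ck setT 1 (Pb b s).
  apply: (Ck_zero_off Vo (@closed_norm_ball _ _ x0 (2 * (3 * rho))) BV).
    by move=> x /negP; rewrite -ltNge => /ltW H; rewrite /Pb bump0// mulr0.
  apply: (Ck_mul Vo (JC b s)); apply: (@Ck_subset _ _ setT) => //; exact: Ck_bump.
pose M := `|x0| + 2 * (3 * rho).
have M0 : 0 <= M by rewrite /M addr_ge0//; lra.
have farM x : M <= `|x| -> 2 * (3 * rho) <= `|x - x0|.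
  have : `|x| <= `|x - x0| + `|x0| by rewrite -{1}(subrK x0 x); exact: ler_normD.
  by rewrite /M => ? ?; lra.
have ccP b s : cc M (Pb b s).
  split; first by move=> x; exact: Ck_cont (PC b s) _ I.
  by move=> x /farM H; rewrite /Pb bump0// mulr0.
have ccy a : cc M (fun x => y x 0 a).
  split; first by move=> x; exact: Ck_cont (yC 0 a) _ I.
  by move=> x /farM H; rewrite y0 ?mxE// => /KB; lra.
have z0 a : (0 : 'rV[R]_n) 0 a = 0 by rewrite mxE.
have E x : weak_form j k l u x = \sum_b \sum_a c a b *
   (drow l y x 0 a * partial k (Pb b j) x - drow k y x 0 a * partial l (Pb b j) x).
  have [Kx|Kx] := pselect (K x); last first.
    rewrite /weak_form !(drow_off _ Kc u0 Kx) (u0 _ Kx) !mul0mx subr0 addr0 mxE.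
    rewrite !(drow_off _ Kc y0 Kx) big1// => b _; rewrite big1// => a _.
    by rewrite z0; move: (partial _ _ _) (partial _ _ _) => A B; rewrite !mul0r subr0 mulr0.
  have Vx := KV _ Kx.
  have nV : \forall z \near x, u z = y z *m c *m J z.
    by apply: filterS (open_near Vo Vx) => z /uE.
  rewrite (weak_form_pullback j k l uC nV (fun k => is_derive_jacobian k phiC Vx)
            (fun k => is_derive_drow k x yC)
            (fun k => flat_christoffel gs gC adG k Vo VU phiC cs HJ Vx)).
  have PE b k' : partial k' (Pb b j) x = hess phi k' x b j.
    apply: is_derive_partial; apply: is_derive_near (is_derive_jacobian k' phiC Vx b j).
    have [d d0 Hd] : exists2 d, 0 < d & forall z, `|z - x| < d -> `|z - x0| <= 3 * rho.
      exists (3 * rho - `|x - x0|); first by rewrite subr_gt0 KB.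
      move=> z zx; have : `|z - x0| <= `|z - x| + `|x - x0|.
        by rewrite (_ : z - x0 = (z - x) + (x - x0)) ?ler_normD// addrA subrK.
      by lra.
    by apply/nbhs_epsP; exists d => // z /Hd H; rewrite /Pb bump1// mulr1.
  rewrite bilinear_entry; apply: eq_bigr => b _; apply: eq_bigr => a _; by rewrite !PE.
have E' x : weak_form j k l u x = \sum_b \sum_a c a b *
   (partial l (fun x => y x 0 a) x * partial k (Pb b j) x
    - partial k (fun x => y x 0 a) x * partial l (Pb b j) x).
  rewrite E; apply: eq_bigr => b _; apply: eq_bigr => a _; congr (_ * (_ * _ - _ * _)); by rewrite mxE.
rewrite (rVintegral_ext E').
have M1 : 0 <= M + 1 by lra.
have cck a b k1 k2 : cc (M + 1) (fun x => partial k1 (fun x => y x 0 a) x * partial k2 (Pb b j) x).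
  apply: cc_mul; last exact: cc_partial (PC b j) (ccP b j).
  by move=> x; exact: Ck_cont (Ck_partial k1 (yC 0 a)) _ I.
rewrite (rVintegral_sum _ M1); last first.
  by move=> b; apply: cc_sum => a; apply: cc_scale; apply: cc_sub.
rewrite big1// => b _; rewrite (rVintegral_sum _ M1); last first.
  by move=> a; apply: cc_scale; apply: cc_sub.
rewrite big1// => a _; rewrite (rVintegral_scale _ M1) ?(rVintegral_sub M1)//; last exact: cc_sub.
apply/eqP; rewrite mulf_eq0 subr_eq0; apply/orP; right; apply/eqP.
exact: (rVintegral_curl l k M0 (yC 0 a) (ccy a) (PC b j) (ccP b j)).
Qed.

End Local.

Section FlatWeak.
Variables (R : realType) (n : nat) (U : set 'rV[R]_n) (g : 'rV[R]_n -> 'M[R]_n).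
Variable Gam : 'I_n -> 'I_n -> 'I_n -> 'rV[R]_n -> R.
Variable r : nat.
Hypotheses (Uo : open U) (gs : symmetric_on U g) (gC : form_Ck U g r.+1).
Hypothesis adG : adapted_symbols U g r.+1 Gam.
Local Notation Gmx := (Gmx Gam).
Local Notation weak_form := (weak_form Gam).
Implicit Types u : 'rV[R]_n -> 'rV[R]_n.

Lemma row_form_add p (a a' b b' d d' : 'rV[R]_p) (A B C : 'M[R]_p) j :
  ((a + a') *m A - (b + b') *m B + (d + d') *m C) 0 j =
  (a *m A - b *m B + d *m C) 0 j + (a' *m A - b' *m B + d' *m C) 0 j.
Proof.
rewrite !mulmxDl; move: (a *m A) (a' *m A) (b *m B) (b' *m B) (d *m C) (d' *m C) => *.
by rewrite !mxE; ring.
Qed.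

Lemma weak_formD j k l u1 u2 x : Ckmx setT 1 u1 -> Ckmx setT 1 u2 ->
  weak_form j k l (fun x => u1 x + u2 x) x = weak_form j k l u1 x + weak_form j k l u2 x.
Proof.
move=> C1 C2.
have D k' : drow k' (fun x => u1 x + u2 x) x = drow k' u1 x + drow k' u2 x.
  apply/rowP => s; rewrite mxE [RHS]mxE; apply: is_derive_partial.
  apply: (is_derive_ext _ (is_derive_add (is_derive_drow k' x C1 0 s) (is_derive_drow k' x C2 0 s))).
  by move=> y; rewrite mxE.
by rewrite /weak_form !D row_form_add.
Qed.

Lemma compact_norm_bound (K : set 'rV[R]_n) : compact K -> exists2 M, 0 <= M & forall x, M <= `|x| -> ~ K x.
Proof.
move=> /compact_bounded [M [_ HM]]; exists (`|M| + 2); first by rewrite addr_ge0.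
move=> x Mx Kx; have := HM (`|M| + 1) _ x Kx.
rewrite (le_lt_trans (ler_norm M)) ?ltrDl// => /(_ isT) H.
by have := le_trans Mx H; rewrite lerD2l; lra.
Qed.

Lemma weak_form_cc K u j k l : compact K -> K `<=` U -> annihilator_form U g K u ->
  exists2 M, 0 <= M & cc M (weak_form j k l u).
Proof.
move=> Kc KU [uC u0 _]; have [M M0 HM] := compact_norm_bound Kc.
have Kcl : closed K by apply: compact_closed Kc; exact: norm_hausdorff.
have w0 x : ~ K x -> weak_form j k l u x = 0.
  move=> Kx; rewrite /weak_form !(drow_off _ Kcl u0 Kx) (u0 _ Kx) !mul0mx subr0 addr0.
  by rewrite mxE.
exists M => //; split; last by move=> x /HM /w0.
suff : Ck setT 0 (weak_form j k l u) by move=> H x; exact: Ck_cont H _ I.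
apply: (Ck_zero_off Uo Kcl KU w0).
have dC k' : Ckmx U 0 (drow k' u).
  move=> i s; under eq_fun do rewrite mxE.
  by apply: (@Ck_subset _ _ setT) => //; apply: Ck_partial; exact: (uC 0 s).
have GC k' : Ckmx U 0 (Gmx k').
  by move=> i s; under eq_fun do rewrite mxE; apply: (@Ck_le _ _ _ _ r) => //; case: adG.
have uC0 : Ckmx U 0 u.
  move=> i s; apply: (@Ck_subset _ _ setT) => //; apply: (@Ck_le _ _ _ _ 1) => //; exact: uC.
have GG k' l' := Ckmx_mul Uo (GC k') (GC l').
have H1 := Ckmx_mul Uo (dC l) (GC k) 0 j.
have H2 := Ckmx_mul Uo (dC k) (GC l) 0 j.
have H3 : Ckmx U 0 (fun x => Gmx k x *m Gmx l x - Gmx l x *m Gmx k x).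
  move=> a b; have := Ck_sub Uo (GG k l a b) (GG l k a b); apply: Ck_ext => // x _.
  by rewrite [RHS]mxE [X in _ = _ + X]mxE.
have H4 := Ckmx_mul Uo uC0 H3 0 j.
apply: Ck_ext (Ck_add Uo (Ck_sub Uo H1 H2) H4) => // x _.
by rewrite /weak_form [RHS]mxE [X in _ = X + _]mxE [X in _ = _ + X + _]mxE.
Qed.

(** The chart contains the support of the bump of radius [3 * rho], which is 1 near the ball of
    radius [2 * rho] carrying the forms. *)
Definition charted x0 rho := exists (V : set 'rV[R]_n) (phi : 'rV[R]_n -> 'rV[R]_n) (c : 'M[R]_n),
  [/\ open V, V `<=` U, [set x | `|x - x0| <= 2 * (3 * rho)] `<=` V,
   forall i : 'I_n, Ck V 2 (fun x => phi x 0 i)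
   & c^T = c /\ forall x, V x -> jacobian phi x \in unitmx /\
        g x = (jacobian phi x)^T *m c *m jacobian phi x].

Lemma annihilator_scale (K K' : set 'rV[R]_n) u (b : 'rV[R]_n -> R) : annihilator_form U g K u ->
  Ck setT 1 b -> (forall x, ~ K' x -> b x = 0) \/ K' = K ->
  annihilator_form U g K' (fun x => b x *: u x).
Proof.
move=> [uC u0 ug] bC H; split.
- move=> i s; under eq_fun do rewrite mxE.
  by apply: Ck_mul (uC i s); [exact: openT|].
- move=> x; case: H => [b0 /b0 ->|-> /u0 ->]; first by rewrite scale0r.
  by rewrite scaler0.
- by move=> x Ux; apply: scalemx_sub; exact: ug.
Qed.

(* Peels off the bump functions of a covering one at a time instead of building
   a partition of unity. *)
Lemma covered_weak_zero (L : seq ('rV[R]_n * R)) K u j k l : compact K -> K `<=` U ->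
  (forall q, q \in L -> 0 < q.2 /\ charted q.1 q.2) ->
  annihilator_form U g K u ->
  (forall x, u x != 0 -> exists2 q, q \in L & `|x - q.1| < q.2) ->
  rVintegral (weak_form j k l u) = 0.
Proof.
move=> Kc KU; elim: L u => [|[x1 rho] L IH] u HL uA Hu.
  have u0 x : u x = 0 by apply/eqP/negPn/negP => /Hu[].
  rewrite -[RHS](rVintegral0 R n); apply: rVintegral_ext => x.
  have d0 k' : drow k' u x = 0 by apply: (drow_off (K := set0)) => //; exact: closed0.
  by rewrite /weak_form !d0 u0 !mul0mx subr0 addr0 mxE.
have [rho0 [V [phi [c [Vo VU BV phiC [cs HJ]]]]]] := HL (x1, rho) (mem_head _ _).
rewrite /= in rho0 BV.
pose b := bump x1 rho.
have bC : Ck setT 1 b by exact: Ck_bump.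
have b'C : Ck setT 1 (fun x => 1 - b x).
  by apply: (Ck_sub _ _ bC); [exact: openT|apply: Ck_cst; exact: openT].
have A1 := annihilator_scale uA b'C (or_intror erefl).
have A2 : annihilator_form U g [set x | `|x - x1| <= 2 * rho] (fun x => b x *: u x).
  apply: annihilator_scale uA bC _; left => x /negP; rewrite -ltNge => /ltW.
  exact: bump0.
have A3 := annihilator_scale uA bC (or_intror erefl).
(* The second part is supported in the chart of [x1]. The first vanishes on the ball of radius [rho]
   about [x1], so the remaining balls cover it. *)
have -> : weak_form j k l u = weak_form j k l (fun x => (1 - b x) *: u x + b x *: u x).
  by congr (weak_form j k l); apply/funext => x; rewrite -scalerDl subrK scale1r.
have [M1 M10 c1] := weak_form_cc j k l Kc KU A1.
have [M2 M20 c2] := weak_form_cc j k l Kc KU A3.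
have E x := @weak_formD j k l _ _ x (let: And3 h _ _ := A1 in h) (let: And3 h _ _ := A3 in h).
rewrite (rVintegral_ext E) (rVintegral_add (M := Num.max M1 M2)).
- rewrite (local_weak_zero gs gC adG j k l Vo VU phiC cs HJ rho0 BV A2) addr0.
  apply: IH A1 _ => [q qL|x]; first by apply: HL; rewrite in_cons qL orbT.
  rewrite scaler_eq0 negb_or => /andP[bx /Hu[q]].
  rewrite in_cons => /orP[/eqP->/= /ltW xq|qL xq]; last by exists q.
  by move: bx; rewrite /b bump1// subrr eqxx.
- by rewrite le_max M10.
- by apply: cc_le c1; rewrite le_max lexx.
- by apply: cc_le c2; rewrite le_max lexx orbT.
Qed.

Lemma flat_weak : has_flat_coordinates U g r.+2 -> weak_curvature_zero U g Gam.
Proof.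
move=> Hf; have [_ GS _] := adG; apply/(weakP Uo gs GS) => K u j k l Kc KU uA.
have := Kc; rewrite compact_cover.
move=> /(_ _ [set q : 'rV[R]_n * R | 0 < q.2 /\ charted q.1 q.2] (fun q => [set x | `|x - q.1| < q.2])).
case.
- by move=> q _; exact: open_norm_ball.
- move=> x Kx; have [V [phi [c [Vo Vx VU phiC HJ]]]] := flat_chart gs Hf (KU x Kx).
  have /nbhs_epsP[s s0 Hs] := open_near Vo Vx.
  (* [charted] needs the closed ball of six times this radius inside the open ball of radius [s]. *)
  exists (x, s / 7); last by rewrite /= subrr normr0 divr_gt0.
  split => /=; first by rewrite divr_gt0.
  exists V, phi, c; split => //; last by move=> i; apply: Ck_le (phiC i).
  by move=> y /= yx; apply: Hs; apply: le_lt_trans yx _; lra.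
move=> D DD cov; apply: (covered_weak_zero (L := finmap.enum_fset D)) (uA) _ => //.
  by move=> q /DD; rewrite inE.
move=> x ux; have Kx : K x by apply: contrapT => Kx; case: uA => _ /(_ x Kx) E; rewrite E eqxx in ux.
by have [q qD xq] := cov x Kx; exists q.
Qed.

End FlatWeak.

(** * The weak and the strong condition *)

Section WeakStrong.
Variables (R : realType) (n : nat) (U : set 'rV[R]_n) (g : 'rV[R]_n -> 'M[R]_n).
Variable Gam : 'I_n -> 'I_n -> 'I_n -> 'rV[R]_n -> R.
Variable r : nat.
Hypotheses (Uo : open U) (gs : symmetric_on U g) (gC : form_Ck U g r.+2).
Hypothesis adG : adapted_symbols U g r.+2 Gam.
Local Notation Gmx := (Gmx Gam).
Local Notation weak_form := (weak_form Gam).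
Implicit Types u : 'rV[R]_n -> 'rV[R]_n.

Definition riemann j k l s x : R :=
  partial k (Gam s j l) x - partial l (Gam s j k) x
     + \sum_a (Gam s k a x * Gam a l j x - Gam s l a x * Gam a j k x).

Let GC s j k : Ck U r.+1 (Gam s j k). Proof. by case: adG. Qed.
Let GC1 s j k : Ck U 1 (Gam s j k). Proof. exact: Ck_le (GC s j k). Qed.

(** Integration by parts at the level of integrands: the two extra sums have integral zero. *)
Lemma weak_form_divergence K u j k l x : compact K -> K `<=` U -> annihilator_form U g K u ->
  \sum_s u x 0 s * riemann j k l s x =
  weak_form j k l u x + (\sum_s partial k (fun y => u y 0 s * Gam s j l y) x
     - \sum_s partial l (fun y => u y 0 s * Gam s j k y) x).
Proof.
move=> Kc KU [uC u0 _]; have [_ GS _] := adG.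
have Kcl : closed K by apply: compact_closed Kc; exact: norm_hausdorff.
rewrite (weak_formE j k l x Kcl KU u0 GS) -sumrB -big_split/=; apply: eq_bigr => s _.
have [Kx|Kx] := pselect (K x); last first.
  have z0 : u x 0 s = 0 by rewrite u0// mxE.
  have near0 (F : 'rV[R]_n -> R) m : (forall y, ~ K y -> F y = 0) -> partial m F x = 0.
    move=> F0; apply: is_derive_partial; apply: is_derive_near (is_derive_const x (bas m) (0 : R)).
    by apply: filterS (open_near (closed_openC Kcl) Kx) => y /F0 ->.
  have us0 y : ~ K y -> u y 0 s = 0 by move=> /u0 ->; rewrite mxE.
  rewrite z0 !near0 => [|y /us0 ->|y /us0 ->||]//; rewrite ?mul0r//.
  by rewrite !mulr0 subrr !addr0.
have Ux := KU _ Kx.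
have P m m' : partial m (fun y => u y 0 s * Gam s j m' y) x
   = partial m (fun y => u y 0 s) x * Gam s j m' x + u x 0 s * partial m (Gam s j m') x.
  have D1 := @Ck_deriv _ _ _ _ _ (uC 0 s) m x I.
  have D2 := Ck_deriv (GC1 s j m') m Ux.
  exact: is_derive_partial (is_derive_mul D1 D2).
rewrite /riemann !P.
move: (partial _ _ _) (partial _ _ _) (partial _ _ _) (partial _ _ _) (\sum_a _) (u x 0 s) => A B C D S v.
move: (Gam _ _ _ _) (Gam _ _ _ _) => E F.
ring.
Qed.

Lemma weak_riemann K u j k l : compact K -> K `<=` U -> annihilator_form U g K u ->
  rVintegral (weak_form j k l u) = rVintegral (fun x => \sum_s u x 0 s * riemann j k l s x).
Proof.
move=> Kc KU uA; have [M M0 cM] := weak_form_cc Uo adG j k l Kc KU uA.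
rewrite (rVintegral_ext (fun x => weak_form_divergence j k l x Kc KU uA)).
have [N N0 HN] := compact_norm_bound Kc.
have Kcl : closed K by apply: compact_closed Kc; exact: norm_hausdorff.
case: (uA) => uC u0 _.
have FC s m : Ck setT 1 (fun y => u y 0 s * Gam s j m y).
  apply: (Ck_zero_off Uo Kcl KU) => [x /u0 ->|]; first by rewrite mxE mul0r.
  by apply: Ck_mul (GC1 s j m) => //; apply: (@Ck_subset _ _ setT) => //; exact: uC.
have Fc s m : cc N (fun y => u y 0 s * Gam s j m y).
  split=> [x|x /HN /u0 ->]; first exact: Ck_cont (FC s m) _ I.
  by rewrite mxE mul0r.
have pc s m m' : cc (N + 1) (partial m' (fun y => u y 0 s * Gam s j m y)) by exact: cc_partial.
have N1 : 0 <= N + 1 by rewrite addr_ge0.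
have z m m' : rVintegral (fun x => \sum_s partial m' (fun y => u y 0 s * Gam s j m y) x) = 0.
  rewrite (rVintegral_sum _ N1) ?big1// => s _; exact: rVintegral_partial N0 (FC s m) (Fc s m).
have cS m m' : cc (N + 1) (fun x => \sum_s partial m' (fun y => u y 0 s * Gam s j m y) x).
  by apply: cc_sum => s.
rewrite (rVintegral_add (M := Num.max M (N + 1))).
- by rewrite (rVintegral_sub N1)// !z subrr addr0.
- by rewrite le_max M0.
- by apply: cc_le cM; rewrite le_max lexx.
- by apply: (cc_le (M := N + 1)); [rewrite le_max lexx orbT|exact: cc_sub].
Qed.

Lemma weak_strong : weak_curvature_zero U g Gam <->
  forall i j k l x, U x -> curvature g Gam i j k l x = 0.
Proof.
have [_ GS _] := adG; split.
  move=> /(weakP Uo gs GS) H i j k l x Ux.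
  apply: (@bump_fundamental _ _ U (fun x => \sum_s g x i s * riemann j k l s x)) => // [y Uy|rho rho0 BU].
    suff HC : Ck U 0 (fun x => \sum_s g x i s * riemann j k l s x) by exact: Ck_cont HC _ Uy.
    apply: Ck_sum => // s _; apply: Ck_mul => //; first exact: Ck_le (gC i s).
    apply: Ck_add => //.
      by apply: Ck_sub => //; apply: Ck_partial; exact: GC1.
    by apply: Ck_sum => // a _; apply: Ck_sub => //; apply: Ck_mul => //; apply: Ck_le (GC1 _ _ _).
  (* A row of [g] annihilates the radical, and pairing it with the curvature is exactly lowering the
     index [s]. *)
  pose u y := bump x rho y *: row i (g y).
  have uA : annihilator_form U g [set y | `|y - x| <= 2 * rho] u.
    split.
    - move=> a s; apply: (Ck_zero_off Uo (@closed_norm_ball _ _ x (2 * rho)) BU).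
        by move=> y /negP; rewrite -ltNge => /ltW H0; rewrite mxE bump0 ?mul0r.
      under eq_fun do rewrite 2!mxE.
      apply: Ck_mul => //; last exact: Ck_le (gC i s).
      by apply: (@Ck_subset _ _ setT) => //; exact: Ck_bump.
    - by move=> y /negP; rewrite -ltNge => /ltW H0; rewrite /u bump0 ?scale0r.
    - by move=> y Uy; rewrite scalemx_sub// row_sub.
  have cB := @compact_norm_ball _ _ x (2 * rho).
  apply: (etrans _ (H _ u j k l cB BU uA)); rewrite (weak_riemann j k l cB BU uA).
  apply: rVintegral_ext => y; rewrite mulr_suml; apply: eq_bigr => s _.
  rewrite /u mxE [row _ _ _ _]mxE; ring.
move=> H; apply/(weakP Uo gs GS) => K u j k l Kc KU uA.
rewrite (weak_riemann j k l Kc KU uA) -[RHS](rVintegral0 R n); apply: rVintegral_ext => x.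
case: uA => _ u0 ug.
have [Kx|/u0 ->] := pselect (K x); last by rewrite big1// => s _; rewrite mxE mul0r.
(* Conversely a test form is a combination of rows of [g], so its pairing with the curvature is a
   combination of the vanishing lowered components. *)
have /submxP[d ->] := ug x (KU _ Kx).
under eq_bigr do rewrite mxE mulr_suml.
rewrite exchange_big big1//= => i _.
under eq_bigr do rewrite -mulrA.
by rewrite -mulr_sumr; have := H i j k l x (KU _ Kx); rewrite /curvature => ->; rewrite mulr0.
Qed.

End WeakStrong.

(** * From zero curvature to flat coordinates *)

Section LocalFrame.
Variables (R : realType) (n : nat) (U : set 'rV[R]_n) (g : 'rV[R]_n -> 'M[R]_n).
Variable Gam : 'I_n -> 'I_n -> 'I_n -> 'rV[R]_n -> R.
Variable r : nat.
Hypotheses (Uo : open U) (gs : symmetric_on U g) (gC : form_Ck U g r.+1).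
Hypothesis adG : adapted_symbols U g r.+1 Gam.
Variables (m : nat) (f : 'I_m -> 'I_n) (B : set 'rV[R]_n).
Hypotheses (Bo : open B) (BU : B `<=` U).
Hypothesis gm : forall x, U x -> \rank (g x) = m.
Hypothesis fu : forall x, B x -> mxsub f f (g x) \in unitmx.
Local Notation Gmx := (Gmx Gam).
Local Notation weak_form := (weak_form Gam).
Implicit Types (x : 'rV[R]_n).

(* [g = Lf Gf Lf^T] and [d_k Lf = Gmx_k^T Lf - Lf Nf_k] on [B]. *)
Definition Gf x : 'M[R]_m := mxsub f f (g x).
Definition Lf x : 'M[R]_(n, m) := colsub f (g x) *m invmx (Gf x).
Definition Nf k x : 'M[R]_m := rowsub f (Gmx k x)^T *m Lf x.

Lemma LfG x : B x -> Lf x *m Gf x = colsub f (g x).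
Proof. by move=> Bx; rewrite /Lf mulmxKV//; exact: fu. Qed.

Lemma rowsub_Lf x : B x -> rowsub f (Lf x) = 1%:M.
Proof.
move=> Bx; rewrite /Lf -mul_rowsub_mx -mxsub_comp /= mulmxV//; exact: fu.
Qed.

Lemma Lf_rowsub x : B x -> Lf x *m rowsub f (g x) = g x.
Proof. by move=> Bx; apply: skeleton; [apply: gm; exact: BU|exact: fu]. Qed.

Lemma Gf_sym x : B x -> (Gf x)^T = Gf x.
Proof. by move=> /BU Ux; rewrite /Gf trmx_mxsub gs. Qed.

Lemma rowsub_g x : B x -> rowsub f (g x) = Gf x *m (Lf x)^T.
Proof.
move=> Bx; rewrite -[RHS]trmxK trmx_mul trmxK (Gf_sym Bx) (LfG Bx) trmx_mxsub.
by rewrite (gs (BU Bx)).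
Qed.

Lemma g_factor x : B x -> g x = Lf x *m Gf x *m (Lf x)^T.
Proof. by move=> Bx; rewrite -mulmxA -rowsub_g// Lf_rowsub. Qed.

Lemma Ckmx_Gf : Ckmx B r.+1 Gf.
Proof. by apply: Ckmx_sub => i j; apply: Ck_subset (gC i j). Qed.

Lemma Ckmx_Lf : Ckmx B r.+1 Lf.
Proof.
apply: Ckmx_mul => //; last by apply: Ckmx_inv => //; exact: Ckmx_Gf.
by apply: Ckmx_sub => i j; apply: Ck_subset (gC i j).
Qed.

Lemma Ckmx_Gmx k : Ckmx U r (Gmx k).
Proof. by move=> i s; under eq_fun do rewrite mxE; case: adG. Qed.

Lemma Ckmx_Nf k : Ckmx B r (Nf k).
Proof.
apply: Ckmx_mul => //; last by move=> i j; apply: CkS; exact: Ckmx_Lf.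
by apply: Ckmx_sub; apply: Ckmx_tr => i j; apply: Ck_subset (Ckmx_Gmx k i j).
Qed.

Lemma rowsub_trC x k : B x -> (Lf x)^T *m colsub f (Gmx k x) = (Nf k x)^T.
Proof. by move=> Bx; rewrite [in RHS]/Nf [in RHS]trmx_mul [in RHS]trmx_mxsub trmxK. Qed.

Lemma rowsub_mul2 p q s (A : 'M[R]_(n, p)) (P : 'M[R]_(p, q)) (Q : 'M[R]_(q, s)) :
  rowsub f (A *m P *m Q) = rowsub f A *m P *m Q.
Proof. by rewrite -!mul_rowsub_mx. Qed.

Lemma dcolsub_g x k : B x -> is_derive_mx x (bas k) (fun y => colsub f (g y))
  (Lf x *m Gf x *m (Nf k x)^T + (Gmx k x)^T *m Lf x *m Gf x).
Proof.
move=> Bx; have D := is_derive_mxsub id f (adapted_metric gs gC adG k (BU Bx)).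
suff <- : colsub f (g x *m Gmx k x + (Gmx k x)^T *m g x) =
   Lf x *m Gf x *m (Nf k x)^T + (Gmx k x)^T *m Lf x *m Gf x by [].
rewrite -rowsub_trC// linearD /= -!mulmx_colsub -(LfG Bx) !mulmxA.
by rewrite {1}(g_factor Bx).
Qed.

Lemma dGf x k : B x -> is_derive_mx x (bas k) Gf (Gf x *m (Nf k x)^T + Nf k x *m Gf x).
Proof.
move=> Bx; have := is_derive_mxsub f id (dcolsub_g k Bx).
rewrite linearD /= !rowsub_mul2 (rowsub_Lf Bx) mul1mx -/(Nf k x).
move=> H a b; apply: (is_derive_ext _ (H a b)) => y; by rewrite /Gf -mxsub_comp.
Qed.

Lemma frame_algebra (D L : 'M[R]_(n, m)) (G N N' : 'M[R]_m) (A : 'M[R]_n) : G \in unitmx ->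
  D *m G + L *m (G *m N' + N *m G) = L *m G *m N' + A *m L *m G -> D = A *m L - L *m N.
Proof.
move=> uG; rewrite mulmxDr !mulmxA => E.
rewrite -[LHS](mulmxK uG) -[RHS](mulmxK uG); congr (_ *m _); rewrite mulmxBl.
move: (D *m _) (L *m G *m _) (L *m N *m _) (A *m L *m _) E => X1 X2 X3 X4 E.
by rewrite -(addrK (X2 + X3) X1) E opprD addrA [X2 + X4]addrC addrK.
Qed.

(** Differentiate [LfG]: the derivatives of [colsub f g] and of [Gf] are known from the metric
    equation, and [Gf] can be cancelled on the right. *)
Lemma dLf x k : B x -> is_derive_mx x (bas k) Lf ((Gmx k x)^T *m Lf x - Lf x *m Nf k x).
Proof.
move=> Bx.
pose D := \matrix_(i, a) partial k (fun y => Lf y i a) x.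
have HD : is_derive_mx x (bas k) Lf D.
  move=> i a; rewrite [D i a]mxE.
  have H0 := Ckmx_Lf i a. have H1 := Ck_deriv H0 k Bx. exact: H1.
suff <- : D = (Gmx k x)^T *m Lf x - Lf x *m Nf k x by [].
have H : is_derive_mx x (bas k) (fun y => colsub f (g y)) (D *m Gf x + Lf x *m (Gf x *m (Nf k x)^T + Nf k x *m Gf x)).
  apply: is_derive_mx_near (is_derive_mx_mul HD (dGf k Bx)).
  by apply: filterS (open_near Bo Bx) => y /LfG.
have E := is_derive_mx_unique H (dcolsub_g k Bx).
by apply: frame_algebra E; exact: fu.
Qed.

Lemma dLfT x k : B x -> is_derive_mx x (bas k) (fun y => (Lf y)^T)
  ((Lf x)^T *m Gmx k x - (Nf k x)^T *m (Lf x)^T).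
Proof.
move=> Bx; have := is_derive_mx_tr (dLf k Bx).
by rewrite linearB /= !trmx_mul trmxK.
Qed.

(* The columns of [Lf] span the annihilator of the radical, so that multiplied
   by a function they are the test forms. *)
Lemma frame_annihilator (K : set 'rV[R]_n) chi a : closed K -> K `<=` B -> Ck setT 1 chi ->
  (forall x, ~ K x -> chi x = 0) ->
  annihilator_form U g K (fun x => chi x *: row a (Lf x)^T) /\
  forall x, B x -> (row a (Lf x)^T <= g x)%MS.
Proof.
move=> Kc KB chiC chi0.
have Lg x : B x -> (row a (Lf x)^T <= g x)%MS.
  move=> Bx; apply: submx_trans (row_sub _ _) _.
  have uG : Gf x \in unitmx by exact: fu.
  have -> : (Lf x)^T = invmx (Gf x) *m rowsub f (g x) by rewrite (rowsub_g Bx) mulKmx.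
  by apply: submx_trans (submxMl _ _) (rowsub_sub _ _).
split=> //; split.
- move=> i s; apply: (Ck_zero_off Bo Kc KB).
    by move=> x /chi0 E; rewrite mxE E mul0r.
  under eq_fun do rewrite mxE.
  apply: Ck_mul => //; first by apply: (@Ck_subset _ _ setT).
  have := Ckmx_Lf s a; under eq_fun do rewrite -(trmxK (Lf _)) mxE.
  by move=> H; under eq_fun do rewrite mxE; apply: Ck_le H.
- by move=> x /chi0 E; rewrite E scale0r.
move=> x Ux; have [Kx|/chi0 ->] := pselect (K x); last by rewrite scale0r sub0mx.
by rewrite scalemx_sub// Lg//; exact: KB.
Qed.

(** Products of two matrices Gamma cancel as in a curvature computation; restricting to the columns
    [f] turns each remaining [LT *m Gk] into [Nk^T]. *)
Lemma frame_form_algebra (LT : 'M[R]_(m, n)) (Gk Gl : 'M[R]_n) (Nk Nl : 'M[R]_m) (c ck cl : R) :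
  LT *m colsub f Gk = Nk^T -> LT *m colsub f Gl = Nl^T ->
  colsub f ((cl *: LT + c *: (LT *m Gl - Nl^T *m LT)) *m Gk
    - (ck *: LT + c *: (LT *m Gk - Nk^T *m LT)) *m Gl
    + (c *: LT) *m (Gk *m Gl - Gl *m Gk))
  = cl *: Nk^T - ck *: Nl^T + c *: (Nl *m Nk - Nk *m Nl)^T.
Proof.
move=> Hk Hl.
have -> : (cl *: LT + c *: (LT *m Gl - Nl^T *m LT)) *m Gk
    - (ck *: LT + c *: (LT *m Gk - Nk^T *m LT)) *m Gl + (c *: LT) *m (Gk *m Gl - Gl *m Gk)
    = cl *: (LT *m Gk) - ck *: (LT *m Gl) + c *: (Nk^T *m (LT *m Gl) - Nl^T *m (LT *m Gk)).
  rewrite !mulmxDl -!scalemxAl !mulmxBl mulmxBr !mulmxA.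
  move: (LT *m Gk *m Gl) (LT *m Gl *m Gk) (Nl^T *m LT *m Gk) (Nk^T *m LT *m Gl) => A1 A2 A3 A4.
  move: (LT *m Gk) (LT *m Gl) => A5 A6.
  by apply/matrixP => i j; rewrite !mxE; ring.
rewrite linearD linearB /= !linearZ /= linearB /= -!mulmx_colsub Hk Hl.
by congr (_ + _ *: _); rewrite linearB /= !trmx_mul.
Qed.

(** Tested on the cut-off column [a] of [Lf], and read at the index [f b], the weak condition is the
    distributional flatness of entry [(b, a)] of [Nf]. *)
Lemma frame_weak_form (K : set 'rV[R]_n) chi k l b a x : closed K -> K `<=` B -> Ck setT 1 chi ->
  (forall x, ~ K x -> chi x = 0) -> B x ->
  weak_form (f b) k l (fun x => chi x *: row a (Lf x)^T) x =
  - (Nf l x b a * partial k chi x) + Nf k x b a * partial l chi x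
  + chi x * form_bracket Nf k l x b a.
Proof.
move=> Kc KB chiC chi0 Bx; have [[uC _ _] _] := frame_annihilator a Kc KB chiC chi0.
pose P k' := partial k' chi x *: (Lf x)^T + chi x *: ((Lf x)^T *m Gmx k' x - (Nf k' x)^T *m (Lf x)^T).
have D k' : drow k' (fun x => chi x *: row a (Lf x)^T) x = row a (P k').
  apply: is_derive_mx_unique (is_derive_drow k' x uC) _.
  have := is_derive_mx_row a (is_derive_mx_smul (@Ck_deriv _ _ _ _ _ chiC k' x I) (dLfT k' Bx)).
  by congr is_derive_mx; apply/funext => y; rewrite linearZ.
have E : weak_form (f b) k l (fun x => chi x *: row a (Lf x)^T) x =
  colsub f (P l *m Gmx k x - P k *m Gmx l x
     + (chi x *: (Lf x)^T) *m (Gmx k x *m Gmx l x - Gmx l x *m Gmx k x)) a b.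
  rewrite /weak_form !D -linearZ -!row_mul -linearB -linearD /=.
  by rewrite [LHS]mxE [RHS]mxE.
rewrite E (frame_form_algebra _ _ _ (rowsub_trC k Bx) (rowsub_trC l Bx)) /form_bracket.
move: (Nf l x *m Nf k x - _) => A.
move: (Nf k x) (Nf l x) => Nk Nl; rewrite !mxE; ring.
Qed.

End LocalFrame.

Section Backward.
Variables (R : realType) (n : nat) (U : set 'rV[R]_n) (g : 'rV[R]_n -> 'M[R]_n).
Variable Gam : 'I_n -> 'I_n -> 'I_n -> 'rV[R]_n -> R.
Variable r : nat.
Hypotheses (Uo : open U) (gs : symmetric_on U g) (gC : form_Ck U g r.+1).
Hypothesis adG : adapted_symbols U g r.+1 Gam.
Hypothesis weak0 : weak_curvature_zero U g Gam.
Variables (m : nat) (f : 'I_m -> 'I_n) (p : 'rV[R]_n) (rho : R).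
Local Notation B := [set x | `|x - p| < rho].
Hypotheses (rho0 : 0 < rho) (BU : B `<=` U).
Hypothesis gm : forall x, U x -> \rank (g x) = m.
Hypothesis fu : forall x, B x -> mxsub f f (g x) \in unitmx.
Local Notation Gmx := (Gmx Gam).
Local Notation Lf := (Lf g f).
Local Notation Nf := (Nf g Gam f).
Local Notation Gf := (Gf g f).
Implicit Types (x : 'rV[R]_n).

Lemma flat_frame : exists (sigma : R) (Z : 'rV[R]_n -> 'M[R]_m),
  [/\ 0 < sigma, sigma <= rho, Z p = 1%:M, Ckmx [set x | `|x - p| < sigma] r.+1 Z
    & forall x k, `|x - p| < sigma -> is_derive_mx x (bas k) Z (Nf k x *m Z x)].
Proof.
have Bo : open B := @open_norm_ball _ _ p rho.
have [_ GS _] := adG.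
pose d := rho / 3; have d0 : 0 < d by rewrite divr_gt0.
have dB : [set x | `|x - p| <= 2 * d] `<=` B by move=> x /= H; apply: le_lt_trans H _; rewrite /d; move: rho0; lra.
pose K := [set x | `|x - p| <= d].
have KB : K `<=` B by move=> x; rewrite /K /= => H; apply: dB => /=; move: d0 H; lra.
have Kcl : closed K by exact: closed_norm_ball.
(* [parallel_frame] wants a global compactly supported connection. It is flat only on [K], where the
   bump is 1, and the functions [chi] are supported there. *)
pose N k x := bump p d x *: Nf k x.
have NE k x : K x -> N k x = Nf k x by move=> Kx; rewrite /N bump1// scale1r.
have NC k : Ckmx B r (Nf k) := Ckmx_Nf gC adG Bo BU fu k.
have M0 : 0 <= `|p| + 2 * d by rewrite addr_ge0//; lra.
have cN : ccmx (`|p| + 2 * d) N.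
  move=> k a b; have := cc_mul_bump Bo d0 dB (fun x Bx => Ck_cont (NC k a b) Bx).
  by congr cc; apply/funext => x; rewrite [RHS]mxE mulrC.
have [|sigma [Z [s0 Zp Zc DZ]]] := @parallel_frame _ _ _ p _ d N M0 d0 cN.
  move=> k l a b chi chiC chi0.
  have chi0' x : ~ K x -> chi x = 0.
    by move=> /negP; rewrite -ltNge => /ltW; exact: chi0.
  have [uA _] := frame_annihilator gs gC Bo BU fu b Kcl KB chiC chi0'.
  have := (weakP Uo gs GS).1 weak0 K _ (f a) k l (@compact_norm_ball _ _ p d) (subset_trans KB BU) uA.
  apply: etrans; apply: rVintegral_ext => x.
  have [Kx|Kx] := pselect (K x).
    by rewrite (frame_weak_form gs gC adG Bo BU gm fu k l a b Kcl KB chiC chi0' (KB _ Kx)) /form_bracket !NE.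
  have [_ u0 _] := uA.
  rewrite /weak_form !(drow_off _ Kcl u0 Kx) (u0 _ Kx) !mul0mx subr0 addr0 [RHS]mxE.
  have near0 k' : partial k' chi x = 0.
    apply: is_derive_partial; apply: is_derive_near (is_derive_const x (bas k') (0 : R)).
    by apply: filterS (open_near (closed_openC Kcl) Kx) => y /chi0' ->.
  by rewrite !near0 (chi0' _ Kx) !mulr0 mul0r oppr0 !addr0.
pose s := Num.min sigma d.
have s1 : s <= sigma by rewrite ge_min lexx.
have s2 : s <= d by rewrite ge_min lexx orbT.
have sB : [set x | `|x - p| < s] `<=` B.
  by move=> x /= H; apply: KB => /=; apply: ltW; exact: lt_le_trans H _.
have DZs x k : `|x - p| < s -> is_derive_mx x (bas k) Z (Nf k x *m Z x).
  move=> xs; rewrite -NE; first by apply: DZ; exact: lt_le_trans xs _.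
  by apply: ltW; exact: lt_le_trans xs _.
exists s, Z; split => //.
- by rewrite lt_min s0.
- by apply: le_trans s2 _; rewrite /d; move: rho0; lra.
have so := @open_norm_ball _ _ p s.
(* Bootstrap: [Z] gains one derivative at a time from its equation, up to one more than [Nf] has. *)
suff H j : (j <= r.+1)%N -> Ckmx [set x | `|x - p| < s] j Z by exact: H.
elim: j => [|j IH] jr a b; first by apply: Ck0 => x _; exact: Zc.
apply: (@Ck_build _ _ _ _ _ (fun k x => (Nf k x *m Z x) a b)) => //.
  by move=> x k xs; exact: DZs.
move=> k; apply: Ckmx_mul => //; last by apply: IH; exact: ltnW.
by move=> u v; apply: (Ck_le (k := r)) => //; apply: Ck_subset (NC k u v).
Qed.

End Backward.

(** * Closed one-forms and homogeneous linear equations *)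

Section Poincare.
Variables (R : realType) (n : nat) (p : 'rV[R]_n).

Lemma poincare (sigma : R) (A : 'I_n -> 'rV[R]_n -> R) : 0 < sigma ->
  (forall i, Ck [set x | `|x - p| < sigma] 1 (A i)) ->
  (forall i k x, `|x - p| < sigma -> partial k (A i) x = partial i (A k) x) ->
  exists phi : 'rV[R]_n -> R, forall x k, `|x - p| < sigma / 4 -> is_derive x (bas k) phi (A k x).
Proof.
move=> s0 AC AS; pose d := sigma / 4; have d0 : 0 < d by rewrite divr_gt0.
set B := [set x | _] in AC.
have Bo : open B by exact: open_norm_ball.
have dB : [set x | `|x - p| <= 2 * d] `<=` B.
  by move=> x; rewrite /B /= => H; apply: le_lt_trans H _; rewrite /d; move: s0; lra.
pose A' i x := A i x * bump p d x.
have cA' i : cc (`|p| + 2 * d) (A' i).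
  by apply: (cc_mul_bump Bo d0 dB) => x Bx; exact: Ck_cont (AC i) _ Bx.
have CA' i : Ck setT 1 (A' i).
  apply: (Ck_zero_off Bo (@closed_norm_ball _ _ p (2 * d)) dB).
    by move=> x /negP; rewrite -ltNge => /ltW H; rewrite /A' bump0// mulr0.
  by apply: (Ck_mul Bo (AC i)); apply: (@Ck_subset _ _ setT) => //; exact: Ck_bump.
have dd x : `|x - p| < d -> B x by move=> xd; apply: dB => /=; move: xd (normr_ge0 (x - p)); lra.
have bE x : `|x - p| < d -> \forall y \near x, forall i, A i y = A' i y.
  move=> xd; apply: filterS (open_near (@open_norm_ball _ _ p d) xd) => y /= yd i.
  by rewrite /A' bump1 ?mulr1// ltW.
have pE i k x : `|x - p| < d -> partial k (A' i) x = partial k (A i) x.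
  move=> xd; apply: is_derive_partial; apply: is_derive_near (Ck_deriv (AC i) k (dd _ xd)).
  by apply: filterS (bE x xd) => y; apply.
exists (radial1 p A') => x k xd.
have := @partial_radial1_C1 _ _ p _ d A' (fun _ _ => 0) k x CA' cA' (fun i => cc0 _ _).
have -> : radialt p (fun _ _ => 0) x = 0.
  transitivity (\int[@lebesgue_measure R]_(t in `[0, 1]) (0 : R)); last first.
    by rewrite int_cst// mul0r.
  by apply: eq_Rintegral => t _; rewrite big1 ?mulr0// => i _; rewrite mul0r.
have E : A' k x = A k x by rewrite /A' bump1 ?mulr1//; exact: ltW.
rewrite subr0 E.
apply => // i y yd; rewrite !pE// AS ?subrr ?oppr0//; exact: dd.
Qed.

(** On each ray from [p] this is a linear differential equation with zero initial value and no
    source, so [small_gronwall] with [eta = 0] applies. *)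
Lemma transport_zero m (sigma : R) (S : 'rV[R]_n -> 'M[R]_m) (N : 'I_n -> 'rV[R]_n -> 'M[R]_m) :
  0 < sigma -> Ckmx [set x | `|x - p| < sigma] 1 S -> S p = 0 ->
  (forall k a b, {for p, continuous (fun x => N k x a b)}) ->
  (forall x k, `|x - p| < sigma -> is_derive_mx x (bas k) S (N k x *m S x + S x *m (N k x)^T)) ->
  exists2 tau, 0 < tau <= sigma & forall x, `|x - p| < tau -> S x = 0.
Proof.
move=> s0 SC Sp cN DS; set B := [set x | _] in SC.
have Bo : open B by exact: open_norm_ball.
pose C := 1 + \sum_k `|N k p|.
have C0 : 0 <= C by rewrite addr_ge0// sumr_ge0.
have [r1 r10 Hr1] : exists2 r, 0 < r & forall y : 'rV[R]_n, `|y - p| < r ->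
    forall i : 'I_n * ('I_m * 'I_m), `|N i.1 y i.2.1 i.2.2| <= C.
  apply: (@common_radius R _ _ (fun y : 'rV[R]_n => `|y - p|)
    (fun (i : 'I_n * ('I_m * 'I_m)) y => `|N i.1 y i.2.1 i.2.2| <= C)) => -[k [a b]] /=.
  have /continuous_epsP/(_ 1 ltr01)[r r0 Hr] := cN k a b; exists r => // y /Hr H.
  rewrite -(subrK (N k p a b) (N k y a b)); apply: le_trans (ler_normD _ _) _; apply: lerD => //.
  apply: le_trans (norm_mx_coord _ _ _) _; rewrite (bigD1 k)//= lerDl; exact: sumr_ge0.
have NC k y : `|y - p| < r1 -> `|N k y| <= C.
  by move=> yr; apply/norm_mx_leP => // a b; exact: (Hr1 y yr (k, (a, b))).
pose P := n%:R * (2 * (m%:R * C)).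
have P0 : 0 <= P by rewrite !mulr_ge0.
(* The last bound makes the Lipschitz constant along a ray, at most [|x - p| * P], no larger than
   1/2. *)
pose tau := Num.min (Num.min sigma r1) (2^-1 / (P + 1)).
have P1 : 0 < P + 1 by rewrite ltr_wpDl.
have t0 : 0 < tau by rewrite !lt_min s0 r10 divr_gt0.
exists tau; first by rewrite t0 /= !ge_min lexx.
move=> x; rewrite !lt_min => /andP[/andP[xs xr] xP].
have rayB t : 0 <= t <= 1 -> `|ray p x t - p| <= `|x - p| by exact: ray_norm.
have SrayD t a b : 0 < t < 1 -> is_derive (t : R) 1 (fun t : R => S (ray p x t) a b)
    (\sum_i (x - p) 0 i * (N i (ray p x t) *m S (ray p x t) + S (ray p x t) *m (N i (ray p x t))^T) a b).
  move=> /andP[/ltW t1 /ltW t2]; have Bt : B (ray p x t).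
    by apply: le_lt_trans (rayB t _) xs; rewrite t1.
  have := Ck_line Bo (SC a b) Bt; congr is_derive; apply: eq_bigr => i _; congr (_ * _).
  exact: is_derive_partial (DS _ i Bt a b).
have S0 : `|S (ray p x 1)| <= 2 * 0.
  apply: (@small_gronwall R _ _ (fun t => S (ray p x t)) (fun t => \matrix_(a, b)
     (\sum_i (x - p) 0 i * (N i (ray p x t) *m S (ray p x t) + S (ray p x t) *m (N i (ray p x t))^T) a b))).
  - move=> a b t t01; apply: (@continuous_comp _ _ _ (ray p x) (fun y => S y a b)).
      exact: continuous_ray.
    by apply: Ck_cont (SC a b) _ _; apply: le_lt_trans (rayB t t01) xs.
  - by rewrite ray0.
  - by move=> t t01 a b; rewrite mxE; exact: SrayD.
  - move=> t /andP[/ltW t1 /ltW t2]; rewrite addr0.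
    have t01 : 0 <= t <= 1 by rewrite t1.
    have NCt i : `|N i (ray p x t)| <= C by apply: NC; exact: le_lt_trans (rayB t t01) xr.
    apply/norm_mx_leP => [|a b]; first by rewrite mulr_ge0.
    rewrite mxE; apply: le_trans (ler_norm_sum _ _ _) _.
    apply: (@le_trans _ _ (\sum_(i < n) `|x - p| * (2 * (m%:R * C) * `|S (ray p x t)|))).
      apply: ler_sum => i _; rewrite normrM; apply: ler_pM => //; first exact: norm_mx_coord.
      apply: le_trans (norm_mx_coord _ _ _) _; apply: le_trans (ler_normD _ _) _.
      have NT : `|(N i (ray p x t))^T| <= C.
        by apply/norm_mx_leP => // u v; rewrite mxE; apply: le_trans (norm_mx_coord _ _ _) (NCt i).
      have E1 : `|N i (ray p x t) *m S (ray p x t)| <= m%:R * (C * `|S (ray p x t)|).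
        by apply: le_trans (norm_mulmx _ _) _; rewrite ler_wpM2l// ler_wpM2r.
      have E2 : `|S (ray p x t) *m (N i (ray p x t))^T| <= m%:R * (C * `|S (ray p x t)|).
        by apply: le_trans (norm_mulmx _ _) _; rewrite ler_wpM2l// mulrC ler_wpM2r.
      by rewrite -!mulrA; move: E1 E2; lra.
    rewrite sumr_const card_ord -[leLHS]mulr_natl.
    rewrite [leLHS](_ : _ = `|x - p| * P * `|S (ray p x t)|); last by rewrite /P; ring.
    rewrite ler_wpM2r//.
    apply: (@le_trans _ _ (`|x - p| * (P + 1))); first by rewrite ler_wpM2l// lerDl.
    by move: (ltW xP); rewrite ler_pdivlMr.
  - by rewrite ler01 lexx.
by move: S0; rewrite mulr0 ray1 normr_le0 => /eqP.
Qed.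

End Poincare.

(** * Construction of the flat chart *)

Section Coordinates.
Variables (R : realType) (n : nat) (U : set 'rV[R]_n) (g : 'rV[R]_n -> 'M[R]_n).
Variable Gam : 'I_n -> 'I_n -> 'I_n -> 'rV[R]_n -> R.
Variable r : nat.
Hypotheses (Uo : open U) (gs : symmetric_on U g) (gC : form_Ck U g r.+1).
Hypothesis gr : constant_rank U g.
Hypothesis adG : adapted_symbols U g r.+1 Gam.
Hypothesis weak0 : weak_curvature_zero U g Gam.
Local Notation Gmx := (Gmx Gam).
Implicit Types (x : 'rV[R]_n).

Lemma minor_near m (f : 'I_m -> 'I_n) p : U p -> mxsub f f (g p) \in unitmx ->
  exists2 rho, 0 < rho & [set x | `|x - p| < rho] `<=` U /\
    forall x, `|x - p| < rho -> mxsub f f (g x) \in unitmx.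
Proof.
move=> Up uf; have dp : \det (mxsub f f (g p)) != 0 by rewrite -unitfE -unitmxE.
have dC : Ck U 0 (fun x => \det (mxsub f f (g x))).
  by apply: Ck_det => //; apply: Ckmx_sub => i j; exact: Ck_le (gC i j).
have e0 : 0 < `|\det (mxsub f f (g p))| / 2 by rewrite divr_gt0// normr_gt0.
have /continuous_epsP/(_ _ e0)[d d0 Hd] := Ck_cont dC Up.
have /nbhs_epsP[s s0 Hs] := open_near Uo Up.
exists (Num.min d s); first by rewrite lt_min d0.
split=> x /=; rewrite lt_min => /andP[xd xs]; first exact: Hs.
rewrite unitmxE unitfE; apply/negP => /eqP E; have := Hd x xd; rewrite E sub0r normrN.
by move: e0; lra.
Qed.

(* Completes the [m] functions [phi] by the coordinates not in the range of [f]. *)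
Definition complete_coord m (f : 'I_m -> 'I_n) (phi : 'I_m -> 'rV[R]_n -> R) x : 'rV[R]_n :=
  \row_i if [pick a | f a == i] is Some a then phi a x else x 0 i.

Lemma jacobian_complete m (f : 'I_m -> 'I_n) (phi : 'I_m -> 'rV[R]_n -> R) Phi x i s :
  (forall a k, is_derive x (bas k) (phi a) (Phi k a)) ->
  jacobian (complete_coord f phi) x i s =
    if [pick a | f a == i] is Some a then Phi s a else (i == s)%:R.
Proof.
move=> Hphi; rewrite mxE; apply: is_derive_partial.
apply: (@is_derive_ext _ _ (fun y => if [pick a | f a == i] is Some a then phi a y else y 0 i)).
  by move=> y; rewrite mxE.
case: pickP => [a _|_]; first exact: Hphi.
by have := is_derive_coord x (bas s) i; rewrite mxE eqxx.
Qed.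

(** The columns in the range of [f] kill the entries of a kernel vector there; after that the other
    columns are those of the identity. *)
Lemma complete_unit m (f : 'I_m -> 'I_n) (phi : 'I_m -> 'rV[R]_n -> R) (Phi : 'M[R]_(n, m)) x :
  (forall a k, is_derive x (bas k) (phi a) (Phi k a)) -> rowsub f Phi = 1%:M -> injective f ->
  jacobian (complete_coord f phi) x \in unitmx.
Proof.
move=> Hphi Phi1 fI; apply: unitmx_ker => v vJ.
have vf b : v 0 (f b) = 0.
  have := congr1 (fun M : 'rV[R]_n => M 0 (f b)) vJ; rewrite [LHS]mxE [RHS]mxE => <-.
  rewrite (bigD1 (f b))//= big1 => [|i ib]; rewrite (jacobian_complete _ _ _ Hphi).
    case: pickP => [a /eqP/fI ->|/(_ b)]; last by rewrite eqxx.
    by have /matrixP/(_ b b) := Phi1; rewrite !mxE eqxx => ->; rewrite mulr1 addr0.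
  case: pickP => [a /eqP fa|_]; last by rewrite (negPf ib) mulr0.
  have /matrixP/(_ b a) := Phi1; rewrite !mxE => ->.
  by rewrite -fa (inj_eq fI) eq_sym in ib; rewrite (negPf ib) mulr0.
apply/rowP => s; rewrite [RHS]mxE.
case: (pickP (fun a => f a == s)) => [a /eqP <-//|fs].
have := congr1 (fun M : 'rV[R]_n => M 0 s) vJ; rewrite [LHS]mxE [RHS]mxE => <-.
rewrite (bigD1 s)//= big1 => [|i is_]; rewrite (jacobian_complete _ _ _ Hphi).
  by case: pickP => [a|_]; [rewrite fs|rewrite eqxx mulr1 addr0].
by case: pickP => [a /eqP <-|_]; [rewrite vf mul0r|rewrite (negPf is_) mulr0].
Qed.

Lemma complete_rowsub m (f : 'I_m -> 'I_n) (phi : 'I_m -> 'rV[R]_n -> R) (Phi : 'M[R]_(n, m)) x :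
  (forall a k, is_derive x (bas k) (phi a) (Phi k a)) -> injective f ->
  rowsub f (jacobian (complete_coord f phi) x) = Phi^T.
Proof.
move=> Hphi fI; apply/matrixP => a s; rewrite [LHS]mxE [RHS]mxE (jacobian_complete _ _ _ Hphi).
by case: pickP => [b /eqP/fI ->//|/(_ a)]; rewrite eqxx.
Qed.

Lemma gram_algebra m (N G G0 Z : 'M[R]_m) :
  G *m N^T + N *m G - (N *m Z *m G0 *m Z^T + Z *m G0 *m (N *m Z)^T) =
  N *m (G - Z *m G0 *m Z^T) + (G - Z *m G0 *m Z^T) *m N^T.
Proof.
rewrite trmx_mul mulmxBr mulmxBl !mulmxA.
move: (N *m Z *m G0 *m _) (Z *m G0 *m _ *m _) (N *m G) (G *m N^T) => A1 A2 A3 A4.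
by apply/matrixP => a b; rewrite !mxE; ring.
Qed.

Lemma weak_flat_coordinates : has_flat_coordinates U g r.+2.
Proof.
have [_ GS _] := adG.
move=> p Up; pose m := \rank (g p).
have [f uf] : exists f : 'I_m -> 'I_n, mxsub f f (g p) \in unitmx := principal_minor (gs Up).
have [rho rho0 [BU fu]] := minor_near Up uf.
have gm x : U x -> \rank (g x) = m by move=> Ux; exact: gr.
have Bo := @open_norm_ball _ _ p rho.
have [sigma [Z [s0 srho Zp ZC DZ]]] := flat_frame Uo gs gC adG weak0 rho0 BU gm fu.
have Do := @open_norm_ball _ _ p sigma; set D := [set x | _] in ZC Do.
have DB x : D x -> `|x - p| < rho by move=> Dx; exact: lt_le_trans Dx srho.
have Dp : D p by rewrite /D /= subrr normr0.
pose Phi x := Lf g f x *m Z x.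
have LC : Ckmx D r.+1 (Lf g f).
  by move=> i a; apply: Ck_subset (Ckmx_Lf gC Bo BU fu i a) => x; exact: DB.
have PhiC : Ckmx D r.+1 Phi by exact: Ckmx_mul.
have dPhi x k : D x -> is_derive_mx x (bas k) Phi ((Gmx k x)^T *m Phi x).
  move=> Dx; have := is_derive_mx_mul (dLf gs gC adG Bo BU gm fu k (DB x Dx)) (DZ x k Dx).
  congr is_derive_mx; rewrite mulmxBl /Phi !mulmxA subrK.
  by [].
have phi_exists a : exists ph : 'rV[R]_n -> R, forall x k, `|x - p| < sigma / 4 ->
    is_derive x (bas k) ph (Phi x k a).
  apply: (@poincare _ _ p sigma (fun k x => Phi x k a)) => //.
    by move=> i; exact: Ck_le (PhiC i a).
  (* The columns of [Phi] are parallel one-forms, and they are closed because the symbols are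
     symmetric in the lower indices. *)
  move=> i k x Dx; rewrite (is_derive_partial (dPhi x k Dx i a)) (is_derive_partial (dPhi x i Dx k a)).
  rewrite [LHS]mxE [RHS]mxE; apply: eq_bigr => s _; congr (_ * _).
  rewrite [LHS]mxE [RHS]mxE [LHS]mxE [RHS]mxE; apply: GS; apply: BU; exact: DB.
have [phi Hphi] := choice phi_exists.
pose S x := Gf g f x - Z x *m Gf g f p *m (Z x)^T.
have GC : Ckmx D r.+1 (Gf g f).
  by apply: Ckmx_sub => i a; apply: Ck_subset (gC i a) => x /DB; exact: BU.
have [||||tau /andP[tau0 taus] S0] := @transport_zero _ _ p m sigma S (Nf g Gam f) s0.
- move=> a b; have H := Ckmx_mul Do (Ckmx_mul Do ZC (Ckmx_cst r.+1 (Gf g f p) Do)) (Ckmx_tr ZC) a b.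
  apply: (@Ck_le _ _ _ _ r.+1) => //; apply: Ck_ext (Ck_sub Do (GC a b) H) => // x _.
  by rewrite [RHS]mxE [X in _ = _ + X]mxE.
- by rewrite /S Zp trmx1 mul1mx mulmx1 subrr.
- move=> k a b; apply: (Ck_cont (Ckmx_Nf gC adG Bo BU fu k a b)).
  by rewrite /= subrr normr0.
- move=> x k Dx; have DG := dGf gs gC adG BU gm fu k (DB x Dx).
  have DZZ := is_derive_mx_mul (is_derive_mx_mul (DZ x k Dx) (is_derive_mx_cst x (bas k) (Gf g f p)))
     (is_derive_mx_tr (DZ x k Dx)).
  have := is_derive_mx_sub DG DZZ; congr is_derive_mx.
  rewrite /S mulmx0 addr0; exact: gram_algebra.
pose E := [set x | `|x - p| < Num.min (sigma / 4) tau].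
have Eo : open E by exact: open_norm_ball.
have E1 x : E x -> `|x - p| < sigma / 4 by rewrite /E /= lt_min => /andP[].
have E2 x : E x -> `|x - p| < tau by rewrite /E /= lt_min => /andP[].
have ED x : E x -> D x by move=> /E2 H; exact: lt_le_trans H taus.
have Ep : E p by rewrite /E /= subrr normr0 lt_min tau0 divr_gt0.
have EU : E `<=` U by move=> x /ED/DB /BU.
have rL : rowsub f (Lf g f p) = 1%:M by apply: (rowsub_Lf fu) => /=; rewrite subrr normr0.
have fI : injective f.
  (* A repeated index would give two equal rows of the identity matrix [rowsub f (Lf g f p)]. *)
  move=> a b fab; apply/eqP; apply: contraT => ab.
  have /matrixP H := rL; move: (H a a) (H b a).
  rewrite [rowsub _ _ _ _]mxE [rowsub _ _ _ _]mxE fab [1%:M _ _]mxE eqxx => ->.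
  by rewrite mxE eq_sym (negPf ab) => /eqP; rewrite oner_eq0.
pose ph := complete_coord f phi.
have phC i : Ck E r.+2 (fun x => ph x 0 i).
  under eq_fun do rewrite mxE; case: pickP => [a _|_]; last exact: Ck_coord.
  apply: (@Ck_build _ _ _ _ _ (fun k x => Phi x k a)) => //.
    by move=> x k /E1; exact: Hphi.
  by move=> k; apply: Ck_subset (PhiC k a) => x; exact: ED.
have Jp : jacobian ph p \in unitmx.
  apply: (complete_unit (Phi := Phi p)) => //; first by move=> a k; apply: Hphi; exact: E1.
  by rewrite /Phi Zp mulmx1.
(* The minor at [p] placed at the indices [f] and padded by zeros: the added coordinates do not
   enter [g]. *)
pose c := (rowsub f 1%:M)^T *m Gf g f p *m rowsub f (1%:M : 'M[R]_n).
have gE x : E x -> g x = (jacobian ph x)^T *m c *m jacobian ph x.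
  move=> Ex; have Dx := ED x Ex.
  have rJ := complete_rowsub (fun a k => Hphi a x k (E1 x Ex)) fI.
  rewrite /c !mulmxA -trmx_mul -rowsubE -mulmxA -rowsubE rJ trmxK.
  have /eqP := S0 x (E2 x Ex); rewrite subr_eq0 => /eqP GE.
  rewrite [LHS](g_factor gs BU gm fu (DB x Dx)) GE /Phi.
  by move: (Lf g f x) (Z x) (Gf g f p) => L0 Z0 G0; rewrite trmx_mul !mulmxA.
have [V [W [psi [[Vo Vp VE Wo] VW WV psiC Hpsi]]]] := inverse_function Eo phC Ep Jp.
exists V, W, ph, psi, c; split => //.
- by split => // x /VE /EU.
- by move=> i; split => //; apply: Ck_subset (phC i).
move=> y a b Wy; have [Vy _] := WV y Wy; have [uJ dpsi] := Hpsi y Wy.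
set J := jacobian ph (psi y) in uJ dpsi.
have -> : c a b = ((invmx J)^T *m g (psi y) *m invmx J) a b.
  rewrite (gE _ (VE _ Vy)) -/J !mulmxA -trmx_mul mulmxV// trmx1 mul1mx -mulmxA mulmxV//.
  by rewrite mulmx1.
rewrite exchange_big [RHS]mxE; apply: eq_bigr => j _.
rewrite [X in _ = X * _]mxE mulr_suml; apply: eq_bigr => i _.
by rewrite !dpsi [_^T _ _]mxE (mulrC (g _ _ _)).
Qed.

End Coordinates.

Theorem theorem2p9 (R : realType) (n r : nat) (U : set 'rV[R]_n)
    (g : 'rV[R]_n -> 'M[R]_n)
    (r_ge1 : (1 <= r)%N)
    (U_domain : domain_set U)
    (g_sym : symmetric_on U g)
    (g_Cr : form_Ck U g r)
    (g_rank : constant_rank U g)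
    (g_radical : forall x, U x -> forall v, radical g x v ->
       forall i j : 'I_n, \sum_s christoffel1 g i j s x * v 0 s = 0) :
  (exists Gam : 'I_n -> 'I_n -> 'I_n -> 'rV[R]_n -> R,
     adapted_symbols U g r Gam) /\
  (forall Gam : 'I_n -> 'I_n -> 'I_n -> 'rV[R]_n -> R,
     adapted_symbols U g r Gam ->
     (has_flat_coordinates U g r.+1 <-> curvature_zero U g r Gam)).
Proof.
case: U_domain => Uo _ U0; case: r r_ge1 g_Cr => // r _ gC.
split; first exact: adapted_exist.
move=> Gam adG; have weakE : curvature_zero U g r.+1 Gam <-> weak_curvature_zero U g Gam.
  (* In class C^1 the curvature condition is the weak one by definition. *)
  case: r gC adG => [|r] gC adG //.
  by apply: iff_sym; exact: (weak_strong Uo g_sym gC adG).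
split=> [/(flat_weak Uo g_sym gC adG) H|/weakE.1 H]; first exact: weakE.2.
exact: (weak_flat_coordinates Uo g_sym gC g_rank adG).
Qed.
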